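(* Let $n$ be a positive integer, $0<p\leq q<\infty$, let $\mathbf{u}=(u_0,u_1,\dots,u_n)$ with each $u_k\in H(\mathbb{D})$, and let $\mu$ be a positive Borel measure on $\mathbb{D}$. Then: (a) $\mu$ is a $(\mathbf{u},p,q)$-Sobolev Carleson measure if and only if, for each $0\leq k\leq n$, the measure $|u_k|^q\,d\mu$ is a $(k,p,q)$-Carleson measure; (b) $\mu$ is a vanishing $(\mathbf{u},p,q)$-Sobolev Carleson measure if and only if, for each $0\leq k\leq n$, the measure $|u_k|^q\,d\mu$ is a vanishing $(k,p,q)$-Carleson measure.
   Context: $\mathbb{D}$ is the open unit disc, $H(\mathbb{D})$ the space of analytic functions on $\mathbb{D}$, $dA=\frac{dx\,dy}{\pi}$ normalized area measure. For $0<p<\infty$, the Bergman space $A^p$ consists of $f\in H(\mathbb{D})$ with $\|f\|_p^p=\int_{\mathbb{D}}|f|^p\,dA<\infty$. For an integer $k\geq0$, a positive Borel measure $\nu$ on $\mathbb{D}$ is a $(k,p,q)$-Carleson measure if there is $C>0$ with $\int_{\mathbb{D}}|f^{(k)}|^q\,d\nu\leq C\|f\|_p^q$ for all $f\in A^p$; it is a vanishing $(k,p,q)$-Carleson measure if $\int_{\mathbb{D}}|f_j^{(k)}|^q\,d\nu\to0$ whenever $\{f_j\}$ is a bounded sequence in $A^p$ converging to $0$ uniformly on compact subsets of $\mathbb{D}$. Writing $\langle\mathbf{u},\mathcal{D}f\rangle=u_0f+u_1f'+\cdots+u_nf^{(n)}$, $\mu$ is a $(\mathbf{u},p,q)$-Sobolev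 Carleson measure if there is $C>0$ with $\int_{\mathbb{D}}|\langle\mathbf{u}(z),\mathcal{D}f(z)\rangle|^q\,d\mu(z)\leq C\|f\|_p^q$ for all $f\in A^p$, and a vanishing $(\mathbf{u},p,q)$-Sobolev Carleson measure if $\int_{\mathbb{D}}|\langle\mathbf{u},\mathcal{D}f_j\rangle|^q\,d\mu\to0$ whenever $\{f_j\}$ is bounded in $A^p$ and converges to $0$ uniformly on compact subsets of $\mathbb{D}$. *)

(* Defs.v *)
From HB Require Import structures.
From mathcomp Require Import all_boot all_order all_algebra.
From mathcomp Require Import all_classical all_reals all_analysis.
From mathcomp Require Import complex.
Import Order.TTheory GRing.Theory Num.Theory.
Import numFieldNormedType.Exports.

Set Implicit Arguments.
Unset Strict Implicit.
Unset Printing Implicit Defensive.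

Local Open Scope ring_scope.
Local Open Scope complex_scope.
Local Open Scope classical_set_scope.

Section Defs.
Variable R : realType.

(* The plane R^2 with its Borel (= product Borel) sigma-algebra. *)
Definition plane := (measurableTypeR R * measurableTypeR R)%type.

Definition toC (x : plane) : R[i] := x.1 +i* x.2.

Definition cabs (z : R[i]) : R := Normc.normc z.

Definition discC : set R[i] := [set z | cabs z < 1].
Definition disc : set plane := [set x | cabs (toC x) < 1].

Definition holo (f : R[i] -> R[i]) : Prop :=
  forall z, discC z -> derivable (f : R[i]^o -> R[i]^o) z 1.

Definition cder (k : nat) (f : R[i] -> R[i]) : R[i] -> R[i] :=
  derive1n (V := R[i]^o) k (f : R[i]^o -> R[i]^o).

Definition area : set plane -> \bar R :=
  (@lebesgue_measure R \x @lebesgue_measure R)%E.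

(* int_D |f|^p dA, with dA = dx dy / pi. *)
Definition bergman_int (p : R) (f : R[i] -> R[i]) : \bar R :=
  ((\int[area]_(x in disc) (powR (cabs (f (toC x))) p)%:E) * (pi^-1)%:E)%E.

Definition bergman (p : R) (f : R[i] -> R[i]) : Prop :=
  holo f /\ (bergman_int p f < +oo)%E.

Definition bnorm (p : R) (f : R[i] -> R[i]) : R :=
  powR (fine (bergman_int p f)) p^-1.

Definition der_int (nu : {measure set plane -> \bar R}) (k : nat) (q : R)
    (f : R[i] -> R[i]) : \bar R :=
  (\int[nu]_(x in disc) (powR (cabs (cder k f (toC x))) q)%:E)%E.

Definition carleson (k : nat) (p q : R) (nu : {measure set plane -> \bar R}) :=
  exists2 C : R, 0 < C &
    forall f, bergman p f ->
      (der_int nu k q f <= (C * powR (bnorm p f) q)%:E)%E.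

Definition ucc_to0 (fs : nat -> R[i] -> R[i]) : Prop :=
  forall K : set R[i]^o, compact K -> K `<=` discC ->
    forall e : R, 0 < e ->
      \forall j \near \oo, forall z, K z -> cabs (fs j z) < e.

Definition bounded_seq (p : R) (fs : nat -> R[i] -> R[i]) : Prop :=
  (forall j, bergman p (fs j)) /\ exists M : R, forall j, bnorm p (fs j) <= M.

Definition vcarleson (k : nat) (p q : R) (nu : {measure set plane -> \bar R}) :=
  forall fs : nat -> R[i] -> R[i], bounded_seq p fs -> ucc_to0 fs ->
    (der_int nu k q (fs j)) @[j --> \oo] --> 0%E.

Definition sob_op (n : nat) (u : nat -> R[i] -> R[i]) (f : R[i] -> R[i])
    (z : R[i]) : R[i] :=
  \sum_(k < n.+1) u k z * cder k f z.

Definition sob_int (mu : {measure set plane -> \bar R}) (n : nat)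
    (u : nat -> R[i] -> R[i]) (q : R) (f : R[i] -> R[i]) : \bar R :=
  (\int[mu]_(x in disc) (powR (cabs (sob_op n u f (toC x))) q)%:E)%E.

Definition sob_carleson (n : nat) (u : nat -> R[i] -> R[i]) (p q : R)
    (mu : {measure set plane -> \bar R}) :=
  exists2 C : R, 0 < C &
    forall f, bergman p f ->
      (sob_int mu n u q f <= (C * powR (bnorm p f) q)%:E)%E.

Definition sob_vcarleson (n : nat) (u : nat -> R[i] -> R[i]) (p q : R)
    (mu : {measure set plane -> \bar R}) :=
  forall fs : nat -> R[i] -> R[i], bounded_seq p fs -> ucc_to0 fs ->
    (sob_int mu n u q (fs j)) @[j --> \oo] --> 0%E.

End Defs.

(* Main.v *)
(* The functions [tfun b d M z = (d / (b - z))^M], with [|b| = 1 + d], satisfy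
   [tfun^(k) = M (M + 1) ... (M + k - 1) d^(-k) (d / (b - z))^(M + k)], and their
   norm in A^p is at most a constant times [d^(2/p)] as soon as [M p >= 4]. Taking
   [M = N, ..., N + n] gives a linear system for the numbers
   [u_k(z) d^(-k) (d / (b - z))^k] whose matrix of rising factorials is invertible
   and does not depend on [b], [d] and [z]. Hence on the disc of centre [b] and
   radius [4 d] each [|u_k|] is bounded by [d^k] times the sum of the values of the
   Sobolev operator at the test functions, so that the measure |u_k|^q d(mu) of
   that disc is at most a constant times [d^((k + 2/p) q)], with an arbitrarily
   small constant as [d] tends to 0 in the vanishing case.

   Conversely, such a bound for the balls B(y, (1 - |y|) / 2) implies the
   (k, p, q)-Carleson inequality when p <= q: bound |f^(k)(x)|^p by the mean of
   |f|^p over a ball around x (subharmonicity and Cauchy's estimates), estimate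
   the factor |f^(k)|^(q - p) by the norm of f, and exchange the integrals. In the
   vanishing case this is applied to an annulus near the unit circle, the rest of
   the disc being compact. Cauchy's theory is derived from Goursat's theorem on
   rectangles. *)
Require Import Defs.
From HB Require Import structures.
From mathcomp Require Import all_boot all_order all_algebra.
From mathcomp Require Import all_classical all_reals all_analysis.
From mathcomp Require Import measurable_realfun complex.
From mathcomp Require Import ring lra.
Import Order.TTheory GRing.Theory Num.Theory.
Import numFieldNormedType.Exports.

Set Implicit Arguments.
Unset Strict Implicit.
Unset Printing Implicit Defensive.

Local Open Scope ring_scope.
Local Open Scope complex_scope.
Local Open Scope classical_set_scope.

(** * Absolute value and complex differentiability *)

Section CAbs.
Variable R : realType.
Implicit Types (z w : R[i]) (f g : R[i] -> R[i]).

(** A single test function only controls the sum of the terms [u_k f^(k)], in which cancellation is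
    possible; several exponents with the same pole [b] separate the terms. The pole is put outside
    the disc, as far from the unit circle as the point under study, so that [|d / (b - z)|] is at
    most 1 on the disc and at least 1/4 on the ball of radius [4 d] around [b]. The condition
    [M p >= 4] comes from bounding a radial function by a product of two Poisson kernels, one in
    each coordinate, whose integrals are arctangents. Rectangles and Tonelli's theorem replace polar
    coordinates throughout, also in the mean value inequality, at the price of constants that are
    not sharp. Exchanging the integrals requires a sigma-finite measure, whereas [mu] is arbitrary.
    In the passage from the Sobolev condition to the Carleson conditions, the finiteness of |u_k|^q
    d(mu) on the disc is itself deduced from test functions, those with [b = 2] and [d = 1]. *)

Lemma normcE_cabs z : `|z| = (cabs z)%:C.
Proof. by []. Qed.

Lemma cabs_ge0 z : 0 <= cabs z.
Proof. by case: z => a b; rewrite /cabs /=; exact: sqrtr_ge0. Qed.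
Lemma cabs0 : cabs (0 : R[i]) = 0. Proof. exact: Normc.normc0. Qed.
Lemma cabs1 : cabs (1 : R[i]) = 1. Proof. exact: Normc.normc1. Qed.
Lemma cabsM z w : cabs (z * w) = cabs z * cabs w.
Proof. exact: Normc.normcM. Qed.
Lemma cabsV z : cabs z^-1 = (cabs z)^-1.
Proof. exact: Normc.normcV. Qed.
Lemma cabsN z : cabs (- z) = cabs z.
Proof. exact: normcN. Qed.
Lemma cabsD z w : cabs (z + w) <= cabs z + cabs w.
Proof. exact: le_normcD. Qed.
Lemma cabsBC z w : cabs (z - w) = cabs (w - z).
Proof. by rewrite -cabsN opprB. Qed.
Lemma cabsB_ge z w : cabs z - cabs w <= cabs (z - w).
Proof. by rewrite lerBlDr -{1}(subrK w z); exact: cabsD. Qed.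
Lemma cabs_eq0 z : (cabs z == 0) = (z == 0).
Proof.
apply/eqP/eqP => [/Normc.eq0_normc //|->]; exact: cabs0.
Qed.
Lemma cabs_gt0 z : (0 < cabs z) = (z != 0).
Proof. by rewrite lt_def cabs_ge0 andbT cabs_eq0. Qed.
Lemma cabsX z n : cabs (z ^+ n) = cabs z ^+ n.
Proof. by elim: n => [|n IH]; rewrite ?cabs1 // !exprS cabsM IH. Qed.
Lemma cabsR (x : R) : cabs x%:C = `|x|.
Proof. by rewrite /cabs /= expr0n addr0 sqrtr_sqr. Qed.
Lemma cabs_i : cabs ('i : R[i]) = 1.
Proof. by rewrite /cabs /= expr0n expr1n add0r sqrtr1. Qed.
Lemma cabs_triangle z w v : cabs (z - v) <= cabs (z - w) + cabs (w - v).
Proof. by rewrite -{1}(subrK w z) -addrA; exact: cabsD. Qed.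
Lemma cabs_sum (I : Type) (r : seq I) (P : pred I) (F : I -> R[i]) :
  cabs (\sum_(i <- r | P i) F i) <= \sum_(i <- r | P i) cabs (F i).
Proof.
elim/big_ind2 : _ => [|x1 x2 y1 y2 h1 h2|//]; first by rewrite cabs0.
by rewrite (le_trans (cabsD _ _))// lerD.
Qed.
Lemma cabs_sqr z : cabs z ^+ 2 = complex.Re z ^+ 2 + complex.Im z ^+ 2.
Proof. by case: z => a b; rewrite /cabs /= sqr_sqrtr// addr_ge0// sqr_ge0. Qed.
Lemma normRe_cabs z : `|complex.Re z| <= cabs z.
Proof.
rewrite -sqrtr_sqr; case: z => a b; rewrite /cabs /=.
by rewrite ler_wsqrtr// lerDl sqr_ge0.
Qed.
Lemma normIm_cabs z : `|complex.Im z| <= cabs z.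
Proof.
rewrite -sqrtr_sqr; case: z => a b; rewrite /cabs /=.
by rewrite ler_wsqrtr// lerDr sqr_ge0.
Qed.
Lemma cabs_ReIm z : cabs z <= `|complex.Re z| + `|complex.Im z|.
Proof.
rewrite -ler_sqr ?nnegrE ?cabs_ge0 ?addr_ge0// cabs_sqr sqrrD.
by rewrite !real_normK ?num_real// addrAC lerDl mulrn_wge0// mulr_ge0.
Qed.

(** The norm of [R[i]] takes its values in [R[i]], so that radii of neighbourhoods are complex
    numbers; the order of [R[i]] forces a positive one to be real. *)
Lemma gt0_complex (e : R[i]) : 0 < e -> 0 < complex.Re e /\ e = (complex.Re e)%:C.
Proof. by case: e => a b; rewrite ltcE /= => /andP[/eqP-> a0]; split. Qed.

Lemma complex_gt0 (x : R) : ((0 : R[i]) < x%:C) = (0 < x).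
Proof. by rewrite ltcE /= eqxx. Qed.

Definition ccont (f : R[i] -> R[i]) (z : R[i]) : Prop :=
  {for z, continuous (f : R[i]^o -> R[i]^o)}.

Lemma ccontP f z : ccont f z <->
  forall e : R, 0 < e -> exists2 d : R, 0 < d &
    forall w, cabs (w - z) < d -> cabs (f w - f z) < e.
Proof.
rewrite /ccont /prop_for /continuous_at; split.
- move=> /(cvgrPdist_lt (F := nbhs (z : R[i]^o))) h e e0.
  have /h : (0 : R[i]) < e%:C by rewrite complex_gt0.
  rewrite -nbhs_nearE => /nbhs_ballP[d /= /gt0_complex[d0 ->] hd]; exists (complex.Re d) => // w wd.
  have /hd : ball (z : R[i]^o) (complex.Re d)%:C w.
    by rewrite -ball_normE /= normcE_cabs cabsBC ltcR.
  by rewrite /= normcE_cabs cabsBC ltcR.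
- move=> h; apply/(cvgrPdist_lt (F := nbhs (z : R[i]^o))) => e /gt0_complex[e0 ->].
  have [d d0 hd] := h _ e0.
  rewrite -nbhs_nearE; apply/nbhs_ballP; exists d%:C => /=; first by rewrite complex_gt0.
  move=> w; rewrite -ball_normE /= normcE_cabs ltcR cabsBC => /hd.
  by rewrite normcE_cabs cabsBC ltcR.
Qed.

(** Derivative without division: the inequality makes sense at [w = z] too, so no punctured
    neighbourhood occurs and remainders can be estimated directly, as in [Goursat]. *)
Definition has_cder f z l : Prop :=
  forall e : R, 0 < e -> exists2 d : R, 0 < d &
    forall w, cabs (w - z) < d -> cabs (f w - f z - l * (w - z)) <= e * cabs (w - z).

Definition cderivable f z := derivable (f : R[i]^o -> R[i]^o) z 1.

Lemma cderS k f : cder k.+1 f = cder 1 (cder k f).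
Proof. by []. Qed.

(** The quotient inside [derive1], so that [cder1E] holds by conversion. *)
Definition dquot f z (h : R[i]^o) : R[i]^o := h^-1 * (f (h + z) - f z).

Lemma cder1E f z : cder 1 f z = lim (dquot f z @ (0 : R[i]^o)^').
Proof. by []. Qed.

Lemma cderivableE f z :
  cderivable f z = cvg (dquot f z @ (0 : R[i]^o)^').
Proof.
have <- : (fun h : R[i]^o => h^-1 *: ((f : R[i]^o -> R[i]^o)
    (h *: (1 : R[i]^o) + z) - f z)) = dquot f z.
  by apply/funext => h; rewrite /dquot /GRing.scale /= mulr1.
by [].
Qed.

Lemma dquot_cvgP f z (l : R[i]) :
  dquot f z @ (0 : R[i]^o)^' --> (l : R[i]^o) <-> has_cder f z l.
Proof.
split=> [/(cvgrPdist_lt (F := (0 : R[i]^o)^')) h e e0|h].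
- have /h : (0 : R[i]) < e%:C by rewrite complex_gt0.
  rewrite -nbhs_nearE => /nbhs_ballP[d /= /gt0_complex[d0 ->] hd].
  exists (complex.Re d) => // w wd.
  have [->|wz] := eqVneq w z; first by rewrite !subrr mulr0 subr0 cabs0 mulr0.
  have /hd : ball (0 : R[i]^o) (complex.Re d)%:C (w - z).
    by rewrite -ball_normE /= normcE_cabs sub0r cabsN ltcR.
  have wz0 : w - z != 0 by rewrite subr_eq0.
  move=> /(_ wz0); rewrite normcE_cabs ltcR /dquot subrK => H; rewrite cabsBC in H.
  have -> : f w - f z - l * (w - z) = ((w - z)^-1 * (f w - f z) - l) * (w - z).
    by field.
  by rewrite cabsM ler_pM2r ?cabs_gt0// ltW.
- apply/(cvgrPdist_lt (F := (0 : R[i]^o)^')) => e /gt0_complex[e0 ->].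
  have [d d0 hd] := h (complex.Re e / 2) (divr_gt0 e0 (ltr0n _ 2)).
  rewrite -nbhs_nearE; apply/nbhs_ballP; exists d%:C => /=; first by rewrite complex_gt0.
  move=> v; rewrite -ball_normE /= normcE_cabs ltcR sub0r cabsN => vd v0.
  rewrite normcE_cabs ltcR /dquot cabsBC.
  have := hd (v + z); rewrite addrK => /(_ vd) H.
  have -> : v^-1 * (f (v + z) - f z) - l = v^-1 * (f (v + z) - f z - l * v) by field.
  rewrite cabsM cabsV mulrC ltr_pdivrMr ?cabs_gt0//.
  apply: (le_lt_trans H); rewrite ltr_pM2r ?cabs_gt0//.
  by rewrite ltr_pdivrMr// ltr_pMr// ltr1n.
Qed.

Lemma cderivable_has f z : cderivable f z -> has_cder f z (cder 1 f z).
Proof. by rewrite cderivableE cder1E => h; apply/dquot_cvgP. Qed.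

Lemma has_cder_derive f z l : has_cder f z l -> cderivable f z /\ cder 1 f z = l.
Proof.
move=> /dquot_cvgP h; rewrite cderivableE cder1E; split; first by apply/cvg_ex; exists l.
exact: cvg_lim h.
Qed.

Lemma cderivable_cont f z : cderivable f z -> ccont f z.
Proof.
by move=> h; apply: differentiable_continuous; apply/derivable1_diffP.
Qed.

End CAbs.

Section Rules.
Variable R : realType.
Implicit Types (z w c : R[i]) (f g : R[i] -> R[i]).

Lemma has_cderM f g z l m : has_cder f z l -> has_cder g z m ->
  has_cder (fun w => f w * g w) z (f z * m + g z * l).
Proof.
move=> /has_cder_derive[df <-] /has_cder_derive[dg <-].
have [H1 H2] : cderivable (fun w => f w * g w) z /\ 
   cder 1 (fun w => f w * g w) z = (f z * cder 1 g z + g z * cder 1 f z).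
  split.
  - exact: (@derivableM _ (R[i]^o) f g z 1 df dg).
  - have := (@deriveM _ (R[i]^o) f g z 1 df dg).
    rewrite -!derive1E. exact.
by rewrite -H2; apply: cderivable_has.
Qed.

Lemma has_cderV f z l : f z != 0 -> has_cder f z l ->
  has_cder (fun w => (f w)^-1) z (- (f z) ^- 2 * l).
Proof.
move=> fz0 /has_cder_derive[df <-].
have [H1 H2] : cderivable (fun w => (f w)^-1) z /\ 
   cder 1 (fun w => (f w)^-1) z = (- (f z) ^- 2 * cder 1 f z).
  split.
  - exact: (@derivableV _ (R[i]^o) f z 1 fz0 df).
  - have := (@deriveV _ (R[i]^o) f z 1 fz0 df).
    rewrite -!derive1E. exact.
by rewrite -H2; apply: cderivable_has.
Qed.

Lemma has_cder_cst c z : has_cder (fun=> c) z 0.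
Proof.
move=> e e0; exists 1 => // w _.
by rewrite subrr mul0r subr0 cabs0 mulr_ge0// ?cabs_ge0 ?ltW.
Qed.

Lemma has_cder_id z : has_cder id z 1.
Proof.
move=> e e0; exists 1 => // w _.
by rewrite mul1r subrr cabs0 mulr_ge0// ?cabs_ge0 ?ltW.
Qed.

Lemma has_cderD f g z l m : has_cder f z l -> has_cder g z m ->
  has_cder (fun w => f w + g w) z (l + m).
Proof.
move=> hf hg e e0; have e20 : 0 < e / 2 by rewrite divr_gt0.
have [d1 d10 h1] := hf _ e20; have [d2 d20 h2] := hg _ e20.
exists (Num.min d1 d2); first by rewrite lt_min d10.
move=> w; rewrite lt_min => /andP[/h1 {}h1 /h2 {}h2].
have -> : f w + g w - (f z + g z) - (l + m) * (w - z) =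
  (f w - f z - l * (w - z)) + (g w - g z - m * (w - z)) by ring.
rewrite (le_trans (cabsD _ _))// (le_trans (lerD h1 h2))//.
by rewrite -mulrDl -splitr.
Qed.

Lemma has_cderZ c f z l : has_cder f z l -> has_cder (fun w => c * f w) z (c * l).
Proof.
by move=> h; have := has_cderM (has_cder_cst c z) h; rewrite mulr0 addr0.
Qed.

Lemma has_cderN f z l : has_cder f z l -> has_cder (fun w => - f w) z (- l).
Proof.
move=> /(has_cderZ (-1)); rewrite mulN1r.
by under eq_fun do rewrite mulN1r.
Qed.

Lemma has_cderB f g z l m : has_cder f z l -> has_cder g z m ->
  has_cder (fun w => f w - g w) z (l - m).
Proof. by move=> hf /has_cderN; exact: has_cderD. Qed.

Lemma has_cderX f z l n : has_cder f z l ->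
  has_cder (fun w => f w ^+ n) z (n%:R * f z ^+ n.-1 * l).
Proof.
move=> h; elim: n => [|n IH].
  rewrite !mul0r; under eq_fun do rewrite expr0; exact: has_cder_cst.
have := has_cderM h IH; under eq_fun do rewrite -exprS.
congr (has_cder _ _ _); rewrite /=; case: n {IH} => [|n] /=; first by rewrite expr0; ring.
by rewrite !exprS -[n.+2]addn1 natrD; ring.
Qed.

Lemma has_cder_near f g z l : (exists2 d : R, 0 < d & forall w, cabs (w - z) < d -> f w = g w) ->
  has_cder f z l -> has_cder g z l.
Proof.
move=> [d d0 fg] hf e e0; have [d' d'0 h] := hf e e0.
exists (Num.min d d'); first by rewrite lt_min d0.
move=> w; rewrite lt_min => /andP[wd /h]; rewrite (fg w wd) (fg z) //.
by rewrite subrr cabs0.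
Qed.

(** Lets the factor [2 i pi] of Cauchy's formula be dropped from upper bounds. *)
Lemma cabs_2ipi_ge1 : 1 <= cabs (2 * 'i * pi%:C : R[i]).
Proof.
rewrite !cabsM cabs_i -[2 : R[i]](rmorph_nat (real_complex R)) !cabsR mulr1 normr_nat ger0_norm
  ?pi_ge0//.
by have := pi_ge2 R; lra.
Qed.

Lemma discC_ball (z : R[i]) w : discC z -> cabs (w - z) < 1 - cabs z -> discC w.
Proof.
rewrite /discC /= => z1 h; rewrite -[w](subrK z).
by apply: (le_lt_trans (cabsD _ _)); lra.
Qed.

Lemma has_cder_eq_disc f g z l : (forall w, discC w -> f w = g w) -> discC z ->
  has_cder f z l -> has_cder g z l.
Proof.
move=> fg zD; apply: has_cder_near; exists (1 - cabs z); first by rewrite subr_gt0.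
by move=> w /(discC_ball zD) /fg.
Qed.

(** A derivative at a point of the disc depends only on values in the disc, which is open; a chain
    of functions, each the derivative of the preceding one there, thus determines every [cder k f]
    on the disc. *)
Lemma cder_has_disc k f (F : nat -> R[i] -> R[i]) :
  (forall w, discC w -> F 0 w = f w) ->
  (forall j w, discC w -> has_cder (F j) w (F j.+1 w)) ->
  forall w, discC w -> cder k f w = F k w.
Proof.
move=> F0 FS; elim: k => [|k IH] w wD; first by rewrite F0.
rewrite cderS; apply: (has_cder_derive (l := F k.+1 w) _).2.
by apply: (has_cder_eq_disc _ wD (FS k w wD)) => v vD; rewrite IH.
Qed.

Lemma has_cder_cont f z l : has_cder f z l -> ccont f z.
Proof. by move=> /has_cder_derive[? _]; exact: cderivable_cont. Qed.

End Rules.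

(** * Line integrals, Goursat's theorem and Cauchy's formula *)

Section CInt.
Variable R : realType.
Implicit Types (g : R -> R[i]) (c : R[i]) (a b m : R).
Local Notation leb := (@lebesgue_measure R).

Definition cint g a b : R[i] :=
  (\int[leb]_(x in `[a, b]) complex.Re (g x)) +i*
  (\int[leb]_(x in `[a, b]) complex.Im (g x)).

Definition cintegrable g a b : Prop :=
  leb.-integrable `[a, b] (EFin \o (fun x => complex.Re (g x))) /\
  leb.-integrable `[a, b] (EFin \o (fun x => complex.Im (g x))).

Definition rcont g (x : R) := forall e : R, 0 < e -> exists2 d : R, 0 < d &
  forall y, `|y - x| < d -> cabs (g y - g x) < e.

Lemma rcont_cintegrable g a b : (forall x, a <= x <= b -> rcont g x) ->
  cintegrable g a b.
Proof.
move=> h; have H (p : R[i] -> R) : {morph p : x y / x - y} -> (forall z, `|p z| <= cabs z) ->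
    leb.-integrable `[a, b] (EFin \o (fun x => p (g x))).
  move=> pB ple; apply: continuous_compact_integrable; first exact: segment_compact.
  apply: continuous_in_subspaceT => x /set_mem; rewrite /= in_itv /= => xab.
  apply/cvgrPdist_lt => e /(h x xab)[d d0 hd].
  apply/nbhs_normP; exists d => // y.
  rewrite /ball_ /= distrC => /hd H; rewrite -pB.
  by rewrite (le_lt_trans (ple _))// cabsBC.
by split; apply: H; [case=> ? ? []| exact: normRe_cabs|case=> ? ? []|exact: normIm_cabs].
Qed.

Lemma cintD g1 g2 a b : cintegrable g1 a b -> cintegrable g2 a b ->
  cint (fun x => g1 x + g2 x) a b = cint g1 a b + cint g2 a b.
Proof.
move=> [r1 i1] [r2 i2]; rewrite /cint.
under eq_Rintegral do rewrite raddfD /=.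
rewrite RintegralD//.
under [X in _ +i* X]eq_Rintegral do rewrite raddfD /=.
by rewrite RintegralD.
Qed.

Lemma cintZ c g a b : cintegrable g a b ->
  cint (fun x => c * g x) a b = c * cint g a b.
Proof.
case: c => u v [r i]; rewrite /cint.
have -> : (fun x => complex.Re ((u +i* v) * g x)) =
          (fun x => u * complex.Re (g x) - v * complex.Im (g x)).
  by apply/funext => x; case: (g x).
have -> : (fun x => complex.Im ((u +i* v) * g x)) =
          (fun x => u * complex.Im (g x) + v * complex.Re (g x)).
  by apply/funext => x; case: (g x).
have I k f : leb.-integrable `[a, b] (EFin \o f) ->
    leb.-integrable `[a, b] (EFin \o (fun x => k * f x)).
  by move=> fi; exact: (@integrableZl _ _ _ leb _ (measurable_itv _) k (EFin \o f) fi).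
by rewrite RintegralB ?RintegralD ?RintegralZl//; do ?exact: I.
Qed.

Lemma cintegrableZ c g a b : cintegrable g a b -> cintegrable (fun x => c * g x) a b.
Proof.
case: c => u v [r i].
have I k f : leb.-integrable `[a, b] (EFin \o f) ->
    leb.-integrable `[a, b] (EFin \o (fun x => k * f x)).
  by move=> fi; exact: (@integrableZl _ _ _ leb _ (measurable_itv _) k (EFin \o f) fi).
split.
  have -> : (fun x => complex.Re ((u +i* v) * g x)) =
          (fun x => u * complex.Re (g x) - v * complex.Im (g x)).
    by apply/funext => x; case: (g x).
  apply: (@integrableB _ _ _ leb _ (measurable_itv _) (EFin \o (fun x => u * complex.Re (g x)))
    (EFin \o (fun x => v * complex.Im (g x)))); exact: I.
have -> : (fun x => complex.Im ((u +i* v) * g x)) =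
          (fun x => u * complex.Im (g x) + v * complex.Re (g x)).
  by apply/funext => x; case: (g x).
apply: (@integrableD _ _ _ leb _ (measurable_itv _) (EFin \o (fun x => u * complex.Im (g x)))
  (EFin \o (fun x => v * complex.Re (g x)))); exact: I.
Qed.

Lemma cintegrableD g1 g2 a b : cintegrable g1 a b -> cintegrable g2 a b ->
  cintegrable (fun x => g1 x + g2 x) a b.
Proof.
move=> [r1 i1] [r2 i2]; split.
  have -> : (fun x => complex.Re (g1 x + g2 x)) = (fun x => complex.Re (g1 x) + complex.Re (g2 x)).
    by apply/funext => x; rewrite raddfD.
  exact: (@integrableD _ _ _ leb _ (measurable_itv _) _ _ r1 r2).
have -> : (fun x => complex.Im (g1 x + g2 x)) = (fun x => complex.Im (g1 x) + complex.Im (g2 x)).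
  by apply/funext => x; rewrite raddfD.
exact: (@integrableD _ _ _ leb _ (measurable_itv _) _ _ i1 i2).
Qed.

Lemma eq_cint g1 g2 a b : (forall x, a <= x <= b -> g1 x = g2 x) ->
  cint g1 a b = cint g2 a b.
Proof.
by move=> h; congr (_ +i* _); apply: eq_Rintegral => x /set_mem; rewrite /= in_itv /= => /h ->.
Qed.

Lemma itv_length a b : a <= b -> leb `[a, b] = (b - a)%:E.
Proof.
move=> ab; rewrite lebesgue_measure_itv /= lte_fin.
move: ab; rewrite le_eqVlt => /predU1P[->|->]; last by rewrite -EFinB.
by rewrite ltxx subrr.
Qed.

Lemma cint_cst c a b : a <= b -> cint (fun=> c) a b = c * (b - a)%:C.
Proof.
move=> ab; have H k : \int[leb]_(x in `[a, b]) (cst k x) = k * (b - a).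
  transitivity (k * fine (leb `[a, b])); last by rewrite itv_length.
  exact: Rintegral_cst.
rewrite /cint (H (complex.Re c)) (H (complex.Im c)).
by case: c => u v; simpc.
Qed.

Lemma cint_split g a m b : a <= m <= b -> cintegrable g a b ->
  [/\ cintegrable g a m, cintegrable g m b & cint g a b = cint g a m + cint g m b].
Proof.
move=> /andP[am mb] [r i].
have H f : leb.-integrable `[a, b] (EFin \o f) ->
  [/\ leb.-integrable `[a, m] (EFin \o f), leb.-integrable `[m, b] (EFin \o f) &
    \int[leb]_(x in `[a, b]) f x = \int[leb]_(x in `[a, m]) f x + \int[leb]_(x in `[m, b]) f x].
  move=> fi; split.
  - by apply: integrableS fi => //; apply: subset_itvl; rewrite bnd_simp.
  - by apply: integrableS fi => //; apply: subset_itvr; rewrite bnd_simp.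
  - have := @Rintegral_itvB _ f (BLeft a) (BRight b) m fi.
    rewrite !bnd_simp => /(_ am mb) E; apply/eqP; rewrite addrC -subr_eq E.
    rewrite Rintegral_itv_obnd_cbnd//.
    by apply: integrableS fi => //; apply: subset_itvr; rewrite bnd_simp.
by rewrite /cint; have [r1 r2 ->] := H _ r; have [i1 i2 ->] := H _ i; split.
Qed.

Lemma measurable_cabs d (T : measurableType d) (D : set T) (f : T -> R[i]) :
  measurable_fun D (fun x => complex.Re (f x)) ->
  measurable_fun D (fun x => complex.Im (f x)) ->
  measurable_fun D (fun x => cabs (f x)).
Proof.
move=> mr mi; have -> : (fun x => cabs (f x)) = (fun x => Num.sqrt
     (complex.Re (f x) ^+ 2 + complex.Im (f x) ^+ 2)).
  by apply/funext => x; rewrite /cabs; case: (f x).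
apply: (@measurableT_comp _ _ _ _ _ _ (@Num.sqrt R)).
  by apply: continuous_measurable_fun; exact: sqrt_continuous.
by apply: measurable_funD; exact: measurable_funX.
Qed.

Lemma cintegrable_mcabs g a b : cintegrable g a b ->
  measurable_fun (`[a, b] : set (measurableTypeR R)) (EFin \o (fun x => cabs (g x))).
Proof.
case=> /integrableP[/measurable_EFinP mr _] /integrableP[/measurable_EFinP mi _].
by apply/measurable_EFinP; exact: measurable_cabs.
Qed.

(** Real and imaginary parts are estimated separately, hence the factor 2. *)
Lemma cint_le g a b : cintegrable g a b ->
  ((cabs (cint g a b))%:E <= 2%:E * \int[leb]_(x in `[a, b]) (cabs (g x))%:E)%E.
Proof.
move=> [r i].
have H (p : R[i] -> R) : (forall z, `|p z| <= cabs z) ->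
  leb.-integrable `[a, b] (EFin \o (fun x => p (g x))) ->
  (`|\int[leb]_(x in `[a, b]) p (g x)|%:E <= \int[leb]_(x in `[a, b]) (cabs (g x))%:E)%E.
  move=> ple ip; rewrite EFin_normr_Rintegral//.
  rewrite (le_trans (le_abse_integral _ _ _))//; first by case/integrableP: ip.
  have mg := cintegrable_mcabs (conj r i).
  apply: ge0_le_integral => //=.
  - by do 2 apply: measurableT_comp => //; case/integrableP: ip => /measurable_EFinP.
  - by move=> x _; rewrite lee_fin.
rewrite mule_natl (le_trans (y := (`|complex.Re (cint g a b)| + `|complex.Im (cint g a b)|)%:E))//.
  by rewrite lee_fin cabs_ReIm.
by rewrite EFinD leeD//; [apply: H => //; exact: normRe_cabs|apply: H => //; exact: normIm_cabs].
Qed.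

Lemma cint_le_bound g a b (M : R) : a <= b -> cintegrable g a b ->
  (forall x, a <= x <= b -> cabs (g x) <= M) ->
  cabs (cint g a b) <= 2 * ((b - a) * M).
Proof.
move=> ab ig gM; rewrite -lee_fin (le_trans (cint_le ig))// EFinM lee_pmul2l//.
rewrite (@le_trans _ _ (\int[leb]_(x in `[a, b]) M%:E)%E)//.
  apply: ge0_le_integral => //=.
  - by move=> x _; rewrite lee_fin cabs_ge0.
  - exact: cintegrable_mcabs.
have -> : (\int[leb]_(x in `[a, b]) (cst M%:E x) = M%:E * leb `[a, b])%E.
  exact: integral_cst.
by rewrite itv_length// -EFinM mulrC.
Qed.

End CInt.

Ltac by_side :=
  first [by constructor 3|by constructor 4|by constructor 2|by constructor 1].

Section Rect.
Variable R : realType.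
Implicit Types (g f : R[i] -> R[i]) (a b c d x y : R).

(* The integral along the boundary of [a, b] x [c, d], counterclockwise. *)
Definition Irect g a b c d : R[i] :=
  cint (fun x => g (x +i* c)) a b - cint (fun x => g (x +i* d)) a b +
  'i * (cint (fun y => g (b +i* y)) c d - cint (fun y => g (a +i* y)) c d).

Definition Irect_integrable g a b c d : Prop :=
  [/\ cintegrable (fun x => g (x +i* c)) a b, cintegrable (fun x => g (x +i* d)) a b,
      cintegrable (fun y => g (b +i* y)) c d & cintegrable (fun y => g (a +i* y)) c d].

Lemma ccont_cintegrable_horiz g a b c : (forall x, a <= x <= b -> ccont g (x +i* c)) ->
  cintegrable (fun x => g (x +i* c)) a b.
Proof.
move=> h; apply: rcont_cintegrable => x /h /ccontP H e /H[d d0 hd].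
exists d => // y yx; apply: hd; apply: le_lt_trans yx.
by rewrite (le_trans (cabs_ReIm _))//= subrr normr0 addr0.
Qed.

Lemma ccont_cintegrable_vert g a c d : (forall y, c <= y <= d -> ccont g (a +i* y)) ->
  cintegrable (fun y => g (a +i* y)) c d.
Proof.
move=> h; apply: rcont_cintegrable => x /h /ccontP H e /H[r r0 hd].
exists r => // y yx; apply: hd; apply: le_lt_trans yx.
by rewrite (le_trans (cabs_ReIm _))//= subrr normr0 add0r.
Qed.

Definition on_boundary a b c d x y := 
  [/\ a <= x <= b, c <= y <= d & [\/ x = a, x = b, y = c | y = d]].

Lemma ccont_Irect_integrable g a b c d : a <= b -> c <= d ->
  (forall x y, on_boundary a b c d x y -> ccont g (x +i* y)) ->
  Irect_integrable g a b c d.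
Proof.
move=> ab cd h; split; [apply: ccont_cintegrable_horiz|apply: ccont_cintegrable_horiz|apply:
  ccont_cintegrable_vert|apply: ccont_cintegrable_vert] => x xab;
  by apply: h; split => //; rewrite ?lexx ?ab ?cd //; by_side.
Qed.

Lemma IrectD g1 g2 a b c d : Irect_integrable g1 a b c d -> Irect_integrable g2 a b c d ->
  Irect (fun w => g1 w + g2 w) a b c d = Irect g1 a b c d + Irect g2 a b c d.
Proof.
move=> [h1 h2 h3 h4] [k1 k2 k3 k4]; rewrite /Irect !cintD//; ring.
Qed.

Lemma IrectZ k g a b c d : Irect_integrable g a b c d ->
  Irect (fun w => k * g w) a b c d = k * Irect g a b c d.
Proof. by move=> [h1 h2 h3 h4]; rewrite /Irect !cintZ//; ring. Qed.

Lemma Irect_integrableD g1 g2 a b c d : Irect_integrable g1 a b c d -> Irect_integrable g2 a b c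
  d ->
  Irect_integrable (fun w => g1 w + g2 w) a b c d.
Proof.
by move=> [h1 h2 h3 h4] [k1 k2 k3 k4]; split;
  apply: (@cintegrableD _ (fun x => g1 _) (fun x => g2 _)).
Qed.

Lemma Irect_integrableZ k g a b c d : Irect_integrable g a b c d -> Irect_integrable
  (fun w => k * g w) a b c d.
Proof.
by move=> [h1 h2 h3 h4]; split; apply: (@cintegrableZ _ k (fun x => g _)).
Qed.

Lemma Irect_le g a b c d (M : R) : a <= b -> c <= d -> Irect_integrable g a b c d ->
  (forall x y, on_boundary a b c d x y -> cabs (g (x +i* y)) <= M) ->
  cabs (Irect g a b c d) <= 4 * ((b - a) + (d - c)) * M.
Proof.
move=> ab cd [h1 h2 h3 h4] gM.
have G1 := cint_le_bound (M := M) ab h1; have G2 := cint_le_bound (M := M) ab h2.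
have G3 := cint_le_bound (M := M) cd h3; have G4 := cint_le_bound (M := M) cd h4.
rewrite /Irect (le_trans (cabsD _ _))//.
have -> : 4 * (b - a + (d - c)) * M = (2 * ((b - a) * M) + 2 * ((b - a) * M)) +
   (2 * ((d - c) * M) + 2 * ((d - c) * M)) by ring.
apply: lerD.
- rewrite (le_trans (cabsD _ _))// cabsN lerD// ?G1 ?G2// => x xab;
  by apply: gM; split => //; rewrite ?lexx ?ab ?cd //; by_side.
- rewrite cabsM.
  rewrite cabs_i mul1r (le_trans (cabsD _ _))// cabsN lerD// ?G3 ?G4// => x xab;
  by apply: gM; split => //; rewrite ?lexx ?ab ?cd //; by_side.
Qed.

(** On opposite sides the values of an affine function differ by a constant, so that only integrals
    of constants occur, and the two pairs of sides cancel. *)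
Lemma Irect_affine k l a b c d : a <= b -> c <= d ->
  Irect_integrable (fun w => k + l * w) a b c d /\ Irect (fun w => k + l * w) a b c d = 0.
Proof.
move=> ab cd.
have C w : ccont (fun w => k + l * w) w.
  apply: has_cder_cont (has_cderD (has_cder_cst _ _) (has_cderZ _ (has_cder_id _))).
have I : Irect_integrable (fun w => k + l * w) a b c d by apply: ccont_Irect_integrable.
split => //; case: I => h1 h2 h3 h4; rewrite /Irect.
have -> : cint (fun x => k + l * (x +i* c)) a b - cint (fun x => k + l * (x +i* d)) a b
   = l * 'i * (c - d)%:C * (b - a)%:C.
  rewrite -cint_cst// -mulN1r -cintZ// -cintD//; last exact: cintegrableZ.
  apply: eq_cint => x _.
  have E (t : R) : x +i* t = x%:C + 'i * t%:C by simpc.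
  by rewrite !E rmorphB /=; ring.
have -> : cint (fun y => k + l * (b +i* y)) c d - cint (fun y => k + l * (a +i* y)) c d
   = l * (b - a)%:C * (d - c)%:C.
  rewrite -cint_cst// -mulN1r -cintZ// -cintD//; last exact: cintegrableZ.
  apply: eq_cint => x _.
  have E (t : R) : t +i* x = t%:C + 'i * x%:C by simpc.
  by rewrite !E rmorphB /=; ring.
by rewrite !rmorphB /=; ring.
Qed.

Lemma Irect_splitx g a m b c d : a <= m <= b -> Irect_integrable g a b c d ->
  cintegrable (fun y => g (m +i* y)) c d ->
  Irect g a b c d = Irect g a m c d + Irect g m b c d.
Proof.
move=> amb [h1 h2 h3 h4] hm; rewrite /Irect.
have [_ _ ->] := cint_split amb h1; have [_ _ ->] := cint_split amb h2.
ring.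
Qed.

Lemma Irect_splity g a b c m d : c <= m <= d -> Irect_integrable g a b c d ->
  cintegrable (fun x => g (x +i* m)) a b ->
  Irect g a b c d = Irect g a b c m + Irect g a b m d.
Proof.
move=> amb [h1 h2 h3 h4] hm; rewrite /Irect.
have [_ _ ->] := cint_split amb h3; have [_ _ ->] := cint_split amb h4.
ring.
Qed.

End Rect.

(** * Goursat's theorem for rectangles *)

Section Goursat.
Variable R : realType.
Implicit Types (g f : R[i] -> R[i]) (a b c d x y s : R).

(* [P a c s] is about the rectangle with lower left corner (a, c) and sides
   s * A and s * B. *)
Lemma rect_bisection (P : R -> R -> R -> Prop) (a0 c0 A B : R) :
  0 <= A -> 0 <= B ->
  let Q a c s := [/\ 0 < s, a0 <= a, a + s * A <= a0 + A, c0 <= c & c + s * B <= c0 + B] in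
  (forall a c s, Q a c s -> P a c (s / 2) -> P (a + s / 2 * A) c (s / 2) ->
    P a (c + s / 2 * B) (s / 2) -> P (a + s / 2 * A) (c + s / 2 * B) (s / 2) -> P a c s) ->
  (forall x y, a0 <= x <= a0 + A -> c0 <= y <= c0 + B -> exists2 e : R, 0 < e &
    forall a c s, Q a c s -> s < e -> a <= x <= a + s * A -> c <= y <= c + s * B -> P a c s) ->
  P a0 c0 1.
Proof.
move=> A0 B0 Q step loc; apply: contrapT => nP.
(* [T] collects the rectangles on which [P] fails. By [step], one of the four quarters fails again,
   and iterating this choice produces nested rectangles with sides tending to 0. *)
pose T := {t : R * R * R | Q t.1.1 t.1.2 t.2 /\ ~ P t.1.1 t.1.2 t.2}.
have nxt (t : T) : {t' : T | [/\ (sval t').2 = (sval t).2 / 2,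
    (sval t).1.1 <= (sval t').1.1, (sval t).1.2 <= (sval t').1.2,
    (sval t').1.1 + (sval t').2 * A <= (sval t).1.1 + (sval t).2 * A &
    (sval t').1.2 + (sval t').2 * B <= (sval t).1.2 + (sval t).2 * B] }.
  apply: cid; case: t => [[[a c] s] /= [[s0 h1 h2 h3 h4] np]].
  apply: contrapT => /forallNP h; apply: np; apply: step => //.
  all: apply: contrapT => np.
  - have q : Q a c (s / 2) by split => //; nra.
    by apply: (h (exist _ (a, c, s / 2) (conj q np))); split => /=; nra.
  - have q : Q (a + s / 2 * A) c (s / 2) by split => //; nra.
    by apply: (h (exist _ (_, _, s / 2) (conj q np))); split => /=; nra.
  - have q : Q a (c + s / 2 * B) (s / 2) by split => //; nra.
    by apply: (h (exist _ (_, _, s / 2) (conj q np))); split => /=; nra.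
  - have q : Q (a + s / 2 * A) (c + s / 2 * B) (s / 2) by split => //; nra.
    by apply: (h (exist _ (_, _, s / 2) (conj q np))); split => /=; nra.
have q0 : Q a0 c0 1 by split => //; rewrite mul1r.
pose t0 : T := exist _ (a0, c0, 1) (conj q0 nP).
pose t n : T := iter n (fun t => sval (nxt t)) t0.
have tS n := svalP (nxt (t n)); rewrite -/(t _) in tS.
have tE n : (sval (t n)).2 = 2^-1 ^+ n.
  by elim: n => [//|n IH]; have [-> _ _ _ _] := tS n; rewrite IH exprSr.
have mono m n : (m <= n)%N -> [/\ (sval (t m)).1.1 <= (sval (t n)).1.1,
    (sval (t m)).1.2 <= (sval (t n)).1.2,
    (sval (t n)).1.1 + (sval (t n)).2 * A <= (sval (t m)).1.1 + (sval (t m)).2 * A &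
    (sval (t n)).1.2 + (sval (t n)).2 * B <= (sval (t m)).1.2 + (sval (t m)).2 * B].
  elim: n => [|n IH]; first by rewrite leqn0 => /eqP ->.
  rewrite leq_eqVlt => /predU1P[-> //|/IH [i1 i2 i3 i4]].
  have [_ j1 j2 j3 j4] := tS n; split.
  - exact: le_trans j1.
  - exact: le_trans j2.
  - exact: le_trans i3.
  - exact: le_trans i4.
have s0 n : 0 < (sval (t n)).2 by rewrite tE exprn_gt0.
have ub1 n m : (sval (t m)).1.1 <= (sval (t n)).1.1 + (sval (t n)).2 * A.
  have [mn|/ltnW nm] := leqP m n.
    have [h _ _ _] := mono _ _ mn; rewrite (le_trans h)// lerDl mulr_ge0// ltW//.
  have [_ _ h _] := mono _ _ nm; apply: le_trans h.
  by rewrite lerDl mulr_ge0// ltW.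
have ub2 n m : (sval (t m)).1.2 <= (sval (t n)).1.2 + (sval (t n)).2 * B.
  have [mn|/ltnW nm] := leqP m n.
    have [_ h _ _] := mono _ _ mn; rewrite (le_trans h)// lerDl mulr_ge0// ltW//.
  have [_ _ _ h] := mono _ _ nm; apply: le_trans h.
  by rewrite lerDl mulr_ge0// ltW.
(* The suprema of the lower left corners lie in all the rectangles: by [ub1] and [ub2], no corner
   lies beyond the opposite sides of another rectangle. *)
pose x := sup (range (fun n => (sval (t n)).1.1)).
pose y := sup (range (fun n => (sval (t n)).1.2)).
have xn n : (sval (t n)).1.1 <= x <= (sval (t n)).1.1 + (sval (t n)).2 * A.
  apply/andP; split.
    apply: ub_le_sup; last by exists n.
    by exists ((sval (t n)).1.1 + (sval (t n)).2 * A) => _ [m _ <-].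
  apply: ge_sup; first by exists (sval (t 0%N)).1.1; exists 0%N.
  by move=> _ [m _ <-].
have yn n : (sval (t n)).1.2 <= y <= (sval (t n)).1.2 + (sval (t n)).2 * B.
  apply/andP; split.
    apply: ub_le_sup; last by exists n.
    by exists ((sval (t n)).1.2 + (sval (t n)).2 * B) => _ [m _ <-].
  apply: ge_sup; first by exists (sval (t 0%N)).1.2; exists 0%N.
  by move=> _ [m _ <-].
have := xn 0%N; have := yn 0%N; rewrite /= !mul1r => y0 x0.
have [e e0 he] := loc x y x0 y0.
have [n ne] : exists n, (2^-1 : R) ^+ n < e.
  have := @cvg_expr R 2^-1; rewrite ger0_norm// invf_lt1// ltr1n => /(_ isT).
  move=> /cvgr0Pnorm_lt /(_ _ e0) [n _ /(_ n (leqnn n)) h]; exists n.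
  by apply: le_lt_trans h; exact: ler_norm.
have [q npn] := svalP (t n).
apply: npn; apply: he => //; first by rewrite tE.
Qed.

Definition rectC g a b c d :=
  forall x y, a <= x <= b -> c <= y <= d -> ccont g (x +i* y).

Lemma rectC_sub g a b c d a' b' c' d' : a <= a' -> b' <= b -> c <= c' -> d' <= d ->
  rectC g a b c d -> rectC g a' b' c' d'.
Proof.
move=> h1 h2 h3 h4 cg x y /andP[xa xb] /andP[yc yd].
by apply: cg; [rewrite (le_trans h1)//= (le_trans xb)|rewrite (le_trans h3)//= (le_trans yd)].
Qed.

Lemma rectC_integrable g a b c d : a <= b -> c <= d -> rectC g a b c d -> Irect_integrable g a b
  c d.
Proof. by move=> ab cd cg; apply: ccont_Irect_integrable => // x y [xab ycd _]; exact: cg. Qed.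

Lemma Irect_split4 g a m b c n d : a <= m -> m <= b -> c <= n -> n <= d ->
  rectC g a b c d ->
  Irect g a b c d = (Irect g a m c n + Irect g a m n d) +
                    (Irect g m b c n + Irect g m b n d).
Proof.
move=> am mb cn nd cg.
have ab := le_trans am mb; have cd := le_trans cn nd.
have l := lexx.
rewrite (@Irect_splitx _ _ _ m); first 1 last.
- by rewrite am.
- exact: rectC_integrable.
- by apply: ccont_cintegrable_vert => y ycd; apply: cg => //; rewrite am.
have c1 : rectC g a m c d by exact: rectC_sub cg.
have c2 : rectC g m b c d by exact: rectC_sub cg.
congr (_ + _); apply: Irect_splity; rewrite ?cn//.
- exact: rectC_integrable.
- by apply: ccont_cintegrable_horiz => x xab; apply: c1 => //; rewrite cn.
- exact: rectC_integrable.
- by apply: ccont_cintegrable_horiz => x xab; apply: c2 => //; rewrite cn.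
Qed.

(** The property that is bisected is [|I| <= e s^2]: each quarter has the weight [(s / 2)^2], so the
    four bounds add up exactly to that of the whole. Locally, subtracting the affine part does not
    change the integral and leaves a remainder [o(s)] on a boundary of length [O(s)]. *)
Lemma Goursat g a b c d : a <= b -> c <= d ->
  (forall x y, a <= x <= b -> c <= y <= d -> cderivable g (x +i* y)) ->
  Irect g a b c d = 0.
Proof.
move=> ab cd dg.
have cg : rectC g a b c d.
  by move=> x y h1 h2; apply: cderivable_cont; exact: dg.
apply/eqP; rewrite -cabs_eq0; apply/eqP/le_anti; rewrite cabs_ge0 andbT.
apply/ler_addgt0Pl => e e0; rewrite addr0.
pose A := b - a; pose B := d - c.
have A0 : 0 <= A by rewrite subr_ge0.
have B0 : 0 <= B by rewrite subr_ge0.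
have -> : b = a + 1 * A by rewrite /A; ring.
have -> : d = c + 1 * B by rewrite /B; ring.
suff : cabs (Irect g a (a + 1 * A) c (c + 1 * B)) <= e * 1 ^+ 2 by rewrite expr1n mulr1.
have bE : a + A = b by rewrite /A; ring.
have dE : c + B = d by rewrite /B; ring.
apply: (@rect_bisection (fun a c s => cabs (Irect g a (a + s * A) c (c + s * B)) <= e * s ^+ 2) a
  c A B A0 B0).
- move=> a' c' s [s0 q1 q2 q3 q4]; rewrite bE dE in q2 q4.
  have e1 : a' + s / 2 * A + s / 2 * A = a' + s * A by field.
  have e2 : c' + s / 2 * B + s / 2 * B = c' + s * B by field.
  rewrite e1 e2 => p1 p2 p3 p4.
  have sA : 0 <= s / 2 * A by rewrite mulr_ge0// divr_ge0// ltW.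
  have sB : 0 <= s / 2 * B by rewrite mulr_ge0// divr_ge0// ltW.
  rewrite (@Irect_split4 _ _ (a' + s / 2 * A) _ _ (c' + s / 2 * B)) ?lerDl//; first last.
  - by apply: rectC_sub cg.
  - by rewrite -e2 lerDl.
  - by rewrite -e1 lerDl.
  rewrite (le_trans (cabsD _ _))//.
  rewrite (le_trans (lerD (cabsD _ _) (cabsD _ _)))//.
  have -> : e * s ^+ 2 = e * (s / 2) ^+ 2 + e * (s / 2) ^+ 2 +
    (e * (s / 2) ^+ 2 + e * (s / 2) ^+ 2) by field.
  by apply: lerD; apply: lerD.
- move=> x y xab ycd; rewrite bE in xab; rewrite dE in ycd.
  pose D := A + B.
  have D0 : 0 <= D by rewrite addr_ge0.
  (* [Irect_le] contributes [4 s D] and the distance to [z] another [s D], hence [4 D^2]; the [+ 1]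
     covers a rectangle reduced to a point, as does the one in [r / (D + 1)]. *)
  have e'0 : 0 < e / (4 * D ^+ 2 + 1).
    by rewrite divr_gt0// ltr_wpDl// mulr_ge0// sqr_ge0.
  have [r r0 hr] := cderivable_has (dg x y xab ycd) e'0.
  exists (r / (D + 1)); first by rewrite divr_gt0// ltr_wpDl.
  move=> a' c' s [s0 q1 q2 q3 q4] sr /andP[x1 x2] /andP[y1 y2]; rewrite bE dE in q2 q4.
  have sDr : s * D < r.
    move: sr; rewrite ltr_pdivlMr ?ltr_wpDl// mulrDr mulr1 => h; lra.
  set z := x +i* y in hr.
  set l := cder 1 g z in hr.
  have sA0 : 0 <= s * A by rewrite mulr_ge0// ltW.
  have sB0 : 0 <= s * B by rewrite mulr_ge0// ltW.
  have ab' : a' <= a' + s * A by rewrite lerDl.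
  have cd' : c' <= c' + s * B by rewrite lerDl.
  have [Ia Ea] := Irect_affine (g z - l * z) l ab' cd'.
  have Ig : Irect_integrable g a' (a' + s * A) c' (c' + s * B) by apply: rectC_integrable => //;
    exact: rectC_sub cg.
  have IE : Irect g a' (a' + s * A) c' (c' + s * B) =
    Irect (fun w => g w + -1 * (g z - l * z + l * w)) a' (a' + s * A) c' (c' + s * B).
    rewrite IrectD//; last exact: Irect_integrableZ.
    by rewrite IrectZ// Ea mulr0 addr0.
  rewrite IE.
  apply: (le_trans (Irect_le (M := e / (4 * D ^+ 2 + 1) * (s * D)) ab' cd' _ _)).
  + by apply: Irect_integrableD => //; exact: Irect_integrableZ.
  + move=> x' y' [x'ab y'cd _].
    have -> : g (x' +i* y') + -1 * (g z - l * z + l * (x' +i* y')) =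
      g (x' +i* y') - g z - l * (x' +i* y' - z) by ring.
    have zz : cabs (x' +i* y' - z) <= s * D.
      rewrite (le_trans (cabs_ReIm _))//= /D mulrDr lerD// ler_norml; lra.
    rewrite (le_trans (hr _ (le_lt_trans zz sDr)))// ler_wpM2l// ltW//.
  + have -> : 4 * (a' + s * A - a' + (c' + s * B - c')) * (e / (4 * D ^+ 2 + 1) * (s * D)) =
       (4 * D ^+ 2) / (4 * D ^+ 2 + 1) * (e * s ^+ 2) by rewrite /D; ring.
    apply: ler_piMl; first by rewrite mulr_ge0 ?sqr_ge0 ?ltW.
    have D20 : 0 <= D ^+ 2 by rewrite sqr_ge0.
    by rewrite ler_pdivrMr; lra.
Qed.

End Goursat.

(** * The Poisson kernel on an interval *)

Section Kernel.
Variable R : realType.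
Implicit Types (a b x e : R).
Local Notation leb := (@lebesgue_measure R).

Lemma poisson_kernel_continuous x0 e : 0 < e ->
  continuous (fun x => e / ((x - x0) ^+ 2 + e ^+ 2)).
Proof.
move=> e0 x.  pose G x := (x - x0) ^+ 2 + e ^+ 2.
  have cG : {for x, continuous G}.
    apply/differentiable_continuous/derivable1_diffP.
    have : is_derive x (1 : R) G (2 * (x - x0)).
      apply: is_derive_eq; rewrite /GRing.scale /=; ring.
    by move=> ?; exact: ex_derive.
  apply: cvgM; first exact: cvg_cst.
  by apply: cvgV => //; rewrite gt_eqF// ltr_wpDl ?sqr_ge0// exprn_gt0.
Qed.

Lemma poisson_kernel_integrable x0 e a b : 0 < e ->
  cintegrable (fun x => (e / ((x - x0) ^+ 2 + e ^+ 2))%:C) a b.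
Proof.
move=> e0; split; apply: continuous_compact_integrable; try exact: segment_compact.
  by apply: continuous_subspaceT => x; exact: poisson_kernel_continuous.
by apply: continuous_subspaceT => x; exact: cst_continuous.
Qed.

(** The antiderivative is an arctangent. It yields both the constant [2 i pi] of Cauchy's formula
    and the size of the test functions in [A^p]. *)
Lemma integral_poisson_kernel x0 e a b : 0 < e -> a < b ->
  (\int[leb]_(x in `[a, b]) (e / ((x - x0) ^+ 2 + e ^+ 2))%:E)%E =
  (atan ((b - x0) / e) - atan ((a - x0) / e))%:E.
Proof.
move=> e0 ab.
pose F x := atan ((x - x0) / e).
have dF x : is_derive x (1 : R) F (e / ((x - x0) ^+ 2 + e ^+ 2)).
  have d1 : is_derive x (1 : R) (fun x => (x - x0) / e) e^-1.
    apply: is_derive_eq; rewrite /GRing.scale /=; ring.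
  have := @is_derive1_comp R atan _ x _ _ (is_derive1_atan _) d1.
  move/is_derive_eq; apply.
  have h : (x - x0) ^+ 2 + e ^+ 2 != 0 by rewrite gt_eqF// ltr_wpDl ?sqr_ge0// exprn_gt0.
  have h' : e != 0 by rewrite gt_eqF.
  rewrite -[LHS]/((1 + ((x - x0) / e) ^+ 2)^-1 * e^-1).
  have -> : 1 + ((x - x0) / e) ^+ 2 = ((x - x0) ^+ 2 + e ^+ 2) / e ^+ 2 by field.
  by field; rewrite h' h.
have cF x : {for x, continuous F}.
  apply/differentiable_continuous/derivable1_diffP; exact: ex_derive.
rewrite (@continuous_FTC2 _ _ F)//.
- by apply: continuous_subspaceT => x; exact: poisson_kernel_continuous.
- split.
  + by move=> x _; exact: ex_derive.
  + by apply: cvg_at_right_filter; exact: cF.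
  + by apply: cvg_at_left_filter; exact: cF.
- by move=> x _; rewrite derive1E; exact: derive_val.
Qed.

Lemma cint_real (r : R -> R) a b : cint (fun x => (r x)%:C) a b = (\int[leb]_(x in `[a, b]) r x)%:C.
Proof.
rewrite /cint /=; congr (_ +i* _).
by rewrite /Rintegral integral0_eq.
Qed.

End Kernel.

(** * Cauchy's integral formula for rectangles *)

Section Cauchy.
Variable R : realType.
Implicit Types (g f : R[i] -> R[i]) (a b c d x y e : R).

Lemma has_cder_cauchy_kernel (z w : R[i]) : w != z ->
  exists l, has_cder (fun w => (w - z)^-1) w l.
Proof.
move=> wz; eexists; apply: has_cderV; first by rewrite subr_eq0.
exact: has_cderB (has_cder_id _) (has_cder_cst _ _).
Qed.

Lemma ccont_cauchy_kernel (z w : R[i]) : w != z -> ccont (fun w => (w - z)^-1) w.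
Proof. by move=> /has_cder_cauchy_kernel[l /has_cder_cont]. Qed.

Lemma boundary_far x0 y0 e x y : 0 < e ->
  on_boundary (x0 - e) (x0 + e) (y0 - e) (y0 + e) x y ->
  e <= cabs (x +i* y - (x0 +i* y0)).
Proof.
move=> e0 [_ _ H].
have r : `|x - x0| <= cabs (x +i* y - (x0 +i* y0)) by exact: (normRe_cabs (x +i* y - (x0 +i* y0))).
have i : `|y - y0| <= cabs (x +i* y - (x0 +i* y0)) by exact: (normIm_cabs (x +i* y - (x0 +i* y0))).
case: H => h; [apply: le_trans r|apply: le_trans r|apply: le_trans i|apply: le_trans i];
  by rewrite ler_normr h; apply/orP; (left; lra) || (right; lra).
Qed.

(** On a square centred at the pole, the values of the kernel on opposite sides combine into [2 i]
    or 2 times a real Poisson kernel, whose integral is [atan 1 - atan (-1) = pi / 2]. *)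
Lemma Irect_cauchy_kernel x0 y0 e : 0 < e ->
  Irect_integrable (fun w => (w - (x0 +i* y0))^-1) (x0 - e) (x0 + e) (y0 - e) (y0 + e) /\
  Irect (fun w => (w - (x0 +i* y0))^-1) (x0 - e) (x0 + e) (y0 - e) (y0 + e) = 2 * 'i * pi%:C.
Proof.
move=> e0.
have ex : x0 - e <= x0 + e by lra. have ey : y0 - e <= y0 + e by lra.
have I : Irect_integrable (fun w => (w - (x0 +i* y0))^-1) (x0 - e) (x0 + e) (y0 - e) (y0 + e).
  apply: ccont_Irect_integrable => // x y /(boundary_far e0) h.
  by apply: ccont_cauchy_kernel; rewrite -subr_eq0 -cabs_gt0 (lt_le_trans e0).
split => //; case: I => h1 h2 h3 h4.
have K t0 : cint (fun x => (e / ((x - t0) ^+ 2 + e ^+ 2))%:C) (t0 - e) (t0 + e) = (pi / 2)%:C.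
  rewrite cint_real; congr (_%:C).
  rewrite /Rintegral integral_poisson_kernel//; last by lra.
  have -> : t0 + e - t0 = e by ring.
  have -> : t0 - e - t0 = - e by ring.
  by rewrite mulNr divff ?gt_eqF// atanN atan1 /= opprK; field.
have iR t0 := @poisson_kernel_integrable R t0 e (t0 - e) (t0 + e) e0.
have N t : t ^+ 2 + e ^+ 2 != 0 by rewrite gt_eqF// ltr_wpDl ?sqr_ge0// exprn_gt0.
have F1 (t : R) : (t +i* (- e))^-1 + -1 * (t +i* e)^-1 = 2 * 'i * (e / (t ^+ 2 + e ^+ 2))%:C :>
  R[i].
  have Nt := N t; apply/eqP; rewrite eq_complex /=; apply/andP; split; apply/eqP; field;
    first [exact: N|done].
have F2 (t : R) : (e +i* t)^-1 + -1 * ((- e) +i* t)^-1 = 2 * (e / (t ^+ 2 + e ^+ 2))%:C :> R[i].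
  have Nt := N t; apply/eqP; rewrite eq_complex /=; apply/andP; split; apply/eqP; field;
    first [exact: N|done|by rewrite addrC; exact: N].
have B1 x y x' y' : x +i* y - (x' +i* y') = (x - x') +i* (y - y') :> R[i] by simpc.
have s1 (t : R) : t + e - t = e by ring.
have s2 (t : R) : t - e - t = - e by ring.
have E (p q r t : R[i]) : p - q + 'i * (r - t) = (p + -1 * q) + 'i * (r + -1 * t) by ring.
rewrite /Irect E.
rewrite -!cintZ// -!cintD; try by [|exact: cintegrableZ].
rewrite (@eq_cint _ _ (fun x => 2 * 'i * (e / ((x - x0) ^+ 2 + e ^+ 2))%:C)); last first.
  by move=> x _; rewrite !B1 s1 s2 F1.
rewrite [X in _ + 'i * X](@eq_cint _ _ (fun y => 2 * (e / ((y - y0) ^+ 2 + e ^+ 2))%:C)); last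
  first.
  by move=> x _; rewrite !B1 s1 s2 F2.
rewrite !cintZ// !K.
by rewrite !rmorphM/= fmorphV /=; field.
Qed.

(* The punctured rectangle splits into a small square around the pole and
   rectangles on which the integrand is holomorphic. *)
Lemma Cauchy_formula f a b c d x0 y0 : a < x0 < b -> c < y0 < d ->
  (forall x y, a <= x <= b -> c <= y <= d -> cderivable f (x +i* y)) ->
  Irect (fun w => f w * (w - (x0 +i* y0))^-1) a b c d = 2 * 'i * pi%:C * f (x0 +i* y0).
Proof.
move=> /andP[ax xb] /andP[cy yd] df.
pose z := x0 +i* y0; rewrite -/z.
pose g w := f w * (w - z)^-1.
have dg x y : a <= x <= b -> c <= y <= d -> (x != x0) || (y != y0) ->
    cderivable g (x +i* y).
  move=> xab ycd n; have wz : x +i* y != z.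
    by apply: contraTneq n => -[-> ->]; rewrite !eqxx.
  have [l hl] := has_cder_cauchy_kernel wz.
  exact: (has_cder_derive (has_cderM (cderivable_has (df _ _ xab ycd)) hl)).1.
apply/eqP; rewrite -subr_eq0 -cabs_eq0; apply/eqP/le_anti; rewrite cabs_ge0 andbT.
apply/ler_addgt0Pl => e e0; rewrite addr0.
(* On the boundary of a square of half side [s] the kernel is at most [1 / s], and [Irect_le] has
   the factor [16 s]. *)
have e160 : 0 < e / 16 by rewrite divr_gt0.
have /ccontP/(_ _ e160)[r r0 hr] : ccont f z.
  by apply/cderivable_cont/df; rewrite !ltW.
pose s := Num.min (r / 4) (Num.min (Num.min ((x0 - a) / 2) ((b - x0) / 2))
  (Num.min ((y0 - c) / 2) ((d - y0) / 2))).
have s0 : 0 < s by rewrite /s !lt_min; lra.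
have [sr sa sb sc sd] : [/\ s <= r / 4, s <= (x0 - a) / 2, s <= (b - x0) / 2,
   s <= (y0 - c) / 2 & s <= (d - y0) / 2].
  by have := lexx s; rewrite {2}/s !le_min => /and3P[-> /andP[-> ->] /andP[-> ->]]; split.
have [xs1 xs2] : x0 - s <= x0 /\ x0 <= x0 + s by lra.
have [ys1 ys2] : y0 - s <= y0 /\ y0 <= y0 + s by lra.
have xs : x0 - s <= x0 + s by exact: le_trans xs2.
have ys : y0 - s <= y0 + s by exact: le_trans ys2.
have [ax' xb' cy' yd'] : [/\ a <= x0 - s, x0 + s <= b, c <= y0 - s & y0 + s <= d] by split; lra.
have [x1 x2] : x0 - s < x0 /\ x0 < x0 + s by lra.
have [y1 y2] : y0 - s < y0 /\ y0 < y0 + s by lra.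
have cg x y : a <= x <= b -> c <= y <= d -> (x != x0) || (y != y0) -> ccont g (x +i* y).
  by move=> h1 h2 h3; apply: cderivable_cont; exact: dg.
have G a' b' c' d' : a <= a' -> a' <= b' -> b' <= b -> c <= c' -> c' <= d' -> d' <= d ->
   [\/ b' < x0, x0 < a', d' < y0 | y0 < c'] -> Irect g a' b' c' d' = 0.
  move=> h1 h2 h3 h4 h5 h6 H; apply: Goursat => // x y /andP[xa xb''] /andP[yc yd''].
  apply: dg; rewrite ?(le_trans h1 xa) ?(le_trans xb'' h3) ?(le_trans h4 yc) ?(le_trans yd'' h6)//.
  case: H => H.
  - by rewrite lt_eqF// (le_lt_trans xb'').
  - by rewrite gt_eqF// (lt_le_trans H).
  - by rewrite (lt_eqF (le_lt_trans yd'' H)) orbT.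
  - by rewrite (gt_eqF (lt_le_trans H yc)) orbT.
have Rg a' b' : a <= a' -> a' <= b' -> b' <= b -> (a' < x0 \/ x0 < a') -> (b' < x0 \/ x0 < b') ->
  Irect_integrable g a' b' c d.
  move=> h1 h2 h3 na nb; apply: ccont_Irect_integrable => //; first by rewrite ltW// (lt_trans cy).
  move=> x y [/andP[xa xb''] ycd H]; apply: cg => //.
    by rewrite (le_trans h1)//= (le_trans xb'').
  case: H => ->.
  - by case: na => h; rewrite ?(lt_eqF h) ?(gt_eqF h).
  - by case: nb => h; rewrite ?(lt_eqF h) ?(gt_eqF h).
  - by rewrite (lt_eqF cy) orbT.
  - by rewrite (gt_eqF yd) orbT.
have -> : Irect g a b c d = Irect g (x0 - s) (x0 + s) (y0 - s) (y0 + s).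
  have ab : a <= b by rewrite ltW// (lt_trans ax).
  have cd : c <= d by rewrite ltW// (lt_trans cy).
  rewrite (@Irect_splitx _ _ _ (x0 - s)); first last.
  - by apply: ccont_cintegrable_vert => y ycd; apply: cg => //; rewrite ?(lt_eqF x1)// ax'
      (le_trans xs1)// ltW.
  - by apply: Rg => //; [left|right].
  - by rewrite ax' (le_trans xs1)// ltW.
  rewrite [X in X + _]G//; [|exact: le_trans xs1 (ltW xb)|by constructor 1]; rewrite add0r.
  rewrite (@Irect_splitx _ _ _ (x0 + s)); first last.
  - by apply: ccont_cintegrable_vert => y ycd; apply: cg => //; rewrite ?(gt_eqF x2)// xb'
      (le_trans _ xs2)// ltW.
  - by apply: Rg => //; [exact: le_trans xs1 (ltW xb)|left|right].
  - by rewrite xs xb'.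
  rewrite [X in _ + X]G//; [|exact: le_trans (ltW ax) xs2|by constructor 2]; rewrite addr0.
  have Rs c' : c <= c' -> c' <= d -> (c' < y0 \/ y0 < c') -> Irect_integrable g (x0 - s) (x0 + s)
    c' d.
    move=> h1 h2 nc; apply: ccont_Irect_integrable => //.
    move=> x y [/andP[xa xb''] /andP[yc yd''] H]; apply: cg => //.
    - by rewrite (le_trans ax')//= (le_trans xb'').
    - by rewrite (le_trans h1).
    case: H => ->.
    - by rewrite (lt_eqF x1).
    - by rewrite (gt_eqF x2).
    - by case: nc => h; rewrite ?(lt_eqF h) ?(gt_eqF h) orbT.
    - by rewrite (gt_eqF yd) orbT.
  have hx x : x0 - s <= x <= x0 + s -> a <= x <= b.
    by move=> /andP[h1 h2]; rewrite (le_trans ax')//= (le_trans h2).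
  rewrite (@Irect_splity _ _ _ _ _ (y0 - s)); first last.
  - by apply: ccont_cintegrable_horiz => x /hx ?; apply: cg => //; rewrite ?(lt_eqF y1) ?orbT//
      cy' (le_trans ys1)// ltW.
  - by apply: Rs => //; left.
  - by rewrite cy' (le_trans ys1)// ltW.
  rewrite [X in X + _]G//; [|exact: le_trans ys1 (ltW yd)|by constructor 3]; rewrite add0r.
  rewrite (@Irect_splity _ _ _ _ _ (y0 + s)); first last.
  - by apply: ccont_cintegrable_horiz => x /hx ?; apply: cg => //; rewrite ?(gt_eqF y2) ?orbT//
      yd' (le_trans _ ys2)// ltW.
  - by apply: Rs => //; [exact: le_trans ys1 (ltW yd)|left].
  - by rewrite ys yd'.
  by rewrite [X in _ + X]G ?addr0//; [exact: le_trans (ltW cy) ys2|constructor 4].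
have [I0 E0] := Irect_cauchy_kernel x0 y0 s0.
have Ig : Irect_integrable g (x0 - s) (x0 + s) (y0 - s) (y0 + s).
  apply: ccont_Irect_integrable => // x y [/andP[h1 h2] /andP[h3 h4] H]; apply: cg.
  - by rewrite (le_trans ax')//= (le_trans h2).
  - by rewrite (le_trans cy')//= (le_trans h4).
  case: H => ->.
  - by rewrite (lt_eqF x1).
  - by rewrite (gt_eqF x2).
  - by rewrite (lt_eqF y1) orbT.
  - by rewrite (gt_eqF y2) orbT.
(* [2 i pi f(z)] is an integral of [f(z)] times the kernel over the small square. What remains is
   the integral of [(f w - f z) / (w - z)], whose numerator is at most [e / 16]. *)
rewrite -E0 mulrC -mulNr -IrectZ// -IrectD//; last exact: Irect_integrableZ.
apply: (le_trans (Irect_le (M := e / 16 / s) xs ys _ _)).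
- by apply: Irect_integrableD => //; exact: Irect_integrableZ.
- move=> x y h; rewrite /g -/z -mulrDl cabsM cabsV.
  have h1 := boundary_far s0 h.
  apply: ler_pM; rewrite ?cabs_ge0 ?invr_ge0 ?cabs_ge0//; last first.
    by rewrite lef_pV2// ?posrE// (lt_le_trans s0).
  apply/ltW/hr; rewrite (le_lt_trans (cabs_ReIm _))//=.
  case: h => /andP[p1 p2] /andP[p3 p4] _.
  have q1 : `|x - x0| <= s by rewrite ler_norml; lra.
  have q2 : `|y - y0| <= s by rewrite ler_norml; lra.
  lra.
- have -> : 4 * (x0 + s - (x0 - s) + (y0 + s - (y0 - s))) * (e / 16 / s) = e by field; rewrite
    gt_eqF.
  by [].
Qed.

End Cauchy.

Section Smooth.
Variable R : realType.
Implicit Types (f : R[i] -> R[i]) (z w : R[i]) (r M : R).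

(* With [a = 1/p], [b = 1/q] one has [a - b = (q - p) a b], so that the
   remainders satisfy [E (m+1) = a E m + (m+1) (q-p)^2 a b^(m+2)]. *)
Lemma inv_pow_taylor (m : nat) (rho : R) : 0 < rho -> exists2 C : R, 0 <= C &
  forall p q : R[i], rho <= cabs p -> rho <= cabs q ->
    cabs (p ^- m - q ^- m - m%:R * q ^- m.+1 * (q - p)) <= C * cabs (q - p) ^+ 2.
Proof.
move=> rho0; elim: m => [|m [C C0 IH]].
  by exists 0 => // p q _ _; rewrite !expr0 subrr mul0r mul0r subrr cabs0 mul0r.
have r1 : 0 <= rho^-1 by rewrite invr_ge0 ltW.
exists (rho^-1 * C + m.+1%:R * rho^-1 ^+ m.+3).
  by rewrite addr_ge0// mulr_ge0// exprn_ge0.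
move=> p q hp hq.
have p0 : p != 0 by rewrite -cabs_gt0 (lt_le_trans rho0).
have q0 : q != 0 by rewrite -cabs_gt0 (lt_le_trans rho0).
have ap : cabs p^-1 <= rho^-1 by rewrite cabsV lef_pV2// posrE (lt_le_trans rho0).
have aq : cabs q^-1 <= rho^-1 by rewrite cabsV lef_pV2// posrE (lt_le_trans rho0).
have -> : p ^- m.+1 - q ^- m.+1 - m.+1%:R * q ^- m.+2 * (q - p) =
  p^-1 * (p ^- m - q ^- m - m%:R * q ^- m.+1 * (q - p)) +
  m.+1%:R * (q - p) ^+ 2 * p^-1 * q^-1 ^+ m.+2.
  have E : p^-1 - q^-1 - (q - p) * p^-1 * q^-1 = 0 by field; rewrite ?p0 ?q0.
  have F (a b h am bm k : R[i]) : a * am - b * bm - (k + 1) * (b * (b * bm)) * h =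
      a * (am - bm - k * (b * bm) * h) + (k + 1) * h ^+ 2 * a * (b * (b * bm)) +
      (bm + (k + 1) * bm * b * h) * (a - b - h * a * b) by ring.
  by rewrite -!exprVn [p^-1 ^+ m.+1]exprS [q^-1 ^+ m.+2]exprS [q^-1 ^+ m.+1]exprS -natr1 F E
    mulr0 addr0.
rewrite (le_trans (cabsD _ _))// mulrDl; apply: lerD.
  by rewrite cabsM -[leRHS]mulrA ler_pM ?cabs_ge0//; exact: IH.
rewrite 2!cabsM cabsM !cabsX -[m.+1%:R](rmorph_nat (real_complex R)) cabsR normr_nat.
have H : cabs p^-1 * cabs q^-1 ^+ m.+2 <= rho^-1 ^+ m.+3.
  rewrite [leRHS]exprS ler_pM ?cabs_ge0 ?exprn_ge0 ?cabs_ge0//.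
  by rewrite ler_pXn2r// ?nnegrE ?cabs_ge0.
rewrite -[leLHS]mulrA [leRHS]mulrAC ler_wpM2l// mulr_ge0// exprn_ge0//.
exact: cabs_ge0.
Qed.
End Smooth.

(** * Compact sets and extreme values *)

Section Compact.
Variable R : realType.
Implicit Types (f : R[i] -> R[i]) (z w : R[i]) (r M : R).

Lemma compact_rect (a b c d : R) : compact ([set z : R[i]^o |
  a <= complex.Re z <= b /\ c <= complex.Im z <= d]).
Proof.
have -> : [set z : R[i]^o | a <= complex.Re z <= b /\ c <= complex.Im z <= d] =
   (fun p : R * R => (p.1 +i* p.2 : R[i]^o)) @` (`[a, b] `*` `[c, d]).
  rewrite eqEsubset; split=> [[x y] /= [h1 h2]|_ [[x y] /= [h1 h2] <-]].
    by exists (x, y) => //=; rewrite !in_itv /=.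
  by move: h1 h2; rewrite !in_itv /=.
apply: continuous_compact; last by apply: compact_setX; exact: segment_compact.
apply: continuous_subspaceT => -[x y].
apply/(cvgrPdist_lt (F := nbhs ((x, y) : R * R))) => e /gt0_complex[e0 ->].
have e20 : 0 < complex.Re e / 2 by rewrite divr_gt0.
exists (ball x (complex.Re e / 2), ball y (complex.Re e / 2)).
  by split; apply: nbhsx_ballx.
move=> [x' y'] /= [xx yy]; rewrite normcE_cabs ltcR.
rewrite (le_lt_trans (cabs_ReIm _))//= [ltRHS]splitr ltrD//.
Qed.

Lemma continuous_cabs : continuous (@cabs R : R[i]^o -> R).
Proof.
move=> z; apply/(cvgrPdist_lt (F := nbhs (z : R[i]^o))) => e e0.
have e0' : (0 : R[i]) < e%:C by rewrite complex_gt0.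
apply/nbhs_ballP; exists e%:C => //= w; rewrite -ball_normE /= normcE_cabs ltcR => h.
apply: le_lt_trans h; rewrite ler_norml cabsB_ge andbT.
by rewrite lerNl opprB cabsBC cabsB_ge.
Qed.

Lemma compact_cball z r : compact ([set w : R[i]^o | cabs (w - z) <= r]).
Proof.
apply: (subclosed_compact _ (@compact_rect (- (cabs z + r)) (cabs z + r) (- (cabs z + r))
  (cabs z + r))).
- have -> : [set w : R[i]^o | cabs (w - z) <= r] = (fun w : R[i]^o => cabs (w - z)) @^-1`
    [set x | x <= r].
    by [].
  apply: closed_comp; last exact: closed_le.
  move=> w _; apply: (@continuous_comp _ _ _ (fun w : R[i]^o => (w - z : R[i]^o)) (@cabs R));
    last exact: continuous_cabs.
  apply: (@has_cder_cont _ (fun w => w - z)); exact: (has_cderB (has_cder_id _) (has_cder_cst _ _)).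
- move=> w /= h.
  have H : cabs w <= cabs z + r by rewrite -[w](subrK z) (le_trans (cabsD _ _))// addrC lerD2l.
  by rewrite -!ler_norml; split; apply: le_trans H; [exact: normRe_cabs|exact: normIm_cabs].
Qed.

(** The weight [d] is 1 in the two lemmas that follow and [(rho - |w - z|)^N] in [max_weight]. *)
Lemma ccont_cabs_max (K : set R[i]^o) (d : R[i] -> R) f : compact K -> K !=set0 ->
  (forall w : R[i], K w -> {for w, continuous (d : R[i]^o -> R)}) ->
  (forall w, K w -> ccont f w) ->
  exists2 w, K w & forall v, K v -> d v * cabs (f v) <= d w * cabs (f w).
Proof.
move=> cK K0 cd cf.
have [|w wK H] := @compact_EVT_max (R[i]^o) R (fun w => d w * cabs (f w)) K K0 cK.
  apply: continuous_in_subspaceT => w /set_mem wK.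
  have c2 : {for w, continuous (fun w : R[i]^o => cabs (f w) : R)}.
    apply: (@continuous_comp _ _ _ (f : R[i]^o -> R[i]^o) (@cabs R)); first exact: cf.
    exact: continuous_cabs.
  exact: (continuousM (cd w wK) c2).
by exists w; [exact/set_mem|move=> v /mem_set/H].
Qed.

Lemma ccont_bounded (K : set R[i]^o) f : compact K ->
  (forall w, K w -> ccont f w) ->
  exists2 M : R, 0 < M & forall v, K v -> cabs (f v) <= M.
Proof.
move=> cK cf; have [->|/set0P K0] := eqVneq K set0; first by exists 1.
have [|w wK H] := @ccont_cabs_max K (fun=> 1) f cK K0 _ cf.
  by move=> w _; exact: cst_continuous.
exists (cabs (f w) + 1); first by rewrite ltr_wpDl ?cabs_ge0.
by move=> v /H; rewrite !mul1r => h; rewrite (le_trans h)// lerDl.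
Qed.

Lemma compact_disc_lt1 (K : set R[i]^o) : compact K -> K `<=` @discC R ->
  exists2 r : R, 0 < r < 1 & forall v, K v -> cabs v <= r.
Proof.
move=> cK sK; have [->|/set0P K0] := eqVneq K set0.
  by exists (1 / 2) => //; apply/andP; split; lra.
have [||w wK H] := @ccont_cabs_max K (fun=> 1) id cK K0.
  by move=> w _; exact: cst_continuous.
  by move=> w _; apply: has_cder_cont (has_cder_id _).
have := sK _ wK; rewrite /discC /= => w1.
exists ((cabs w + 1) / 2); first by have := cabs_ge0 w; lra.
move=> v /H; rewrite !mul1r; lra.
Qed.

End Compact.

(** * Derivatives as Cauchy integrals, and Cauchy's estimates *)

Section Smooth.
Variable R : realType.
Implicit Types (f : R[i] -> R[i]) (z w : R[i]) (x y r M : R).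

Section Square.
Variables (f : R[i] -> R[i]) (x0 y0 r : R).
Hypothesis r0 : 0 < r.
Hypothesis df : forall x y, x0 - r <= x <= x0 + r -> y0 - r <= y <= y0 + r ->
  cderivable f (x +i* y).

Definition cauchy_int (m : nat) (z : R[i]) : R[i] :=
  Irect (fun w => f w * (w - z) ^- m) (x0 - r) (x0 + r) (y0 - r) (y0 + r).

Let xr : x0 - r <= x0 + r. Proof. by rewrite lerBlDr -addrA lerDl addr_ge0 ?ltW. Qed.
Let yr : y0 - r <= y0 + r. Proof. by rewrite lerBlDr -addrA lerDl addr_ge0 ?ltW. Qed.

Lemma boundary_far_near_center x y z : on_boundary (x0 - r) (x0 + r) (y0 - r) (y0 + r) x y ->
  cabs (z - (x0 +i* y0)) < r / 2 -> r / 2 <= cabs (x +i* y - z).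
Proof.
move=> /(boundary_far r0) h hz.
have T := cabs_triangle (x +i* y) z (x0 +i* y0); move: (le_trans h T) hz; lra.
Qed.

Lemma cauchy_int_integrable m z : cabs (z - (x0 +i* y0)) < r / 2 ->
  Irect_integrable (fun w => f w * (w - z) ^- m) (x0 - r) (x0 + r) (y0 - r) (y0 + r).
Proof.
move=> hz; apply: ccont_Irect_integrable => // x y xy.
have far := boundary_far_near_center xy hz; case: xy => hx hy _.
have nz : x +i* y - z != 0 by rewrite -cabs_gt0 (lt_le_trans _ far)// divr_gt0.
have nz' : (x +i* y - z) ^+ m != 0 by rewrite expf_neq0.
apply: has_cder_cont; apply: has_cderM; first exact: cderivable_has (df hx hy).
apply: (has_cderV (f := fun w => (w - z) ^+ m)) => //.
apply: has_cderX; exact: has_cderB (has_cder_id _) (has_cder_cst _ _).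
Qed.

(** Differentiation under the integral sign: by [inv_pow_taylor] with [rho = r / 2], the remainder
    of the kernel is quadratic in [w - z], uniformly on the boundary, which is at distance at least
    [r / 2] from both [z] and [w]. *)
Lemma cauchy_int_has_cder m z : cabs (z - (x0 +i* y0)) < r / 2 ->
  has_cder (cauchy_int m) z (m%:R * cauchy_int m.+1 z).
Proof.
move=> hz e e0.
have [M M0 fM] : exists2 M : R, 0 < M &
    forall x y, x0 - r <= x <= x0 + r -> y0 - r <= y <= y0 + r -> cabs (f (x +i* y)) <= M.
  pose S : set R[i]^o := [set z : R[i]^o | x0 - r <= complex.Re z <= x0 + r /\ y0 - r <=
    complex.Im z <= y0 + r].
  have cS : compact S by exact: compact_rect.
  have [|M M0 H] := @ccont_bounded R S f cS.
    by move=> [x y] [h1 h2]; apply: cderivable_cont; exact: df.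
  by exists M => // x y h1 h2; exact: H.
have r20 : 0 < r / 2 by rewrite divr_gt0.
have [C C0 HC] := inv_pow_taylor m r20.
(* [16 r] is the factor of [Irect_le] for a square of half side [r]; the [+ 1] makes [K] positive
   even if [C = 0]. *)
pose K := 16 * r * (M * C) + 1.
have K0 : 0 < K by rewrite ltr_wpDl// !mulr_ge0// ltW.
exists (Num.min (r / 2 - cabs (z - (x0 +i* y0))) (e / K)).
  by rewrite lt_min subr_gt0 hz divr_gt0.
move=> w; rewrite lt_min => /andP[h1 h2].
have hw : cabs (w - (x0 +i* y0)) < r / 2.
  by have := cabs_triangle w z (x0 +i* y0); lra.
have Iz := cauchy_int_integrable m hz; have Iw := cauchy_int_integrable m hw.
have Iz1 := cauchy_int_integrable m.+1 hz.
rewrite /cauchy_int.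
have E : Irect (fun v => f v * (v - w) ^- m) (x0 - r) (x0 + r) (y0 - r) (y0 + r)
   - Irect (fun v => f v * (v - z) ^- m) (x0 - r) (x0 + r) (y0 - r) (y0 + r)
   - m%:R * Irect (fun v => f v * (v - z) ^- m.+1) (x0 - r) (x0 + r) (y0 - r) (y0 + r) * (w - z)
   = Irect (fun v => f v * (v - w) ^- m + (-1) * (f v * (v - z) ^- m) +
        (- (m%:R * (w - z))) * (f v * (v - z) ^- m.+1)) (x0 - r) (x0 + r) (y0 - r) (y0 + r).
  have I2 := Irect_integrableZ (-1) Iz; have I3 := Irect_integrableZ (- (m%:R * (w - z))) Iz1.
  rewrite (IrectD (Irect_integrableD Iw I2) I3) (IrectD Iw I2) (IrectZ _ Iz) (IrectZ _ Iz1).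
  by rewrite mulN1r mulNr -!mulrA [_ * (w - z)]mulrC.
rewrite E; apply: (le_trans (Irect_le (M := M * (C * cabs (w - z) ^+ 2)) xr yr _ _)).
- exact: (Irect_integrableD (Irect_integrableD Iw (Irect_integrableZ (-1) Iz))
    (Irect_integrableZ (- (m%:R * (w - z))) Iz1)).
- move=> x y xy.
  have fz := boundary_far_near_center xy hz; have fw := boundary_far_near_center xy hw.
  have -> : f (x +i* y) * (x +i* y - w) ^- m + -1 * (f (x +i* y) * (x +i* y - z) ^- m) +
     - (m%:R * (w - z)) * (f (x +i* y) * (x +i* y - z) ^- m.+1) =
     f (x +i* y) * ((x +i* y - w) ^- m - (x +i* y - z) ^- m -
       m%:R * (x +i* y - z) ^- m.+1 * ((x +i* y - z) - (x +i* y - w))) by ring.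
  rewrite cabsM ler_pM ?cabs_ge0//; first by case: xy => ? ? _; exact: fM.
  have -> : w - z = (x +i* y - z) - (x +i* y - w) by ring.
  exact: HC.
- have -> : 4 * (x0 + r - (x0 - r) + (y0 + r - (y0 - r))) * (M * (C * cabs (w - z) ^+ 2)) =
      (16 * r * (M * C)) * cabs (w - z) * cabs (w - z) by ring.
  rewrite ler_wpM2r ?cabs_ge0//.
  move: h2; rewrite ltr_pdivlMr// => h2; rewrite (le_trans _ (ltW h2))// mulrC.
  by rewrite ler_wpM2l ?cabs_ge0// /K lerDl.
Qed.

Lemma cauchy_int1 z : cabs (z - (x0 +i* y0)) < r / 2 ->
  cauchy_int 1 z = 2 * 'i * pi%:C * f z.
Proof.
case: z => x y hz; have r20 : 0 < r / 2 by rewrite divr_gt0.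
have hx := le_lt_trans (normRe_cabs _) hz; have hy := le_lt_trans (normIm_cabs _) hz.
rewrite /= !ltr_norml in hx hy.
by apply: Cauchy_formula => //; [move: hx|move: hy]; lra.
Qed.

Let tau : R[i] := 2 * 'i * pi%:C.

Let cabs_tau : 1 <= cabs tau. Proof. exact: cabs_2ipi_ge1. Qed.

Let tau0 : tau != 0.
Proof. by rewrite -cabs_gt0 (lt_le_trans _ cabs_tau). Qed.

Lemma cder1_cauchy_int z : cabs (z - (x0 +i* y0)) < r / 2 ->
  cder 1 f z = tau^-1 * cauchy_int 2 z.
Proof.
move=> hz; apply: (has_cder_derive _).2.
have h : has_cder (fun w => tau^-1 * cauchy_int 1 w) z (tau^-1 * cauchy_int 2 z).
  have := has_cderZ tau^-1 (@cauchy_int_has_cder 1 z hz); by rewrite mul1r.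
apply: has_cder_near h; exists (r / 2 - cabs (z - (x0 +i* y0))); first by rewrite subr_gt0.
move=> w hw; have H : cabs (w - (x0 +i* y0)) < r / 2.
  by have T := cabs_triangle w z (x0 +i* y0); move: T hw; lra.
by rewrite cauchy_int1// mulKf.
Qed.

Let z00 : cabs ((x0 +i* y0) - (x0 +i* y0)) < r / 2.
Proof. by rewrite subrr cabs0 divr_gt0. Qed.

(** Near the centre the derivative is a Cauchy integral of order 2, which is differentiable in turn.
    A square around each point of the disc then gives [holo_cder1]. *)
Lemma cder1_square_cderivable : cderivable (cder 1 f) (x0 +i* y0).
Proof.
apply: (has_cder_derive (l := tau^-1 * (2%:R * cauchy_int 3 (x0 +i* y0))) _).1.
have h := has_cderZ tau^-1 (@cauchy_int_has_cder 2 (x0 +i* y0) z00).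
apply: has_cder_near h; exists (r / 2); first by rewrite divr_gt0.
by move=> w hw; rewrite cder1_cauchy_int.
Qed.

Lemma cder1_square_le (M : R) :
  (forall x y, x0 - r <= x <= x0 + r -> y0 - r <= y <= y0 + r -> cabs (f (x +i* y)) <= M) ->
  cabs (cder 1 f (x0 +i* y0)) <= 16 * M / r.
Proof.
move=> fM; rewrite cder1_cauchy_int// cabsM cabsV.
have I := cauchy_int_integrable 2 z00.
have H : cabs (cauchy_int 2 (x0 +i* y0)) <= 16 * M / r.
  apply: (le_trans (Irect_le (M := M / r ^+ 2) xr yr I _)).
    move=> x y xy; rewrite cabsM; have h := boundary_far r0 xy.
    rewrite ler_pM ?cabs_ge0//; first by case: xy => ? ? _; exact: fM.
    rewrite cabsV cabsX lef_pV2 ?posrE ?exprn_gt0// ?(lt_le_trans r0)//.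
    by rewrite ler_pXn2r// nnegrE ?cabs_ge0 ?ltW.
  by have -> : 4 * (x0 + r - (x0 - r) + (y0 + r - (y0 - r))) * (M / r ^+ 2) = 16 * M / r
    by field; rewrite gt_eqF.
apply: le_trans H; apply: ler_piMl; first exact: cabs_ge0.
by rewrite invf_le1// (lt_le_trans _ cabs_tau).
Qed.

End Square.

Lemma cball_square (x0 y0 r x y : R) : x0 - r <= x <= x0 + r -> y0 - r <= y <= y0 + r ->
  cabs (x +i* y - (x0 +i* y0)) <= 2 * r.
Proof.
move=> h1 h2; rewrite (le_trans (cabs_ReIm _))//=.
have hx : `|x - x0| <= r by rewrite ler_norml; lra.
have hy : `|y - y0| <= r by rewrite ler_norml; lra.
lra.
Qed.

Lemma holo_cder1 f : holo f -> holo (cder 1 f).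
Proof.
move=> hf [x0 y0] zD; set z := x0 +i* y0.
have d0 : 0 < 1 - cabs z by rewrite subr_gt0.
apply: (@cder1_square_cderivable f x0 y0 ((1 - cabs z) / 4)); first by rewrite divr_gt0.
move=> x y hx hy; apply: hf; apply: (discC_ball zD).
by rewrite -/z (le_lt_trans (cball_square hx hy))//; lra.
Qed.

Lemma holo_cder k f : holo f -> holo (cder k f).
Proof. by move=> hf; elim: k => [//|k IH]; rewrite cderS; exact: holo_cder1. Qed.

Lemma cauchy_estimate1 f z r M : holo f -> 0 < r ->
  (forall w, cabs (w - z) <= r -> discC w /\ cabs (f w) <= M) ->
  cabs (cder 1 f z) <= 32 * M / r.
Proof.
case: z => x0 y0 hf r0 H.
have r20 : 0 < r / 2 by rewrite divr_gt0.
have S x y : x0 - r / 2 <= x <= x0 + r / 2 -> y0 - r / 2 <= y <= y0 + r / 2 ->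
    cabs (x +i* y - (x0 +i* y0)) <= r.
  by move=> hx hy; rewrite (le_trans (cball_square hx hy))//; lra.
rewrite (le_trans (@cder1_square_le f x0 y0 (r / 2) r20 _ M _))//.
- by move=> x y hx hy; apply: hf; apply: (H _ (S _ _ hx hy)).1.
- by move=> x y hx hy; apply: (H _ (S _ _ hx hy)).2.
- by rewrite le_eqVlt; apply/orP; left; apply/eqP; field; rewrite gt_eqF.
Qed.

(** Induction with half of the radius for [f^(k)] and half for the last derivative, hence the factor
    [32 * 2^(k + 1)]. What matters is that [C] depends only on [k]. *)
Lemma cauchy_estimate k : exists2 C : R, 0 < C & forall f z r M, holo f -> 0 < r ->
  (forall w, cabs (w - z) <= r -> discC w /\ cabs (f w) <= M) ->
  cabs (cder k f z) <= C * M / r ^+ k.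
Proof.
elim: k => [|k [C C0 IH]].
  exists 1 => // f z r M _ r0 H; rewrite expr0 divr1 mul1r.
  by apply: (H z _).2; rewrite subrr cabs0 ltW.
exists (32 * C * 2 ^+ k.+1); first by rewrite !mulr_gt0// exprn_gt0.
move=> f z r M hf r0 H; rewrite cderS.
have r20 : 0 < r / 2 by rewrite divr_gt0.
rewrite (le_trans (@cauchy_estimate1 _ z (r / 2) (C * M / (r / 2) ^+ k) (holo_cder hf) r20 _))//.
  move=> w wz; split; first by apply: (H w _).1; lra.
  apply: IH => // v vw; apply: H.
  by have T := cabs_triangle v w z; move: T vw wz; lra.
rewrite le_eqVlt; apply/orP; left; apply/eqP.
by rewrite exprMn !exprS exprVn; field; rewrite expf_neq0 ?gt_eqF.
Qed.

End Smooth.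

(** * Mean value inequalities over discs *)

Section Meas.
Variable R : realType.
Implicit Types (f : R[i] -> R[i]) (z w : R[i]) (r M : R).

Definition plane_open (U : set (plane R)) := forall x, U x -> exists2 r : R, 0 < r &
  forall y : plane R, `|y.1 - x.1| < r -> `|y.2 - x.2| < r -> U y.

(** The sigma-algebra of the plane is a product, so an open set is written as the union of the
    countably many rational rectangles that it contains. *)
Lemma plane_open_measurable U : plane_open U -> measurable U.
Proof.
move=> oU.
pose rect (t : rat * rat * (rat * rat)) : set (plane R) :=
  `]ratr t.1.1, ratr t.1.2[ `*` `]ratr t.2.1, ratr t.2.2[.
pose F t : set (plane R) := [set x | rect t x /\ rect t `<=` U].
have -> : U = \bigcup_t F t.
  rewrite eqEsubset; split=> [x /[dup] Ux /oU[r r0 hr]|x [t _]]; last first.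
    by case=> h; apply.
  have [a ax] : exists a, x.1 - r < ratr a < x.1.
    have [a] := @rat_in_itvoo R (x.1 - r) x.1 ltac:(lra).
    by rewrite in_itv /=; exists a.
  have [b bx] : exists b, x.1 < ratr b < x.1 + r.
    have [b] := @rat_in_itvoo R x.1 (x.1 + r) ltac:(lra).
    by rewrite in_itv /=; exists b.
  have [c cx] : exists c, x.2 - r < ratr c < x.2.
    have [c] := @rat_in_itvoo R (x.2 - r) x.2 ltac:(lra).
    by rewrite in_itv /=; exists c.
  have [d dx] : exists d, x.2 < ratr d < x.2 + r.
    have [d] := @rat_in_itvoo R x.2 (x.2 + r) ltac:(lra).
    by rewrite in_itv /=; exists d.
  have rU : rect ((a, b), (c, d)) `<=` U.
    move=> y [/=]; rewrite !in_itv /= => y1 y2.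
    by apply: hr; rewrite ltr_norml; lra.
  exists ((a, b), (c, d)) => //; split => //.
  by split => /=; rewrite in_itv /=; lra.
apply: countable_bigcupT_measurable; first exact: countableP.
move=> t; have [h|h] := pselect (rect t `<=` U); last first.
  by have -> : F t = set0 by rewrite -subset0 => x [].
have -> : F t = rect t by rewrite eqEsubset; split=> [x []|x].
by apply: measurableX; exact: measurable_itv.
Qed.

Lemma plane_openP (U : set R[i]) :
  (forall z, U z -> exists2 r : R, 0 < r & forall w, cabs (w - z) < r -> U w) ->
  plane_open [set x | U (toC x)].
Proof.
move=> h x /h[r r0 hr]; exists (r / 2) => [|y h1 h2]; first by rewrite divr_gt0.
apply: hr; rewrite (le_lt_trans (cabs_ReIm _))//= [ltRHS]splitr ltrD//.
Qed.

Definition pball z r : set (plane R) := [set x | cabs (toC x - z) < r].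

Lemma measurable_pball z r : measurable (pball z r).
Proof.
apply: plane_open_measurable; apply: (@plane_openP [set w | cabs (w - z) < r]) => w /= wz.
exists (r - cabs (w - z)); first by rewrite subr_gt0.
by move=> v h /=; have T := cabs_triangle v w z; move: T h; lra.
Qed.

Lemma disc_pball : @disc R = pball 0 1.
Proof. by apply/funext => x; rewrite /disc /pball /mkset subr0. Qed.

Lemma measurable_disc : measurable (@disc R).
Proof. by rewrite disc_pball; exact: measurable_pball. Qed.

Lemma ccont_measurable_disc f : (forall z, discC z -> ccont f z) ->
  measurable_fun (@disc R) (fun x => cabs (f (toC x))).
Proof.
move=> cf; apply: (measurability _ (RGenOInfty.measurableE R)) => _ [_ [t ->] <-].
have -> : @disc R `&` (fun x => cabs (f (toC x))) @^-1` `]t, +oo[ =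
    [set x | [set z | discC z /\ t < cabs (f z)] (toC x)].
  by apply/seteqP; split=> x /=; rewrite in_itv /= andbT.
apply: plane_open_measurable; apply: plane_openP => z [zD tf].
have e0 : 0 < cabs (f z) - t by rewrite subr_gt0.
have /ccontP/(_ _ e0)[r r0 hr] := cf _ zD.
exists (Num.min r (1 - cabs z)); first by rewrite lt_min r0 subr_gt0.
move=> w; rewrite lt_min => /andP[/hr h1 h2]; split => /=; first exact: discC_ball h2.
by have T := cabsB_ge (f z) (f w); rewrite cabsBC in h1; move: T h1; lra.
Qed.

Lemma holo_ccont f z : holo f -> discC z -> ccont f z.
Proof. by move=> hf zD; apply: cderivable_cont; exact: hf. Qed.

Lemma holo_measurable_powR f p : holo f ->
  measurable_fun (@disc R) (fun x => (powR (cabs (f (toC x))) p)%:E).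
Proof.
move=> hf; apply/measurable_EFinP.
apply: (@measurableT_comp _ _ _ _ _ _ (@powR R ^~ p)); first exact: measurable_powR.
by apply: ccont_measurable_disc => z; exact: holo_ccont.
Qed.

End Meas.

(** * Area mean value inequality for p = 1 *)

Section AreaMean.
Variable R : realType.
Implicit Types (f g : R[i] -> R[i]) (z w : R[i]) (a b c d r M : R).
Local Notation leb := (@lebesgue_measure R).

Lemma Irect_cabs_le g a b c d (S : R) : Irect_integrable g a b c d ->
  (\int[leb]_(x in `[a, b]) (cabs (g (x +i* c)))%:E <= S%:E)%E ->
  (\int[leb]_(x in `[a, b]) (cabs (g (x +i* d)))%:E <= S%:E)%E ->
  (\int[leb]_(y in `[c, d]) (cabs (g (b +i* y)))%:E <= S%:E)%E ->
  (\int[leb]_(y in `[c, d]) (cabs (g (a +i* y)))%:E <= S%:E)%E ->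
  cabs (Irect g a b c d) <= 8 * S.
Proof.
move=> [h1 h2 h3 h4] s1 s2 s3 s4.
have H (h : R -> R[i]) l m : cintegrable h l m ->
    (\int[leb]_(x in `[l, m]) (cabs (h x))%:E <= S%:E)%E -> cabs (cint h l m) <= 2 * S.
  move=> hi hS; rewrite -lee_fin (le_trans (cint_le hi))// EFinM.
  by apply: lee_wpmul2l => //; rewrite lee_fin.
have -> : 8 * S = (2 * S + 2 * S) + (2 * S + 2 * S) by ring.
rewrite /Irect (le_trans (cabsD _ _))// lerD//.
  by rewrite (le_trans (cabsD _ _))// cabsN lerD//; [exact: H h1 s1|exact: H h2 s2].
rewrite cabsM.
by rewrite cabs_i mul1r (le_trans (cabsD _ _))// cabsN lerD//; [exact: H h3 s3|exact: H h4 s4].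
Qed.

(** If [G] exceeded this value on all of [[a, b]], its integral would be at least [I + e]; the slack
    [e] makes weak inequalities sufficient for the contradiction. *)
Lemma exists_le_avg (G : R -> \bar R) a b (I e : R) : measurable_fun setT G ->
  (forall x, 0 <= G x)%E -> a < b -> 0 < e ->
  (\int[leb]_x G x <= I%:E)%E ->
  exists2 c, a <= c <= b & (G c <= ((I + e) / (b - a))%:E)%E.
Proof.
move=> mG G0 ab e0 GI; apply: contrapT => /forall2NP h.
have ba0 : 0 < b - a by rewrite subr_gt0.
have : (\int[leb]_(x in `[a, b]) ((I + e) / (b - a))%:E <= I%:E)%E.
  apply: (le_trans _ GI).
  apply: (@le_trans _ _ (\int[leb]_(x in `[a, b]) G x)%E); last first.
    by apply: ge0_subset_integral => //.
  apply: ge0_le_integral => //=.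
  - move=> x _; rewrite lee_fin divr_ge0 ?(ltW ba0)//.
    have : (0 <= \int[leb]_x G x)%E by apply: integral_ge0.
    by move=> /le_trans/(_ GI); rewrite lee_fin => ?; rewrite addr_ge0// ltW.
  - exact: measurable_funTS.
  - by move=> x; rewrite in_itv /= => xab; have [//|/negP] := h x; rewrite -ltNge => /ltW.
have -> : (\int[leb]_(x in `[a, b]) (cst ((I + e) / (b - a))%:E x) = ((I + e) / (b - a))%:E * leb
  `[a, b])%E.
  exact: integral_cst.
rewrite (itv_length (ltW ab)) -EFinM divfK ?gt_eqF// lee_fin; lra.
Qed.

Lemma integral_cabsM_le (h k : R -> R[i]) l m (K S : R) :
  cintegrable h l m -> cintegrable (fun t => h t * k t) l m -> 0 <= K ->
  (forall t, l <= t <= m -> cabs (k t) <= K) ->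
  (\int[leb]_(t in `[l, m]) (cabs (h t))%:E <= S%:E)%E ->
  (\int[leb]_(t in `[l, m]) (cabs (h t * k t))%:E <= (K * S)%:E)%E.
Proof.
move=> hi hki K0 kK hS.
apply: (@le_trans _ _ (\int[leb]_(t in `[l, m]) (K%:E * (cabs (h t))%:E))%E).
  apply: ge0_le_integral => //=.
  - by move=> t _; rewrite lee_fin cabs_ge0.
  - exact: cintegrable_mcabs hki.
  - by apply: measurable_funeM; exact: cintegrable_mcabs hi.
  - move=> t; rewrite in_itv /= => lm; rewrite -EFinM lee_fin cabsM mulrC.
    by rewrite ler_wpM2r ?cabs_ge0// kK.
rewrite ge0_integralZl//; first by rewrite EFinM lee_wpmul2l.
- exact: cintegrable_mcabs hi.
- by move=> t _; rewrite lee_fin cabs_ge0.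
Qed.

Lemma sides_far x0 y0 s a b c d x y : 0 < s ->
  a <= x0 - s -> x0 + s <= b -> c <= y0 - s -> y0 + s <= d ->
  on_boundary a b c d x y -> s <= cabs (x +i* y - (x0 +i* y0)).
Proof.
move=> s0 ha hb hc hd [hx hy H].
have rr : `|x - x0| <= cabs (x +i* y - (x0 +i* y0)) by exact: (normRe_cabs (x +i* y - (x0 +i* y0))).
have ri : `|y - y0| <= cabs (x +i* y - (x0 +i* y0)) by exact: (normIm_cabs (x +i* y - (x0 +i* y0))).
case: H => h; [apply: le_trans rr|apply: le_trans rr|apply: le_trans ri|apply: le_trans ri];
  rewrite ler_normr h; apply/orP;
  [right; clear - ha|left; clear - hb|right; clear - hc|left; clear - hd]; lra.
Qed.

(** Cauchy's formula with the kernel bounded by [1 / s]: an interior value is controlled by the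
    integrals of [|f|] along the sides, without a bound for its maximum. *)
Lemma cauchy_sides f x0 y0 s a b c d S : 0 < s ->
  a <= x0 - s -> x0 + s <= b -> c <= y0 - s -> y0 + s <= d ->
  (forall x y, a <= x <= b -> c <= y <= d -> cderivable f (x +i* y)) ->
  (\int[leb]_(x in `[a, b]) (cabs (f (x +i* c)))%:E <= S%:E)%E ->
  (\int[leb]_(x in `[a, b]) (cabs (f (x +i* d)))%:E <= S%:E)%E ->
  (\int[leb]_(y in `[c, d]) (cabs (f (b +i* y)))%:E <= S%:E)%E ->
  (\int[leb]_(y in `[c, d]) (cabs (f (a +i* y)))%:E <= S%:E)%E ->
  cabs (f (x0 +i* y0)) <= 8 * (s^-1 * S).
Proof.
move=> s0 ha hb hc hd df S1 S2 S3 S4; set z := x0 +i* y0.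
have ax : a < x0 by lra.
have xb : x0 < b by lra.
have cy : c < y0 by lra.
have yd : y0 < d by lra.
have ab : a <= b by rewrite ltW// (lt_trans ax).
have cd : c <= d by rewrite ltW// (lt_trans cy).
have far x y : on_boundary a b c d x y -> s <= cabs (x +i* y - z) by exact: sides_far.
have Rf : Irect_integrable f a b c d.
  by apply: ccont_Irect_integrable => // x y [hx hy _]; exact: cderivable_cont (df _ _ hx hy).
have Rg : Irect_integrable (fun w => f w * (w - z)^-1) a b c d.
  apply: ccont_Irect_integrable => // x y xy; have fxy := far _ _ xy; case: xy => hx hy _.
  have nz : x +i* y != z by rewrite -subr_eq0 -cabs_gt0 (lt_le_trans _ fxy).
  have [l hl] := has_cder_cauchy_kernel nz.
  exact: has_cder_cont (has_cderM (cderivable_has (df _ _ hx hy)) hl).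
have C : Irect (fun w => f w * (w - z)^-1) a b c d = 2 * 'i * pi%:C * f z.
  by apply: Cauchy_formula; rewrite ?ax ?xb ?cy ?yd.
have kl x y : on_boundary a b c d x y -> cabs (x +i* y - z)^-1 <= s^-1.
  by move=> /far h; rewrite cabsV lef_pV2// posrE (lt_le_trans s0).
have si : 0 <= s^-1 by rewrite invr_ge0 ltW.
have [R1 R2 R3 R4] := Rg; have [Q1 Q2 Q3 Q4] := Rf.
have L : cabs (Irect (fun w => f w * (w - z)^-1) a b c d) <= 8 * (s^-1 * S).
  apply: (Irect_cabs_le Rg).
  - apply: (integral_cabsM_le Q1 R1 si _ S1) => x hx.
    by apply: kl; split; rewrite ?lexx ?cd//; constructor 3.
  - apply: (integral_cabsM_le Q2 R2 si _ S2) => x hx.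
    by apply: kl; split; rewrite ?lexx ?cd//; constructor 4.
  - apply: (integral_cabsM_le Q3 R3 si _ S3) => x hx.
    by apply: kl; split; rewrite ?lexx ?ab//; constructor 2.
  - apply: (integral_cabsM_le Q4 R4 si _ S4) => x hx.
    by apply: kl; split; rewrite ?lexx ?ab//; constructor 1.
apply: le_trans L; rewrite C cabsM; apply: ler_peMl; first exact: cabs_ge0.
exact: cabs_2ipi_ge1.
Qed.

Lemma exists_frame x0 s a b : 0 < s ->
  x0 - s <= a <= x0 - s + s / 2 -> x0 + s / 2 <= b <= x0 + s / 2 + s / 2 ->
  [/\ a <= x0 - s / 2, x0 + s / 2 <= b & forall x, a <= x <= b -> x0 - s <= x <= x0 + s].
Proof. by move=> s0 ha hb; split; [lra|lra|move=> x; lra]. Qed.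

(* The sides of the Cauchy rectangle are chosen on lines along which the
   integral of [cabs f] is at most its average. *)
Lemma area_mean1 f z r : holo f -> 0 < r ->
  (forall w, cabs (w - z) < r -> discC w) ->
  ((cabs (f z))%:E <= (288 / r ^+ 2)%:E *
     \int[@area R]_(x in pball z r) (cabs (f (toC x)))%:E)%E.
Proof.
case: z => x0 y0; set z := x0 +i* y0 => hf r0 zD.
have k0 : 0 < 288 / r ^+ 2 by rewrite divr_gt0 ?ltr0n ?exprn_gt0.
have k0' : (0 < (288 / r ^+ 2)%:E :> \bar R)%E by rewrite lte_fin.
(* The square of half side [s] lies in the ball of radius [2 s < r]. The sides are chosen in its
   outer strips of width [s / 2], hence at distance at least [s / 2] from the centre, and
   [288 / r^2 = 8 (2 / s) (2 / s)]. *)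
pose s := r / 3.
have s0 : 0 < s by rewrite divr_gt0.
have s20 : 0 < s / 2 by rewrite divr_gt0.
have inB x y : x0 - s <= x <= x0 + s -> y0 - s <= y <= y0 + s -> cabs (x +i* y - z) < r.
  by move=> hx hy; rewrite (le_lt_trans (cball_square hx hy))// /s; clear - r0; lra.
(* Extended by 0, [|f|] can be integrated over whole lines, and such an integral bounds the one
   along a side wherever the side ends. *)
pose H : plane R -> \bar R := (fun x : plane R => (cabs (f (toC x)))%:E) \_ (pball z r).
have mB := measurable_pball z r.
have BD : pball z r `<=` @disc R by move=> x; exact: zD.
have mH : measurable_fun setT H.
  have m1 := ccont_measurable_disc (fun w => @holo_ccont R f w hf).
  have m2 := measurable_funS (@measurable_disc R) BD m1.
  have m3 := iffRL (measurable_EFinP _ _) m2.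
  exact: (iffLR (measurable_restrictT _ mB) m3).
have H0 x : (0 <= H x)%E.
  by rewrite /H /patch; case: ifP => // _; rewrite lee_fin cabs_ge0.
have HE x y : cabs (x +i* y - z) < r -> H (x, y) = (cabs (f (x +i* y)))%:E.
  by move=> h; rewrite /H patchE mem_set.
have EI : (\int[@area R]_(x in pball z r) (cabs (f (toC x)))%:E = \int[@area R]_x H x)%E.
  by rewrite integral_mkcond.
rewrite EI; have I0 : (0 <= \int[@area R]_x H x)%E by exact: integral_ge0.
have [->|Ifin] := eqVneq (\int[@area R]_x H x)%E +oo%E.
  by rewrite (gt0_muley k0') leey.
have {Ifin} : (\int[@area R]_x H x)%E \is a fin_num by rewrite (ge0_fin_numE I0) ltey.
move=> /fineK; set I := fine _ => IE; rewrite -IE -EFinM lee_fin.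
have F1 := @fubini_tonelli1 _ _ _ _ R leb leb H mH H0.
have F2 := @fubini_tonelli2 _ _ _ _ R leb leb H mH H0.
have mF1 := @measurable_fun_fubini_tonelli_F _ _ _ _ R leb H mH H0.
have mF2 := @measurable_fun_fubini_tonelli_G _ _ _ _ R leb H mH H0.
apply/ler_addgt0Pl => e e0.
(* The slack allowed in the choice of the lines; it costs exactly [e] in the end. *)
pose e' := (288 / r ^+ 2)^-1 * e.
have e'0 : 0 < e' by apply: mulr_gt0 e0; rewrite invr_gt0.
have good (G : R -> \bar R) a : measurable_fun setT G -> (forall x, 0 <= G x)%E ->
   (\int[leb]_x G x <= I%:E)%E -> exists2 c, a <= c <= a + s / 2 &
     (G c <= ((I + e') / (s / 2))%:E)%E.
  move=> mG G0 GI; have [|c ac Gc] := @exists_le_avg G a (a + s / 2) I e' mG G0 _ e'0 GI.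
    by rewrite ltrDl.
  by exists c => //; move: Gc; rewrite addrAC subrr add0r.
have F10 x : (0 <= fubini_F leb H x)%E by exact: integral_ge0.
have F20 x : (0 <= fubini_G leb H x)%E by exact: integral_ge0.
have I1 : (\int[leb]_x fubini_F leb H x <= I%:E)%E by rewrite -F1 IE.
have I2 : (\int[leb]_x fubini_G leb H x <= I%:E)%E by rewrite -F2 IE.
have [a ha Ga] := good _ (x0 - s) mF1 F10 I1.
have [b hb Gb] := good _ (x0 + s / 2) mF1 F10 I1.
have [c hc Gc] := good _ (y0 - s) mF2 F20 I2.
have [d hd Gd] := good _ (y0 + s / 2) mF2 F20 I2.
have [a1 b1 inx] := exists_frame s0 ha hb.
have [c1 d1 iny] := exists_frame s0 hc hd.
have mx y : measurable_fun setT (fun x : measurableTypeR R => H (x, y)) by exact: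
  measurable_fun_pair1.
have my x : measurable_fun setT (fun y : measurableTypeR R => H (x, y)) by exact:
  measurable_fun_pair2.
have S (h : R -> R[i]) (K : R -> \bar R) l m (B : \bar R) : measurable_fun setT K ->
    (forall t, 0 <= K t)%E -> (forall t, l <= t <= m -> K t = (cabs (h t))%:E) ->
    (\int[leb]_t K t <= B)%E -> (\int[leb]_(t in `[l, m]) (cabs (h t))%:E <= B)%E.
  move=> mK K0 Kh; apply: le_trans.
  rewrite (@eq_integral _ _ _ leb _ K); last first.
    by move=> t /set_mem; rewrite /= in_itv /= => /Kh ->.
  by apply: ge0_subset_integral.
have ab : a <= b by clear - a1 b1 s20; lra.
have cd : c <= d by clear - c1 d1 s20; lra.
have := @cauchy_sides f x0 y0 (s / 2) a b c d ((I + e') / (s / 2)) s20 a1 b1 c1 d1.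
have -> : 8 * ((s / 2)^-1 * ((I + e') / (s / 2))) = e + 288 / r ^+ 2 * I.
  by rewrite /e' /s; clear - r0; field; rewrite gt_eqF.
apply.
- by move=> x y hx hy; apply: hf; apply: zD; apply: inB; [exact: inx|exact: iny].
- apply: (S (fun x => f (x +i* c)) (fun x => H (x, c)) _ _ _ (mx c) _ _ Gc) => // x hx.
  by apply: HE; apply: inB; [exact: inx|apply: iny; rewrite lexx cd].
- apply: (S (fun x => f (x +i* d)) (fun x => H (x, d)) _ _ _ (mx d) _ _ Gd) => // x hx.
  by apply: HE; apply: inB; [exact: inx|apply: iny; rewrite lexx cd].
- apply: (S (fun y => f (b +i* y)) (fun y => H (b, y)) _ _ _ (my b) _ _ Gb) => // y hy.
  by apply: HE; apply: inB; [apply: inx; rewrite lexx ab|exact: iny].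
- apply: (S (fun y => f (a +i* y)) (fun y => H (a, y)) _ _ _ (my a) _ _ Ga) => // y hy.
  by apply: HE; apply: inB; [apply: inx; rewrite lexx ab|exact: iny].
Qed.

End AreaMean.

(** * Area mean value inequality for p at most 1 *)

Section AreaMeanP.
Variable R : realType.
Implicit Types (f g : R[i] -> R[i]) (z w : R[i]) (p r M : R).

Lemma powR_split (F p : R) : 0 <= F -> 0 < p -> F = powR F p * powR F (1 - p).
Proof.
rewrite le_eqVlt => /predU1P[<- p0|F0 p0].
  by rewrite powR0 ?gt_eqF// mul0r.
rewrite -powRD; last by rewrite (gt_eqF F0) implybT.
by rewrite subrKC powRr1 // ltW.
Qed.

Lemma powR_absorb (F D K I c p : R) : 0 < F -> 0 < p <= 1 -> 0 < D -> 0 <= c ->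
  F <= K / D ^+ 2 * (powR (c * F) (1 - p) * I) ->
  D ^+ 2 * powR F p <= K * powR c (1 - p) * I.
Proof.
move=> F0 /andP[p0 p1] D0 c0.
rewrite powRM ?(ltW F0)// {1}(powR_split (ltW F0) p0).
have P0 : 0 < powR F (1 - p) by exact: powR_gt0.
have -> : K / D ^+ 2 * (c `^ (1 - p) * F `^ (1 - p) * I) =
  (K / D ^+ 2 * (c `^ (1 - p) * I)) * F `^ (1 - p) by ring.
rewrite ler_pM2r// => h.
have D20 : 0 < D ^+ 2 by rewrite exprn_gt0.
have -> : K * c `^ (1 - p) * I = D ^+ 2 * (K / D ^+ 2 * (c `^ (1 - p) * I)).
  by field; rewrite gt_eqF.
by rewrite ler_pM2l.
Qed.

Lemma pball_sub z w r s : cabs (w - z) + s <= r -> pball w s `<=` pball z r.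
Proof.
move=> h x; rewrite /pball /= => hx.
by have T := cabs_triangle (toC x) w z; clear - h hx T; lra.
Qed.

Lemma measurable_pball_powR f z r p : holo f -> (forall w, cabs (w - z) < r -> discC w) ->
  measurable_fun (pball z r) (fun x => (powR (cabs (f (toC x))) p)%:E).
Proof.
move=> hf zD; apply: (measurable_funS (@measurable_disc R) _ (holo_measurable_powR p hf)).
by move=> x; exact: zD.
Qed.

Lemma max_weight f z rho N : holo f -> 0 < rho ->
  (forall w, cabs (w - z) <= rho -> discC w) ->
  exists2 w, cabs (w - z) <= rho & forall v, cabs (v - z) <= rho ->
    (rho - cabs (v - z)) ^+ N * cabs (f v) <= (rho - cabs (w - z)) ^+ N * cabs (f w).
Proof.
move=> hf rho0 zD.
have [||||w wK H] := @ccont_cabs_max R [set w | cabs (w - z) <= rho]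
  (fun w => (rho - cabs (w - z)) ^+ N) f.
- exact: compact_cball.
- by exists z; rewrite /= subrr cabs0 ltW.
- move=> w _.
  have c1 : {for w, continuous (fun w : R[i]^o => cabs (w - z) : R)}.
    apply: (@continuous_comp _ _ _ (fun w : R[i]^o => (w - z : R[i]^o)) (@cabs R)); last exact:
      continuous_cabs.
    apply: (@has_cder_cont _ (fun w => w - z)); exact:
      (has_cderB (has_cder_id _) (has_cder_cst _ _)).
  apply: (@continuous_comp _ _ _ (fun w : R[i]^o => cabs (w - z) : R)
    (fun x : R => (rho - x) ^+ N)) => //.
  apply: (@continuous_comp _ _ _ (fun x : R => rho - x) (fun x => x ^+ N)).
    by apply/differentiable_continuous/derivable1_diffP; exact: ex_derive.
  exact: exprn_continuous.
- by move=> w /zD; exact: holo_ccont.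
- by exists w.
Qed.

(* At a point [w] that maximizes [(rho - |w - z|)^N |f w|], the values of [|f|]
   on a ball around [w] are at most [2^N |f w|], so that the factor [|f|^(1-p)]
   coming from the case [p = 1] can be absorbed. *)
Lemma area_mean_small p : 0 < p <= 1 -> exists2 C : R, 0 < C &
  forall f z r, holo f -> 0 < r -> (forall w, cabs (w - z) < r -> discC w) ->
  ((powR (cabs (f z)) p)%:E <= (C / r ^+ 2)%:E *
     \int[@area R]_(x in pball z r) (powR (cabs (f (toC x))) p)%:E)%E.
Proof.
move=> p01; have /andP[p0 p1] := p01.
(* With [N p >= 2] one has [D^(N p - 2) <= rho^(N p - 2)], so that the maximality of [w], raised to
   the power [p], gives [rho^2 |f z|^p <= D^2 F^p]. *)
have [N Np] : exists N : nat, 2 <= N%:R * p.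
  exists (Num.truncn (2 / p)).+1; rewrite -ler_pdivrMr//.
  by apply/ltW/truncnS_gt.
pose c : R := 2 ^+ N.
have c0 : 0 < c by rewrite exprn_gt0.
(* [1152 = 4 * 288] comes from the radius [D / 2], the outer 4 from [rho = r / 2], and [c = 2^N]
   from comparing [|f|] near [w] with [|f w|]. *)
pose C : R := 4 * (1152 * powR c (1 - p)).
have C0 : 0 < C by rewrite !mulr_gt0 ?ltr0n ?powR_gt0.
exists C => // f z r hf r0 zD.
set II := (\int[@area R]_(x in _) _)%E.
have CC0 : 0 < C / r ^+ 2 by rewrite divr_gt0 ?exprn_gt0.
have II0 : (0 <= II)%E by apply: integral_ge0 => x _; rewrite lee_fin powR_ge0.
have [->|Ifin] := eqVneq II +oo%E.
  have CC0' : (0 < (C / r ^+ 2)%:E :> \bar R)%E by rewrite lte_fin.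
  by rewrite (gt0_muley CC0') leey.
have {Ifin} : II \is a fin_num by rewrite (ge0_fin_numE II0) ltey.
move=> /fineK; set I := fine _ => IE; rewrite -IE -EFinM lee_fin.
have I0 : 0 <= I by rewrite -lee_fin IE.
pose rho := r / 2.
have rho0 : 0 < rho by rewrite divr_gt0.
have rhor : rho < r by rewrite /rho; clear - r0; lra.
have [|w wz wmax] := @max_weight f z rho N hf rho0.
  by move=> w h; apply: zD; exact: le_lt_trans rhor.
have zmax := wmax z; rewrite subrr cabs0 subr0 in zmax.
have {}zmax := zmax (ltW rho0).
pose D := rho - cabs (w - z).
pose F := cabs (f w).
rewrite -/D -/F in zmax wmax.
have D0' : 0 <= D by rewrite subr_ge0.
have [G0|G0] := eqVneq (D ^+ N * F) 0.
  have -> : cabs (f z) = 0.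
    apply/eqP; rewrite eq_le cabs_ge0 andbT -(ler_pM2l (exprn_gt0 N rho0)) mulr0 -G0.
    exact: zmax.
  by rewrite powR0 ?gt_eqF// mulr_ge0// ltW.
have G1 : 0 < D ^+ N * F by rewrite lt_def G0 mulr_ge0 ?exprn_ge0 ?cabs_ge0.
have F0 : 0 < F.
  rewrite lt_def cabs_ge0 andbT; apply: contraNneq G0 => E.
  by rewrite E mulr0.
have D0 : 0 < D.
  rewrite lt_def D0' andbT; apply: contraTneq G1 => ->.
  rewrite expr0n; case: (N) Np => [|k _]; last by rewrite mul0r ltxx.
  by rewrite mul0r => h; exfalso; clear - h; lra.
have D20 : 0 < D / 2 by rewrite divr_gt0.
have Bsub : pball w (D / 2) `<=` pball z r.
  by apply: pball_sub; clear - D0 rhor wz; rewrite /D in D0 *; lra.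
have wD v : cabs (v - w) < D / 2 -> discC v.
  move=> h; apply: zD; have T := cabs_triangle v w z.
  by clear - T D0 h rhor; rewrite /D in D0 h; lra.
have A := area_mean1 hf D20 wD.
have bnd x : pball w (D / 2) x -> cabs (f (toC x)) <= c * F.
  rewrite /pball /= => h.
  have T := cabs_triangle (toC x) w z.
  have hd : D / 2 <= rho - cabs (toC x - z) by clear - T h; rewrite /D in h *; lra.
  have hr : cabs (toC x - z) <= rho by clear - hd D20; lra.
  have H := wmax _ hr.
  have P : 0 < (D / 2) ^+ N by rewrite exprn_gt0.
  rewrite -(ler_pM2l P); have -> : (D / 2) ^+ N * (c * F) = D ^+ N * F.
    by rewrite mulrA /c -exprMn divfK.
  apply: le_trans H; rewrite ler_wpM2r ?cabs_ge0//.
  by apply: lerXn2r => //; rewrite nnegrE; [exact: ltW|exact: le_trans (ltW D20) hd].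
have c1p : 0 <= powR (c * F) (1 - p) by exact: powR_ge0.
have J : (\int[@area R]_(x in pball w (D / 2)) (cabs (f (toC x)))%:E <=
    (powR (c * F) (1 - p))%:E * II)%E.
  have m1 := measurable_pball_powR p hf wD.
  have mB := measurable_pball w (D / 2).
  apply: (@le_trans _ _ (\int[@area R]_(x in pball w (D / 2))
     ((powR (c * F) (1 - p))%:E * (powR (cabs (f (toC x))) p)%:E))%E).
    apply: ge0_le_integral => //.
    - by move=> x _; rewrite lee_fin cabs_ge0.
    - have := measurable_pball_powR 1 hf wD.
      by under eq_fun do rewrite powRr1 ?cabs_ge0//.
    - exact: measurable_funeM.
    - move=> x xB; rewrite -EFinM lee_fin {1}(powR_split (cabs_ge0 (f (toC x))) p0) mulrC.
      rewrite ler_wpM2r ?powR_ge0// ge0_ler_powR ?nnegrE ?cabs_ge0 ?subr_ge0//.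
      + by rewrite mulr_ge0// ltW.
      + exact: bnd.
  rewrite ge0_integralZl//; last by move=> x _; rewrite lee_fin powR_ge0.
  apply: lee_wpmul2l; first by rewrite lee_fin.
  apply: ge0_subset_integral => //.
  - exact: measurable_pball.
  - exact: measurable_pball_powR.
  - by move=> x _; rewrite lee_fin powR_ge0.
have AA : F <= 1152 / D ^+ 2 * (powR (c * F) (1 - p) * I).
  rewrite -lee_fin (le_trans A)//.
  have -> : 1152 / D ^+ 2 = 288 / (D / 2) ^+ 2 by field; rewrite gt_eqF.
  rewrite [leRHS]EFinM; apply: lee_wpmul2l; last by rewrite EFinM IE.
  by rewrite lee_fin divr_ge0 ?ler0n// exprn_ge0// ltW.
have B := powR_absorb F0 p01 D0 (ltW c0) AA.
have {}zmax : powR (rho ^+ N * cabs (f z)) p <= powR (D ^+ N * F) p.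
  apply: ge0_ler_powR => //; rewrite ?nnegrE ?mulr_ge0 ?exprn_ge0 ?cabs_ge0//; exact: ltW.
have E (x : R) : 0 < x -> powR (x ^+ N) p = powR x (N%:R * p - 2) * x ^+ 2.
  move=> x0; rewrite -(powR_mulrn N (ltW x0)) -(powR_mulrn 2 (ltW x0)) -powRrM -powRD ?subrK//.
  by rewrite (gt_eqF x0) implybT.
rewrite !powRM ?exprn_ge0 ?cabs_ge0 ?(ltW D0) ?(ltW rho0)// !E// in zmax.
have P0 : 0 < powR rho (N%:R * p - 2) by exact: powR_gt0.
have DR : powR D (N%:R * p - 2) <= powR rho (N%:R * p - 2).
  rewrite ge0_ler_powR ?nnegrE ?subr_ge0 ?(ltW rho0)//.
  by rewrite lerBlDr lerDl cabs_ge0.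
have : rho ^+ 2 * powR (cabs (f z)) p <= 1152 * powR c (1 - p) * I.
  rewrite -(ler_pM2l P0) mulrA (le_trans zmax)//.
  rewrite -mulrA ler_pM ?powR_ge0// mulr_ge0 ?exprn_ge0 ?powR_ge0//.
have -> : C / r ^+ 2 * I = (1152 * powR c (1 - p) * I) / rho ^+ 2.
  by rewrite /C /rho; field; rewrite gt_eqF.
by rewrite ler_pdivlMr ?exprn_gt0// mulrC.
Qed.

End AreaMeanP.

(** * Mean value inequalities for all exponents and for derivatives *)

Section DerivMean.
Variable R : realType.
Implicit Types (f g : R[i] -> R[i]) (z w : R[i]) (p r M : R).

Lemma holoX f n : holo f -> holo (fun w => f w ^+ n).
Proof.
move=> hf z zD; have h := has_cderX n (cderivable_has (hf z zD)).
exact: (has_cder_derive h).1.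
Qed.

(** The case of exponents at most 1 is applied to the holomorphic function [f^m] with the exponent
    [p / m], where [m >= p]. *)
Lemma area_mean p : 0 < p -> exists2 C : R, 0 < C &
  forall f z r, holo f -> 0 < r -> (forall w, cabs (w - z) < r -> discC w) ->
  ((powR (cabs (f z)) p)%:E <= (C / r ^+ 2)%:E *
     \int[@area R]_(x in pball z r) (powR (cabs (f (toC x))) p)%:E)%E.
Proof.
move=> p0; pose m := (Num.truncn p).+1.
have pm : p <= m%:R by apply/ltW/truncnS_gt.
have m0 : 0 < m%:R :> R by rewrite ltr0n.
have p01 : 0 < p / m%:R <= 1 by rewrite divr_gt0//= ler_pdivrMr// mul1r.
have [C C0 HC] := area_mean_small p01; exists C => // f z r hf r0 zD.
have E w : powR (cabs (f w ^+ m)) (p / m%:R) = powR (cabs (f w)) p.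
  by rewrite cabsX -powR_mulrn ?cabs_ge0// -powRrM mulrC divfK// gt_eqF.
have := HC _ z r (@holoX f m hf) r0 zD; rewrite E.
by under eq_integral do rewrite E.
Qed.

(** Balls of radius [r / 2] around points at distance at most [r / 4] from [z] stay in the given
    ball, so [area_mean] bounds [|f|] at these points by one number [M], to which Cauchy's estimate
    applies. *)
Lemma deriv_mean k p : 0 < p -> exists2 C : R, 0 < C &
  forall f z r, holo f -> 0 < r -> (forall w, cabs (w - z) < r -> discC w) ->
  ((powR (cabs (cder k f z)) p)%:E <= (C * powR r (- (k%:R * p + 2)))%:E *
     \int[@area R]_(x in pball z r) (powR (cabs (f (toC x))) p)%:E)%E.
Proof.
move=> p0; have [C C0 HC] := area_mean p0.
have [B B0 HB] := cauchy_estimate R k.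
pose K := powR (B * 4 ^+ k) p * (4 * C).
have K0 : 0 < K by rewrite mulr_gt0 ?powR_gt0 ?mulr_gt0 ?exprn_gt0 ?ltr0n.
exists K => // f z r hf r0 zD.
set II := (\int[@area R]_(x in _) _)%E.
have P0 : 0 < K * powR r (- (k%:R * p + 2)) by rewrite mulr_gt0 ?powR_gt0.
have II0 : (0 <= II)%E by apply: integral_ge0 => x _; rewrite lee_fin powR_ge0.
have [->|Ifin] := eqVneq II +oo%E.
  have CC0' : (0 < (K * powR r (- (k%:R * p + 2)))%:E :> \bar R)%E by rewrite lte_fin.
  by rewrite (gt0_muley CC0') leey.
have {Ifin} : II \is a fin_num by rewrite (ge0_fin_numE II0) ltey.
move=> /fineK; set I := fine _ => IE; rewrite -IE -EFinM lee_fin.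
have I0 : 0 <= I by rewrite -lee_fin IE.
pose J := C / (r / 2) ^+ 2 * I.
have r20 : 0 < r / 2 by rewrite divr_gt0.
have r40 : 0 < r / 4 by rewrite divr_gt0.
have J0 : 0 <= J by rewrite mulr_ge0// divr_ge0 ?exprn_ge0// ltW.
pose M := powR J p^-1.
have ballD w : cabs (w - z) <= r / 4 -> pball w (r / 2) `<=` pball z r.
  by move=> h; apply: pball_sub; clear - h r0; lra.
have fM w : cabs (w - z) <= r / 4 -> discC w /\ cabs (f w) <= M.
  move=> h; have wD v : cabs (v - w) < r / 2 -> discC v.
    move=> vw; apply: zD; have T := cabs_triangle v w z.
    by clear - T vw h r0; lra.
  split; first by apply: wD; rewrite subrr cabs0.
  have A := HC f w (r / 2) hf r20 wD.
  have {}A : powR (cabs (f w)) p <= J.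
    rewrite -lee_fin (le_trans A)// /J [leRHS]EFinM; apply: lee_wpmul2l.
      by rewrite lee_fin divr_ge0 ?exprn_ge0// ltW.
    rewrite IE; apply: ge0_subset_integral.
    - exact: measurable_pball.
    - exact: measurable_pball.
    - exact: measurable_pball_powR.
    - by move=> x _; rewrite lee_fin powR_ge0.
    - exact: ballD.
  have -> : cabs (f w) = powR (powR (cabs (f w)) p) p^-1.
    by rewrite -powRrM divff ?gt_eqF// powRr1// cabs_ge0.
  by rewrite ge0_ler_powR ?nnegrE ?powR_ge0// invr_ge0 ltW.
have H := HB f z (r / 4) M hf r40 fM.
have M0 : 0 <= M by exact: powR_ge0.
have E : B * M / (r / 4) ^+ k = (B * 4 ^+ k) * (r^-1 ^+ k * M).
  by rewrite !exprMn !exprVn; field; rewrite !expf_neq0// gt_eqF.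
rewrite E in H.
apply: (@le_trans _ _ (powR ((B * 4 ^+ k) * (r^-1 ^+ k * M)) p)).
  rewrite ge0_ler_powR ?nnegrE ?cabs_ge0 ?(ltW p0)// !mulr_ge0 ?exprn_ge0 ?invr_ge0 ?ler0n//;
    exact: ltW.
have ri : 0 <= r^-1 by rewrite invr_ge0 ltW.
rewrite powRM ?mulr_ge0 ?exprn_ge0 ?(ltW B0) ?ler0n// (powRM p (exprn_ge0 k ri) M0).
have -> : powR M p = J by rewrite /M -powRrM mulVf ?gt_eqF// powRr1.
have -> : powR (r^-1 ^+ k) p = powR r (- (k%:R * p)).
  by rewrite -powR_mulrn// -powRrM -powR_inv1 ?(ltW r0)// -powRrM mulN1r.
rewrite opprD powRD; last by rewrite (gt_eqF r0) implybT.
have -> : powR r (- 2) = r ^- 2 by rewrite (powR_invn 2) ?ltW.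
rewrite /K /J le_eqVlt; apply/orP; left; apply/eqP.
by field; rewrite gt_eqF.
Qed.

End DerivMean.

(** * Carleson embedding *)

Section Density.
Local Open Scope ereal_scope.
Context d (T : measurableType d) (R : realType).
Variables (m1 m2 : {measure set T -> \bar R}) (D : set T) (mD : measurable D).
Variable g : T -> R.
Hypothesis g0 : forall x, D x -> (0 <= g x)%R.
Hypothesis mg : measurable_fun D g.
Hypothesis m12 : forall A, measurable A -> A `<=` D -> m1 A = \int[m2]_(x in A) (g x)%:E.

Import HBNNSimple.

Let mgE : measurable_fun D (fun x => (g x)%:E).
Proof. exact/measurable_EFinP. Qed.

Let density_indic E : measurable E ->
  \int[m1]_(x in D) (\1_E x)%:E = \int[m2]_(x in D) ((\1_E x)%:E * (g x)%:E).
Proof.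
move=> mE; rewrite integral_indic// m12; [|exact: measurableI|by move=> x []].
rewrite setIC integral_mkcondr; apply: eq_integral => x _.
by rewrite patchE indicE; case: (x \in E); rewrite ?mul1e ?mul0e.
Qed.

Let density_nnsfun (h : {nnsfun T >-> R}) :
  \int[m1]_(x in D) (h x)%:E = \int[m2]_(x in D) ((h x)%:E * (g x)%:E).
Proof.
under [LHS]eq_integral do rewrite fimfunE -fsumEFin//.
rewrite [LHS]ge0_integral_fsum//; last 2 first.
  - by move=> r; exact/measurable_EFinP/measurableT_comp.
  - by move=> n x _; rewrite EFinM nnfun_muleindic_ge0.
under [RHS]eq_integral.
  move=> x /set_mem xD; rewrite fimfunE -fsumEFin// ge0_mule_fsuml; last first.
    by move=> r; rewrite EFinM nnfun_muleindic_ge0.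
  over.
have H0 n x : D x -> 0 <= (n * \1_(h @^-1` [set n]) x)%:E * (g x)%:E.
  by move=> xD; rewrite mule_ge0// ?lee_fin ?g0// -lee_fin EFinM nnfun_muleindic_ge0.
rewrite [RHS]ge0_integral_fsum//; last first.
  - move=> r; apply: emeasurable_funM => //.
    by apply/measurable_EFinP; do 2 apply/measurableT_comp => //.
apply: eq_fsbigr => r; rewrite inE => -[z _ <-].
under [RHS]eq_integral do rewrite EFinM -muleA.
rewrite ge0_integralZl//; last 3 first.
- by apply: emeasurable_funM => //; exact/measurable_EFinP.
- by move=> x xD; rewrite mule_ge0// lee_fin ?g0.
- by rewrite lee_fin.
by rewrite integralZl_indic_nnsfun//= density_indic.
Qed.

(** By [m12] this holds for indicators, hence for simple functions and, by monotone convergence, for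
    [F]. It serves to integrate against [nu k], which is given by its values on sets. *)
Lemma ge0_integral_density (F : T -> \bar R) : measurable_fun D F ->
  (forall x, D x -> 0 <= F x) ->
  \int[m1]_(x in D) F x = \int[m2]_(x in D) (F x * (g x)%:E).
Proof.
move=> mF F0; pose f_ := nnsfun_approx mD mF.
transitivity (limn (fun n => \int[m1]_(x in D) (f_ n x)%:E)).
  rewrite -monotone_convergence//=.
  - apply: eq_integral => x /[!inE] xD; apply/esym/cvg_lim => //=.
    exact: cvg_nnsfun_approx.
  - by move=> n; apply: measurableT_comp => //; exact: measurable_funTS.
  - by move=> n x _; rewrite lee_fin.
  - by move=> x _ a b ab; rewrite lee_fin//; exact/lefP/nd_nnsfun_approx.
rewrite (_ : \int[m2]_(x in D) _ =
    limn (fun n => \int[m2]_(x in D) ((f_ n x)%:E * (g x)%:E))).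
  by congr (limn _); apply/funext => n /=; rewrite density_nnsfun.
rewrite -monotone_convergence//=.
- apply: eq_integral => x /[!inE] xD; apply/esym/cvg_lim => //.
  apply: cvgeMr => //; exact: cvg_nnsfun_approx.
- move=> n; apply: emeasurable_funM => //.
  by apply: measurableT_comp => //; exact: measurable_funTS.
- by move=> n x xD; rewrite mule_ge0// lee_fin ?g0.
- move=> x xD a b ab; rewrite lee_wpmul2r ?lee_fin ?g0//.
  exact/lefP/nd_nnsfun_approx.
Qed.

End Density.

(** * The kernel of the Carleson embedding *)

Section Embed.
Variable R : realType.
Implicit Types (f g : R[i] -> R[i]) (z w : R[i]) (p q r M : R).

Definition ddist z : R := 1 - cabs z.

(** [bnorm] contains a root and the factor [1 / pi]; with the real number [A], only the exponent
    [q / p] remains. *)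
Lemma bergman_integral p f : bergman p f -> exists2 A : R, 0 <= A &
  (\int[@area R]_(x in @disc R) (powR (cabs (f (toC x))) p)%:E)%E = A%:E /\
  forall q, powR (bnorm p f) q = powR (A / pi) (q / p).
Proof.
rewrite /bergman /bnorm /bergman_int => -[_].
set II := (\int[@area R]_(x in _) _)%E.
have II0 : (0 <= II)%E by apply: integral_ge0 => x _; rewrite lee_fin powR_ge0.
have pi0 : 0 < pi^-1 :> R by rewrite invr_gt0 pi_gt0.
have [->|Ifin] := eqVneq II +oo%E.
  have pi0' : (0 < (pi^-1)%:E :> \bar R)%E by rewrite lte_fin.
  by rewrite (gt0_mulye pi0') ltxx.
have {Ifin} : II \is a fin_num by rewrite (ge0_fin_numE II0) ltey.
move=> /fineK IE _; exists (fine II); first exact: fine_ge0.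
by split => // q; rewrite -IE -EFinM /= -powRrM [_ * q]mulrC.
Qed.

(** Reverses the roles of the points: means are taken over balls around [z], while the measure is
    controlled on balls around [w]. The radii 1/8 and 1/2 leave room for the change of [ddist]. *)
Lemma pball_ddist z w : discC z -> cabs (w - z) < ddist z / 8 ->
  [/\ discC w, cabs (z - w) < ddist w / 2 & ddist w <= 9 / 8 * ddist z].
Proof.
rewrite /discC /ddist /= => zD wz.
have l1 : cabs w <= cabs (w - z) + cabs z by have := cabsD (w - z) z; rewrite subrK.
have l2 : cabs z <= cabs (w - z) + cabs w by have := cabsD (z - w) w; rewrite subrK cabsBC.
by rewrite [cabs (z - w)]cabsBC; split; clear - zD wz l1 l2; lra.
Qed.

Section Kernel.
Variables (f : R[i] -> R[i]) (p s : R).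
Hypothesis hf : holo f.

Let h (y : plane R) : R := powR (cabs (f (toC y))) p * powR (ddist (toC y)) (- s).
Let hD : plane R -> \bar R := (fun y => (h y)%:E) \_ (@disc R).
Let G : set (plane R * plane R) :=
  [set xy | cabs (toC xy.1 - toC xy.2) < ddist (toC xy.2) / 2].

(** The weight is a power of [ddist] at the second variable: it is constant on the sections in the
    first one and cancels against the bound for the measure of a ball. [hD] vanishes outside the
    disc, where nothing is known of [f]. *)
Definition carleson_kernel (xy : plane R * plane R) : \bar R :=
  (hD xy.2 * (\1_G xy)%:E)%E.

Let hD0 y : (0 <= hD y)%E.
Proof. by rewrite /hD patchE; case: ifP => // _; rewrite lee_fin mulr_ge0// powR_ge0. Qed.

Lemma carleson_kernel_ge0 xy : (0 <= carleson_kernel xy)%E.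
Proof. by rewrite mule_ge0// lee_fin indicE. Qed.

Let mtoC1 : measurable_fun setT (fun y : plane R => complex.Re (toC y)).
Proof. exact: measurable_fst. Qed.
Let mtoC2 : measurable_fun setT (fun y : plane R => complex.Im (toC y)).
Proof. exact: measurable_snd. Qed.

Let mddist : measurable_fun setT (fun y : plane R => ddist (toC y)).
Proof. by apply: measurable_funB => //; exact: measurable_cabs. Qed.

Let mhD : measurable_fun setT hD.
Proof.
apply: (iffLR (measurable_restrictT _ (@measurable_disc R))).
apply/measurable_EFinP; apply: measurable_funM.
  exact: (iffLR (measurable_EFinP _ _) (holo_measurable_powR p hf)).
apply: measurable_funTS.
by apply: (@measurableT_comp _ _ _ _ _ _ (@powR R ^~ (- s))) => //; exact: measurable_powR.
Qed.

Let mG : measurable G.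
Proof.
have m1 : measurable_fun setT (fun xy : plane R * plane R => cabs (toC xy.1 - toC xy.2)).
  apply: measurable_cabs.
    rewrite (_ : (fun _ => _) = (fun xy : plane R * plane R => xy.1.1 - xy.2.1)) //.
    apply: measurable_funB.
      by apply: (@measurableT_comp _ _ _ _ _ _ (@fst (measurableTypeR R) (measurableTypeR R))) =>
        //.
    by apply: (@measurableT_comp _ _ _ _ _ _ (@fst (measurableTypeR R) (measurableTypeR R))) => //.
  rewrite (_ : (fun _ => _) = (fun xy : plane R * plane R => xy.1.2 - xy.2.2)) //.
  apply: measurable_funB.
    by apply: (@measurableT_comp _ _ _ _ _ _ (@snd (measurableTypeR R) (measurableTypeR R))) => //.
  by apply: (@measurableT_comp _ _ _ _ _ _ (@snd (measurableTypeR R) (measurableTypeR R))) => //.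
have m2 : measurable_fun setT (fun xy : plane R * plane R => ddist (toC xy.2) / 2).
  apply: measurable_funM => //.
  by apply: (@measurableT_comp _ _ _ _ _ _ (fun y : plane R => ddist (toC y))).
have mt : measurable ([set true] : set bool) by [].
have := measurable_fun_ltr m1 m2 measurableT mt.
rewrite setTI (_ : _ @^-1` _ = G)//.
Qed.

Lemma measurable_carleson_kernel : measurable_fun setT carleson_kernel.
Proof.
apply: emeasurable_funM.
  by apply: (@measurableT_comp _ _ _ _ _ _ hD) => //; exact: measurable_snd.
by apply/measurable_EFinP; exact: measurable_indic.
Qed.

(* By Tonelli, the double integral of the kernel bounds that of
   [|f y|^p] over [|x - y| < ddist x / 8], and its sections in [x] are carried by
   the balls around [y] whose measure is controlled. *)
Lemma carleson_kernel_point x : 0 <= s -> @disc R x ->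
  ((powR (ddist (toC x)) (- s))%:E *
     \int[@area R]_(y in pball (toC x) (ddist (toC x) / 8)) (powR (cabs (f (toC y))) p)%:E <=
   (powR (9 / 8) s)%:E * \int[@area R]_y carleson_kernel (x, y))%E.
Proof.
move=> s0 xD; set z := toC x; set r := ddist z.
have r0 : 0 < r by rewrite subr_gt0.
have BD w : cabs (w - z) < r / 8 -> discC w.
  by move=> /(pball_ddist xD)[].
have mB := measurable_pball z (r / 8).
have mk : measurable_fun setT (fun y => carleson_kernel (x, y)).
  by apply: measurableT_comp; [exact: measurable_carleson_kernel|exact: pair1_measurable].
have k0 y : (0 <= carleson_kernel (x, y))%E by exact: carleson_kernel_ge0.
have c0 : (0 <= (powR (9 / 8) s)%:E :> \bar R)%E by rewrite lee_fin powR_ge0.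
rewrite -ge0_integralZl//; first last.
- by rewrite lee_fin powR_ge0.
- by move=> y _; rewrite lee_fin powR_ge0.
- exact: measurable_pball_powR.
apply: (@le_trans _ _ (\int[@area R]_(y in pball z (r / 8))
  ((powR (9 / 8) s)%:E * carleson_kernel (x, y)))%E).
  apply: ge0_le_integral => //.
  - by move=> y _; rewrite mule_ge0// lee_fin powR_ge0.
  - by apply: measurable_funeM; exact: measurable_pball_powR.
  - by apply: measurable_funeM; exact: measurable_funTS.
  - move=> y yB; have yD : @disc R y by exact: BD.
    have [_ yG dy] := pball_ddist xD yB.
    have dy0 : 0 < ddist (toC y) by rewrite subr_gt0.
    rewrite /carleson_kernel /hD /= patchE mem_set// indicE mem_set// mule1 /h -!EFinM lee_fin.
    rewrite mulrC mulrCA ler_wpM2l ?powR_ge0// !powRN.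
    have c90 : 0 < 9 / 8 * r by rewrite mulr_gt0// divr_gt0// ltr0n.
    rewrite ler_pdivlMr ?powR_gt0// mulrC ler_pdivrMr ?powR_gt0//.
    rewrite -powRM ?(ltW r0) ?divr_ge0 ?ler0n//.
    by apply: ge0_ler_powR; rewrite ?nnegrE ?(ltW dy0) ?(ltW c90).
rewrite ge0_integralZl//; [|by apply: measurable_funTS].
by apply: lee_wpmul2l => //; apply: ge0_subset_integral.
Qed.

Lemma carleson_kernel_section (m : {measure set (plane R) -> \bar R}) (e : R) y :
  (@disc R y -> m (pball (toC y) (ddist (toC y) / 2)) <= (e * powR (ddist (toC y)) s)%:E)%E ->
  (\int[m]_x carleson_kernel (x, y) <=
    (((fun y : plane R => (e * powR (cabs (f (toC y))) p)%:E) \_ (@disc R)) y))%E.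
Proof.
move=> my; rewrite patchE; case: ifPn => [/set_mem yD|yD]; last first.
  rewrite integral0_eq// => x _; rewrite /carleson_kernel /hD /= patchE.
  by rewrite (negbTE yD) mul0e.
have dy0 : 0 < ddist (toC y) by rewrite subr_gt0.
have E x : carleson_kernel (x, y) = ((h y)%:E * (\1_(pball (toC y) (ddist (toC y) / 2)) x)%:E)%E.
  by rewrite /carleson_kernel /hD /= patchE mem_set// !indicE.
under eq_integral do rewrite E.
have mB := measurable_pball (toC y) (ddist (toC y) / 2).
have h0 : 0 <= h y by rewrite mulr_ge0// powR_ge0.
rewrite ge0_integralZl ?lee_fin//; last first.
  by apply/measurable_EFinP; exact: measurable_indic.
rewrite integral_indic// setIT.
apply: (@le_trans _ _ ((h y)%:E * (e * powR (ddist (toC y)) s)%:E)%E).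
  by apply: lee_wpmul2l; [rewrite lee_fin|exact: my].
rewrite -EFinM lee_fin /h powRN le_eqVlt; apply/orP; left; apply/eqP.
by field; rewrite gt_eqF// powR_gt0.
Qed.

End Kernel.
End Embed.

Section Area.
Variable R : realType.
Local Open Scope ereal_scope.

(** [area] is a bare set function; the measure structure and sigma-finiteness, by means of the
    squares of half side [n], are what Tonelli's theorem asks for. *)
HB.instance Definition _ := Measure.copy (@area R)
  (@lebesgue_measure R \x @lebesgue_measure R).

Let area_sigma_finite : sigma_finite setT (@area R).
Proof.
exists (fun n => `[(- n%:R)%R, n%:R] `*` `[(- n%:R)%R, n%:R]).
  apply/esym/seteqP; split=> // -[x y] _.
  exists (Num.truncn (`|x| + `|y|)%R).+1 => //=.
  have h : (`|x| + `|y| <= (Num.truncn (`|x| + `|y|)).+1%:R)%R by apply/ltW/truncnS_gt.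
  rewrite !in_itv /= -!ler_norml; split; apply: le_trans h.
    by rewrite lerDl.
  by rewrite lerDr.
move=> n; split; first by apply: measurableX; exact: measurable_itv.
have -> : area (`[(- n%:R)%R, n%:R] `*` `[(- n%:R)%R, n%:R]) =
    @lebesgue_measure R `[(- n%:R)%R, n%:R] * @lebesgue_measure R `[(- n%:R)%R, n%:R].
  by apply: product_measure1E; exact: measurable_itv.
have n0 : (- n%:R <= n%:R :> R)%R by rewrite (@le_trans _ _ 0%R)// oppr_le0.
by rewrite itv_length// -EFinM ltry.
Qed.

HB.instance Definition _ := Measure_isSigmaFinite.Build _ _ _ (@area R) area_sigma_finite.

Definition area_sfm := [the {sigma_finite_measure set (plane R) -> \bar R} of @area R].

End Area.

(** * The embedding inequality for p at most q *)

Section CarlesonEmbedding.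
Variable R : realType.
Implicit Types (f g : R[i] -> R[i]) (z w : R[i]) (p q r M : R).
Local Notation leb := (@lebesgue_measure R).

(** [deriv_mean] leads to [ix^(q/p)]. As [q / p >= 1], all but one factor [ix] is bounded by a power
    of [A]; the remaining factor is an integral, to which Tonelli's theorem applies. *)
Lemma deriv_powR_le k p q : 0 < p -> p <= q -> exists2 C : R, 0 < C &
  forall f z (A ix : R), holo f -> discC z -> 0 <= ix <= A ->
  (\int[@area R]_(x in pball z (ddist z / 8)) (powR (cabs (f (toC x))) p)%:E)%E = ix%:E ->
  powR (cabs (cder k f z)) q <=
    C * powR A (q / p - 1) * (powR (ddist z) (- ((k%:R + 2 / p) * q)) * ix).
Proof.
move=> p0 pq; have q0 : 0 < q := lt_le_trans p0 pq.
have [C C0 HC] := @deriv_mean R k p p0.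
pose B := C * powR (8^-1) (- (k%:R * p + 2)).
have B0 : 0 < B by rewrite mulr_gt0// powR_gt0// invr_gt0 ltr0n.
exists (powR B (q / p)); first exact: powR_gt0.
move=> f z A ix hf zD /andP[ix0 ixA] ixE.
have r0 : 0 < ddist z by rewrite subr_gt0.
have r80 : 0 < ddist z / 8 by rewrite divr_gt0 ?ltr0n.
have wD w : cabs (w - z) < ddist z / 8 -> discC w by move=> /(pball_ddist zD)[].
have := HC f z _ hf r80 wD; rewrite ixE -EFinM lee_fin => H.
have qp0 : 0 <= q / p by rewrite divr_ge0// ltW.
have -> : powR (cabs (cder k f z)) q = powR (powR (cabs (cder k f z)) p) (q / p).
  by rewrite -powRrM mulrC divfK// gt_eqF.
apply: (@le_trans _ _ (powR (C * powR (ddist z / 8) (- (k%:R * p + 2)) * ix) (q / p))).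
  apply: ge0_ler_powR => //; rewrite nnegrE; first exact: powR_ge0.
  by rewrite !mulr_ge0 ?powR_ge0// ltW.
have P0 x y : 0 <= powR x y :> R by exact: powR_ge0.
rewrite (@powRM _ (ddist z)) ?(ltW r0) ?invr_ge0 ?ler0n//.
have -> : C * (powR (ddist z) (- (k%:R * p + 2)) * powR 8^-1 (- (k%:R * p + 2))) * ix =
   B * (powR (ddist z) (- (k%:R * p + 2)) * ix) by rewrite /B; ring.
rewrite powRM ?(ltW B0) ?mulr_ge0// powRM// -powRrM.
have -> : - (k%:R * p + 2) * (q / p) = - ((k%:R + 2 / p) * q) by field; rewrite gt_eqF.
rewrite -mulrA ler_wpM2l// mulrCA ler_wpM2l//.
rewrite -(mulr_powRB1 ix0); last by rewrite divr_gt0.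
rewrite mulrC ler_wpM2r//; apply: ge0_ler_powR; rewrite ?nnegrE ?ix0 ?(le_trans ix0 ixA)//.
by rewrite subr_ge0 ler_pdivlMr// mul1r.
Qed.

(** [E] is the disc in the bounded case and an annulus in the vanishing case. The bound is linear in
    [e] with a constant independent of [nu] and [E], so a small [e] gives a small integral. *)
Lemma carleson_embed k p q : 0 < p -> p <= q -> exists2 C : R, 0 < C &
  forall (nu : {measure set (plane R) -> \bar R}) (E : set (plane R)) (e : R) f,
  measurable E -> E `<=` @disc R -> (nu E < +oo)%E -> 0 <= e ->
  (forall y, @disc R y -> (nu (pball (toC y) (ddist (toC y) / 2) `&` E) <=
     (e * powR (ddist (toC y)) ((k%:R + 2 / p) * q))%:E)%E) ->
  bergman p f ->
  (\int[nu]_(x in E) (powR (cabs (cder k f (toC x))) q)%:E <=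
    (C * e * powR (bnorm p f) q)%:E)%E.
Proof.
move=> p0 pq; have q0 : 0 < q := lt_le_trans p0 pq.
have [C C0 HC] := deriv_powR_le k p0 pq.
set s := (k%:R + 2 / p) * q in HC *.
have s0 : 0 <= s by rewrite mulr_ge0 ?(ltW q0)// addr_ge0// divr_ge0// ltW.
exists (C * powR (9 / 8) s * powR pi (q / p)).
  by rewrite !mulr_gt0 ?powR_gt0 ?pi_gt0 ?divr_gt0 ?ltr0n.
move=> nu E e f mE ED nuE e0 nue hB; have [hf _] := hB.
have [A A0 [AE ->]] := bergman_integral hB.
have P0 x y : 0 <= powR x y :> R by exact: powR_ge0.
pose K := C * powR A (q / p - 1) * powR (9 / 8) s.
have K0 : 0 <= K by rewrite !mulr_ge0// ltW.
pose ker := carleson_kernel f p s.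
have mk : measurable_fun setT ker by exact: measurable_carleson_kernel.
have k0 xy : (0 <= ker xy)%E by exact: carleson_kernel_ge0.
(* Restricting [nu] to [E] makes it finite, as the exchange of the integrals requires. *)
pose m : {finite_measure set (plane R) -> \bar R} := mfrestr mE nuE.
pose ar := area_sfm R.
have mF := @measurable_fun_fubini_tonelli_F _ _ _ _ R ar ker mk k0.
have F0 x : (0 <= fubini_F ar ker x)%E by exact: integral_ge0.
have md := holo_measurable_powR q (holo_cder (k := k) hf).
have pt x : @disc R x -> ((powR (cabs (cder k f (toC x))) q)%:E <= K%:E * fubini_F ar ker x)%E.
  move=> xD; set z := toC x.
  have BD : pball z (ddist z / 8) `<=` @disc R by move=> y /(pball_ddist xD)[].
  have IA : (\int[@area R]_(y in pball z (ddist z / 8)) (powR (cabs (f (toC y))) p)%:E <= A%:E)%E.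
    rewrite -AE; apply: ge0_subset_integral => //.
    - exact: measurable_pball.
    - exact: measurable_disc.
    - exact: holo_measurable_powR.
    - by move=> y _; rewrite lee_fin.
  have I0 : (0 <= \int[@area R]_(y in pball z (ddist z / 8)) (powR (cabs (f (toC y))) p)%:E)%E.
    by apply: integral_ge0 => y _; rewrite lee_fin.
  have Ifin : (\int[@area R]_(y in pball z (ddist z / 8)) (powR (cabs (f (toC y))) p)%:E)%E \is a
    fin_num.
    by rewrite (ge0_fin_numE I0) (le_lt_trans IA)// ltry.
  have IE := fineK Ifin; set ix := fine _ in IE.
  have ix1 : 0 <= ix <= A by rewrite -!lee_fin IE I0 IA.
  have H1 := HC f z A ix hf xD ix1 (esym IE).
  have H2 := @carleson_kernel_point R f p s hf x s0 xD.
  rewrite -IE -EFinM in H2.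
  rewrite (@le_trans _ _ ((C * powR A (q / p - 1))%:E * (powR (ddist z) (- s) * ix)%:E)%E)//.
  rewrite /K [X in (_ <= X * _)%E]EFinM -muleA; apply: lee_wpmul2l => //.
  by rewrite lee_fin mulr_ge0// ltW.
apply: (@le_trans _ _ (\int[nu]_(x in E) (K%:E * fubini_F ar ker x))%E).
  apply: ge0_le_integral => //.
  - by move=> x _; rewrite lee_fin.
  - exact: measurable_funS (@measurable_disc R) ED md.
  - by apply: measurable_funeM; exact: measurable_funTS.
  - by move=> x /ED; exact: pt.
rewrite (@eq_measure_integral _ _ _ E m nu); last first.
  by move=> B mB BE; rewrite /m /= /mfrestr /mrestr setIidl.
apply: (@le_trans _ _ (\int[m]_x (K%:E * fubini_F ar ker x))%E).
  apply: ge0_subset_integral => //.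
  - exact: measurable_funeM.
  - by move=> x _; rewrite mule_ge0.
rewrite ge0_integralZl// (@fubini_tonelli _ _ _ _ R m ar ker mk k0).
have G0 y : (0 <= fubini_G m ker y)%E by exact: integral_ge0.
have mG := @measurable_fun_fubini_tonelli_G _ _ _ _ R m ker mk k0.
apply: (@le_trans _ _ (K%:E * (e%:E * A%:E))%E).
  apply: lee_wpmul2l => //.
  have mfe : measurable_fun (@disc R) (fun y => (e * powR (cabs (f (toC y))) p)%:E).
    have := measurable_funeM e%:E (holo_measurable_powR p hf).
    by under eq_fun do rewrite -EFinM.
  apply: (@le_trans _ _ (\int[ar]_y
    (((fun y : plane R => (e * powR (cabs (f (toC y))) p)%:E) \_ (@disc R)) y))%E).
    apply: ge0_le_integral => //.
    - by move=> y _; exact: G0.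
    - exact: (iffLR (measurable_restrictT _ (@measurable_disc R)) mfe).
    - by move=> y _; exact: (@carleson_kernel_section R f p s m e y (nue y)).
  rewrite -integral_mkcond.
  under eq_integral do rewrite EFinM.
  rewrite ge0_integralZl//.
  - by rewrite -AE.
  - exact: measurable_disc.
  - exact: holo_measurable_powR.
  - by move=> y _; rewrite lee_fin.
rewrite -!EFinM lee_fin /K.
(* The constant [pi^(q/p)] undoes the normalization of area in [bnorm]. *)
have E1 : A * powR A (q / p - 1) = powR pi (q / p) * powR (A / pi) (q / p).
  rewrite (mulr_powRB1 A0) ?divr_gt0//.
  rewrite -powRM ?pi_ge0 ?divr_ge0 ?pi_ge0// mulrCA divff ?mulr1//.
  by rewrite gt_eqF// pi_gt0.
rewrite le_eqVlt; apply/orP; left; apply/eqP.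
transitivity (C * powR (9 / 8) s * e * (A * powR A (q / p - 1))); first by ring.
by rewrite E1; ring.
Qed.

End CarlesonEmbedding.

(** * Test functions *)

Section Rising.
Variable F : numFieldType.

Definition rising (x : F) (j : nat) : F := \prod_(i < j) (x + i%:R).

Lemma risingS x j : rising x j.+1 = rising x j * (x + j%:R).
Proof. by rewrite /rising big_ord_recr. Qed.

(* A polynomial of degree at most n in the basis of rising factorials that
   vanishes at n.+1 points is zero; evaluating it at 0, -1, -2, etc. kills
   its coordinates one after the other. *)
Lemma rising_invertible (N n : nat) : exists c : 'M[F]_n.+1, forall k j : 'I_n.+1,
  \sum_m c k m * rising (N + m)%:R j = (k == j)%:R.
Proof.
pose A : 'M[F]_n.+1 := \matrix_(m, j) rising (N + m)%:R j.
suff uA : A \in unitmx.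
  exists (invmx A) => k j; have := mulVmx uA => /matrixP/(_ k j).
  by rewrite !mxE => <-; apply: eq_bigr => m _; rewrite !mxE.
rewrite unitmxE unitfE -det_tr; apply/negP => /det0P[v v0 vA].
pose P : {poly F} := \sum_(j < n.+1) v 0 j *: \prod_(i < j) ('X + (i%:R)%:P).
have Px x : P.[x] = \sum_(j < n.+1) v 0 j * rising x j.
  rewrite /P horner_sum; apply: eq_bigr => j _; rewrite hornerZ horner_prod.
  by congr (_ * _); apply: eq_bigr => i _; rewrite hornerD hornerX hornerC.
have sP : (size P <= n.+1)%N.
  apply: (leq_trans (size_sum _ _ _)); apply/bigmax_leqP => j _.
  apply: (leq_trans (size_scale_leq _ _)).
  rewrite (eq_bigr (fun i : 'I_j => 'X - (- i%:R)%:P)); last by move=> i _; rewrite polyCN opprK.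
  by rewrite size_prod_XsubC [index_enum _]unlock -enumT size_enum_ord ltn_ord.
have P0 : P = 0.
  apply: (@roots_geq_poly_eq0 _ P [seq ((N + m)%:R : F) | m <- iota 0 n.+1]).
  - apply/allP => x /mapP[m]; rewrite mem_iota add0n => mn ->.
    rewrite rootE Px; apply/eqP.
    move/matrixP: vA => /(_ 0 (Ordinal mn)); rewrite mxE [RHS]mxE => E; rewrite -[RHS]E.
    by apply: eq_bigr => j _; rewrite !mxE.
  - rewrite map_inj_uniq ?iota_uniq// => a b /eqP.
    by rewrite eqr_nat eqn_add2l => /eqP.
  - by rewrite size_map size_iota.
have vz j (jn : (j < n.+1)%N) : v 0 (Ordinal jn) = 0.
  elim/ltn_ind: j jn => j IH jn.
  have := Px (- j%:R); rewrite P0 horner0 (bigD1 (Ordinal jn))//= big1; last first.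
    move=> [i ilt] /= ne; have [ij|ji|ij] := ltngtP i j.
    - by rewrite IH// mul0r.
    - by rewrite /rising (bigD1 (Ordinal ji))//= addNr mul0r mulr0.
    - by case/eqP: ne; apply: val_inj.
  rewrite addr0 => /esym/eqP; rewrite mulf_eq0 => /orP[/eqP //|].
  rewrite /rising => /prodf_eq0[i _]; rewrite addrC subr_eq0 eqr_nat => /eqP E.
  by have := ltn_ord i; rewrite E ltnn.
by case/eqP: v0; apply/rowP => -[j jn]; rewrite vz mxE.
Qed.

End Rising.

Section TestFunctions.
Variable R : realType.
Implicit Types (f g : R[i] -> R[i]) (z w b : R[i]) (p q r d : R).
Local Notation leb := (@lebesgue_measure R).

Definition tfun b d (M : nat) z : R[i] := (d%:C * (b - z)^-1) ^+ M.

Section Fixed.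
Variables (b : R[i]) (d : R).
Hypothesis d0 : 0 < d.
Hypothesis bd : 1 + d <= cabs b.

Lemma tfun_far z : discC z -> d <= cabs (b - z).
Proof.
rewrite /discC /= => z1; apply: le_trans (cabsB_ge _ _).
by rewrite lerBrDr (le_trans _ bd)// addrC lerD2r ltW.
Qed.

Lemma tfun_neq0 z : discC z -> b - z != 0.
Proof. by move=> /tfun_far h; rewrite -cabs_gt0 (lt_le_trans d0). Qed.

Lemma cabs_tfun1 z : cabs (tfun b d 1 z) = d / cabs (b - z).
Proof. by rewrite /tfun expr1 cabsM cabsV cabsR gtr0_norm. Qed.

Lemma cabs_tfun M z : cabs (tfun b d M z) = (d / cabs (b - z)) ^+ M.
Proof. by rewrite -cabs_tfun1 /tfun cabsX expr1. Qed.

Lemma tfun_has_cder M z : discC z ->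
  has_cder (tfun b d M) z (M%:R * (d^-1)%:C * tfun b d M.+1 z).
Proof.
move=> zD; have nz := tfun_neq0 zD.
have h1 : has_cder (fun w => b - w) z (0 - 1).
  exact: has_cderB (has_cder_cst _ _) (has_cder_id _).
have h2 := has_cderX M (has_cderZ d%:C (@has_cderV R (fun w => b - w) z _ nz h1)).
have -> : M%:R * (d^-1)%:C * tfun b d M.+1 z =
   M%:R * (d%:C * (b - z)^-1) ^+ M.-1 * (d%:C * (- (b - z) ^- 2 * (0 - 1))).
  rewrite /tfun; case: M {h2} => [|M]; first by rewrite !mul0r.
  have dC : d%:C != 0 :> R[i] by rewrite eq_complex /= eqxx andbT gt_eqF.
  rewrite [M.+1.-1]/= !exprS; set t := _ ^+ M.
  by rewrite fmorphV; field; rewrite nz dC.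
exact: h2.
Qed.

Lemma cder_tfun M k z : discC z ->
  cder k (tfun b d M) z = rising M%:R k * (d^-1)%:C ^+ k * tfun b d (M + k) z.
Proof.
move: z; apply: (@cder_has_disc R k (tfun b d M)
  (fun k z => rising M%:R k * (d^-1)%:C ^+ k * tfun b d (M + k) z)).
  by move=> w _; rewrite /rising big_ord0 expr0 addn0 !mul1r.
move=> j w wD.
have := has_cderZ (rising M%:R j * (d^-1)%:C ^+ j) (tfun_has_cder (M + j) wD).
congr (has_cder _ _ _); rewrite risingS exprSr addnS natrD; ring.
Qed.

Lemma tfun_holo M : holo (tfun b d M).
Proof. by move=> z zD; exact: (has_cder_derive (tfun_has_cder M zD)).1. Qed.

End Fixed.
End TestFunctions.

(** * The test functions in the Bergman space *)

Section TestNorm.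
Variable R : realType.
Implicit Types (f g : R[i] -> R[i]) (z w b : R[i]) (p q r d : R).
Local Notation leb := (@lebesgue_measure R).

(** One factor per coordinate of the majorant of [|tfun|^p]. The cut to [[-1, 1]], which contains
    both projections of the disc, leaves an integral over a compact interval, of value at most
    [d pi]. *)
Let square_kernel (t0 d : R) : measurableTypeR R -> \bar R :=
  (fun t : R => (d * (d / ((t - t0) ^+ 2 + d ^+ 2)))%:E) \_ `[-1, 1].

Lemma poisson_kernel_measurable (t0 d : R) : 0 < d ->
  measurable_fun setT (fun t : measurableTypeR R => (d / ((t - t0) ^+ 2 + d ^+ 2))%:E).
Proof.
move=> d0; apply/measurable_EFinP; apply: continuous_measurable_fun.
exact: poisson_kernel_continuous.
Qed.

Lemma poisson_kernel_ge0 (t0 d t : R) : 0 < d -> 0 <= d / ((t - t0) ^+ 2 + d ^+ 2).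
Proof. by move=> d0; rewrite divr_ge0 ?ltW// ltr_wpDl ?sqr_ge0// exprn_gt0. Qed.

Let square_kernel_ge0 t0 d t : 0 < d -> (0 <= square_kernel t0 d t)%E.
Proof.
move=> d0; rewrite /square_kernel patchE; case: ifP => // _.
by rewrite lee_fin mulr_ge0 ?(ltW d0)// poisson_kernel_ge0.
Qed.

Let measurable_square_kernel t0 d : 0 < d -> measurable_fun setT (square_kernel t0 d).
Proof.
move=> d0; apply: (iffLR (measurable_restrictT _ (measurable_itv _))).
apply: measurable_funTS.
have := measurable_funeM d%:E (poisson_kernel_measurable t0 d0).
by under eq_fun do rewrite -EFinM.
Qed.

Let integral_square_kernel1 t0 d : 0 < d -> (\int[leb]_t square_kernel t0 d t <= (d * pi)%:E)%E.
Proof.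
move=> d0; rewrite /square_kernel -integral_mkcond.
under eq_integral do rewrite EFinM.
rewrite ge0_integralZl//; first last.
- by rewrite lee_fin ltW.
- by move=> t _; rewrite lee_fin poisson_kernel_ge0.
- by apply: measurable_funTS; exact: poisson_kernel_measurable.
have N11 : -1 < 1 :> R by exact: lt_trans (ltrN10 R) ltr01.
rewrite (integral_poisson_kernel t0 d0 N11).
rewrite EFinM; apply: lee_wpmul2l; first by rewrite lee_fin ltW.
rewrite lee_fin.
have := atan_ltpi2 ((1 - t0) / d); have := atan_gtNpi2 ((-1 - t0) / d).
by clear; lra.
Qed.

Lemma integral_square_kernel (t0 t1 d : R) : 0 < d ->
  (\int[@area R]_x (square_kernel t0 d x.1 * square_kernel t1 d x.2) <= ((d * pi) ^+ 2)%:E)%E.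
Proof.
move=> d0.
pose H (x : plane R) := (square_kernel t0 d x.1 * square_kernel t1 d x.2)%E.
have mH : measurable_fun setT H.
  apply: emeasurable_funM.
    by apply: (@measurableT_comp _ _ _ _ _ _ (square_kernel t0 d));
      [exact: measurable_square_kernel|exact: measurable_fst].
  by apply: (@measurableT_comp _ _ _ _ _ _ (square_kernel t1 d));
    [exact: measurable_square_kernel|exact: measurable_snd].
have H0 x : (0 <= H x)%E by rewrite mule_ge0// square_kernel_ge0.
rewrite [leLHS](@fubini_tonelli1 _ _ _ _ R leb leb H mH H0).
have c0 : (0 <= (d * pi)%:E :> \bar R)%E by rewrite lee_fin mulr_ge0 ?pi_ge0// ltW.
have kfin t : square_kernel t0 d t \is a fin_num by rewrite /square_kernel patchE; case: ifP.
apply: (@le_trans _ _ (\int[leb]_t (square_kernel t0 d t * (d * pi)%:E))%E).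
  apply: ge0_le_integral => //.
  - by move=> t _; exact: integral_ge0.
  - exact: (@measurable_fun_fubini_tonelli_F _ _ _ _ R leb H mH H0).
  - by apply: emeasurable_funM => //; exact: measurable_square_kernel.
  - move=> t _; rewrite /fubini_F /H /=.
    rewrite -(fineK (kfin t)) ge0_integralZl//.
    + by apply: lee_wpmul2l; [rewrite fineK// square_kernel_ge0|exact: integral_square_kernel1].
    + exact: measurable_square_kernel.
    + by move=> u _; exact: square_kernel_ge0.
    + by rewrite fineK// square_kernel_ge0.
rewrite ge0_integralZr//; [|exact: measurable_square_kernel|by move=> t _; exact:
  square_kernel_ge0].
rewrite expr2 [leRHS]EFinM; apply: lee_wpmul2r => //; exact: integral_square_kernel1.
Qed.

(** [X^2 + d^2] and [Y^2 + d^2] are both at most [2 D^2]. A radial function is thus bounded by a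
    product of functions of one variable, which fixes the exponent 4. *)
Lemma tfun_pow4_le (X Y D d : R) : 0 < d -> d <= D -> D ^+ 2 = X ^+ 2 + Y ^+ 2 ->
  (d / D) ^+ 4 <= 4 * ((d * (d / (X ^+ 2 + d ^+ 2))) * (d * (d / (Y ^+ 2 + d ^+ 2)))).
Proof.
move=> d0 dD E; have D0 : 0 < D := lt_le_trans d0 dD.
have X0 : 0 < X ^+ 2 + d ^+ 2 by rewrite ltr_wpDl ?sqr_ge0// exprn_gt0.
have Y0 : 0 < Y ^+ 2 + d ^+ 2 by rewrite ltr_wpDl ?sqr_ge0// exprn_gt0.
have D20 : 0 < D ^+ 2 by rewrite exprn_gt0.
have dD2 : d ^+ 2 <= D ^+ 2 by rewrite lerXn2r// nnegrE ltW.
have K : (X ^+ 2 + d ^+ 2) * (Y ^+ 2 + d ^+ 2) <= 4 * (D ^+ 2) ^+ 2.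
  have x2 := sqr_ge0 X; have y2 := sqr_ge0 Y; have d2 := sqr_ge0 d.
  rewrite E in dD2 *; clear - x2 y2 d2 dD2.
  move: (X ^+ 2) (Y ^+ 2) (d ^+ 2) x2 y2 d2 dD2 => x y t x0 y0 t0 h; nra.
rewrite -subr_ge0.
have -> : 4 * ((d * (d / (X ^+ 2 + d ^+ 2))) * (d * (d / (Y ^+ 2 + d ^+ 2)))) - (d / D) ^+ 4 =
  d ^+ 4 * (4 * (D ^+ 2) ^+ 2 - (X ^+ 2 + d ^+ 2) * (Y ^+ 2 + d ^+ 2)) /
  ((X ^+ 2 + d ^+ 2) * (Y ^+ 2 + d ^+ 2) * (D ^+ 2) ^+ 2).
  by field; rewrite !gt_eqF.
apply: divr_ge0; first by rewrite mulr_ge0 ?exprn_ge0 ?subr_ge0 ?(ltW d0).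
by rewrite !mulr_ge0 ?(ltW X0) ?(ltW Y0) ?exprn_ge0 ?(ltW D0).
Qed.

Lemma tfun_integral b d (M : nat) p : 0 < d -> 1 + d <= cabs b -> 4 <= M%:R * p ->
  (\int[@area R]_(x in @disc R) (powR (cabs (tfun b d M (toC x))) p)%:E <=
    (4 * (d * pi) ^+ 2)%:E)%E.
Proof.
move=> d0 bd Mp.
have mk : measurable_fun setT (fun x : plane R =>
  (square_kernel (complex.Re b) d x.1 * square_kernel (complex.Im b) d x.2)%E).
  apply: emeasurable_funM.
    by apply: (@measurableT_comp _ _ _ _ _ _ (square_kernel (complex.Re b) d));
      [exact: measurable_square_kernel|exact: measurable_fst].
  by apply: (@measurableT_comp _ _ _ _ _ _ (square_kernel (complex.Im b) d));
    [exact: measurable_square_kernel|exact: measurable_snd].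
have k0 (x : plane R) : (0 <= square_kernel (complex.Re b) d x.1 * square_kernel (complex.Im b) d
  x.2)%E.
  by rewrite mule_ge0// square_kernel_ge0.
apply: (@le_trans _ _ (4%:E * \int[@area R]_x (square_kernel (complex.Re b) d x.1 * square_kernel
  (complex.Im b) d x.2))%E); last first.
  rewrite [leRHS]EFinM; apply: lee_wpmul2l; first by rewrite lee_fin ler0n.
  exact: integral_square_kernel.
rewrite -ge0_integralZl//.
apply: (@le_trans _ _ (\int[@area R]_(x in @disc R)
  (4%:E * (square_kernel (complex.Re b) d x.1 * square_kernel (complex.Im b) d x.2)))%E); last
    first.
  apply: ge0_subset_integral => //.
  - exact: measurable_disc.
  - exact: measurable_funeM.
  - by move=> x _; apply: mule_ge0 => //; rewrite lee_fin ler0n.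
apply: ge0_le_integral => //.
- exact: measurable_disc.
- by move=> x _; rewrite lee_fin powR_ge0.
- by apply: holo_measurable_powR; exact: tfun_holo.
- by apply: measurable_funTS; exact: measurable_funeM.
move=> [x y] xyD.
have z1 : cabs (toC (x, y)) <= 1 by exact: ltW.
have x1 : (-1 <= x <= 1) by rewrite -ler_norml (le_trans (normRe_cabs (toC (x, y)))).
have y1 : (-1 <= y <= 1) by rewrite -ler_norml (le_trans (normIm_cabs (toC (x, y)))).
have far := tfun_far bd xyD.
have D0 : 0 < cabs (b - toC (x, y)) := lt_le_trans d0 far.
rewrite /square_kernel !patchE !mem_set /= ?in_itv//= -!EFinM lee_fin.
rewrite (cabs_tfun b d0).
have g01 : 0 < d / cabs (b - toC (x, y)) <= 1.
  by rewrite divr_gt0//= ler_pdivrMr// mul1r.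
have g0 : 0 <= d / cabs (b - toC (x, y)) by case/andP: g01 => /ltW.
rewrite -powR_mulrn// -powRrM.
(* As the base is at most 1, the exponent [M p >= 4] may be lowered to 4. *)
apply: (@le_trans _ _ ((d / cabs (b - toC (x, y))) ^+ 4)).
  by rewrite -(powR_mulrn 4)//; exact: ger_powR.
apply: tfun_pow4_le => //.
rewrite cabs_sqr; case: (b) => b1 b2 /=.
by rewrite -[_ ^+ 2 in RHS]sqrrN opprB -[X in _ + X = _]sqrrN opprB addrC; congr (_ + _); rewrite
  -sqrrN opprB.
Qed.

End TestNorm.

(** * Sobolev Carleson measures *)

Section Sobolev.
Variable R : realType.
Implicit Types (f g : R[i] -> R[i]) (z w b : R[i]) (p q r d : R).

Lemma holoM f g : holo f -> holo g -> holo (fun z => f z * g z).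
Proof.
move=> hf hg z zD.
exact: (has_cder_derive (has_cderM (cderivable_has (hf _ zD)) (cderivable_has (hg _ zD)))).1.
Qed.

Lemma holo_sum (m : nat) (F : nat -> R[i] -> R[i]) :
  (forall k, (k < m)%N -> holo (F k)) -> holo (fun z => \sum_(k < m) F k z).
Proof.
elim: m => [|m IH] hF z zD.
  apply: (has_cder_derive (l := 0) _).1.
  by under eq_fun do rewrite big_ord0; exact: has_cder_cst.
have h1 := cderivable_has (IH (fun k km => hF k (leqW km)) z zD).
have h2 := cderivable_has (hF m (ltnSn m) z zD).
have -> : (fun z => \sum_(k < m.+1) F k z) = (fun z => \sum_(k < m) F k z + F m z).
  by apply/funext => w; rewrite big_ord_recr.
exact: (has_cder_derive (has_cderD h1 h2)).1.
Qed.

Lemma sob_op_holo n (u : nat -> R[i] -> R[i]) f :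
  (forall k, (k <= n)%N -> holo (u k)) -> holo f -> holo (sob_op n u f).
Proof.
move=> hu hf; apply: (@holo_sum n.+1 (fun k z => u k z * cder k f z)) => k kn.
by apply: holoM; [exact: hu|exact: holo_cder].
Qed.

(** The comparison goes through the maximum of the [a k], which treats [q < 1] and [q >= 1]
    alike. *)
Lemma powR_sum_le (n : nat) (a : 'I_n -> R) q : 0 < q -> (forall k, 0 <= a k) ->
  powR (\sum_k a k) q <= powR n%:R q * \sum_k powR (a k) q.
Proof.
move=> q0 a0; pose M := \big[Num.max/0]_k a k.
have aM k : a k <= M by exact: le_bigmax.
have M0 : 0 <= M by rewrite /M; elim/big_ind: _ => // x y x0 y0; rewrite le_max x0.
have sM : \sum_k a k <= n%:R * M.
  by rewrite -[n in n%:R]card_ord -sumr_const mulr_suml ler_sum// => k _; rewrite mul1r.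
have MS : powR M q <= \sum_k powR (a k) q.
  rewrite /M; elim/big_rec2: _ => [|k S m _ IH]; first by rewrite powR0 ?gt_eqF.
  have S0 : 0 <= S := le_trans (powR_ge0 _ _) IH.
  case: (leP (a k) m) => _; first by rewrite (le_trans IH)// lerDr powR_ge0.
  by rewrite lerDl.
apply: (@le_trans _ _ (powR (n%:R * M) q)).
  apply: ge0_ler_powR; rewrite ?nnegrE ?(ltW q0) ?mulr_ge0//.
  by apply: sumr_ge0.
by rewrite powRM// ler_wpM2l ?powR_ge0.
Qed.

Section Measures.
Variables (n : nat) (q : R) (u : nat -> R[i] -> R[i]).
Variables (mu : {measure set (plane R) -> \bar R}) (nu : nat -> {measure set (plane R) -> \bar R}).
Hypothesis q0 : 0 < q.
Hypothesis hu : forall k, (k <= n)%N -> holo (u k).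
Hypothesis nuE : forall k (A : set (plane R)), (k <= n)%N -> measurable A ->
  nu k A = (\int[mu]_(x in A) (powR (cabs (u k (toC x))) q)%:E)%E.

Lemma weighted_integral k E f : (k <= n)%N -> measurable E -> E `<=` @disc R -> holo f ->
  (\int[nu k]_(x in E) (powR (cabs (f (toC x))) q)%:E)%E =
  (\int[mu]_(x in E) (powR (cabs (u k (toC x) * f (toC x))) q)%:E)%E.
Proof.
move=> kn mE ED hf.
rewrite (@ge0_integral_density _ _ R (nu k) mu E mE (fun x => powR (cabs (u k (toC x))) q)).
- by apply: eq_integral => x _; rewrite -EFinM cabsM mulrC powRM ?cabs_ge0.
- by move=> x _; exact: powR_ge0.
- have := measurable_funS (@measurable_disc R) ED (holo_measurable_powR q (hu kn)).
  by move/measurable_EFinP.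
- by move=> A mA _; exact: nuE.
- exact: (measurable_funS (@measurable_disc R) ED (holo_measurable_powR q hf)).
- by move=> x _; rewrite lee_fin powR_ge0.
Qed.

Lemma sob_int_ge0 f : (0 <= sob_int mu n u q f)%E.
Proof. by apply: integral_ge0 => x _; rewrite lee_fin powR_ge0. Qed.

Lemma der_int_ge0 (m : {measure set (plane R) -> \bar R}) k f : (0 <= der_int m k q f)%E.
Proof. by apply: integral_ge0 => x _; rewrite lee_fin powR_ge0. Qed.

Lemma sob_int_le_der f : holo f ->
  (sob_int mu n u q f <= (powR n.+1%:R q)%:E * \sum_(k < n.+1) der_int (nu k) k q f)%E.
Proof.
move=> hf; rewrite /der_int /sob_int.
under [X in (_ <= _ * X)%E]eq_bigr => k _.
  rewrite (weighted_integral (ltn_ord k) (@measurable_disc R) (@subset_refl _ _)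
    (holo_cder (k := k) hf)).
  over.
have hk (k : 'I_n.+1) : holo (fun z => u k z * cder k f z).
  by apply: holoM; [apply: hu; exact: (ltn_ord k)|exact: holo_cder].
have mk (k : 'I_n.+1) := holo_measurable_powR q (hk k).
rewrite -ge0_integral_sum//; last first.
- by move=> k x _; rewrite lee_fin powR_ge0.
- exact: measurable_disc.
rewrite -ge0_integralZl//; first last.
- by move=> x _; apply: sume_ge0 => k _; rewrite lee_fin powR_ge0.
- by apply: emeasurable_sum => k; exact: mk.
- exact: measurable_disc.
apply: ge0_le_integral => //.
- exact: measurable_disc.
- by move=> x _; rewrite lee_fin powR_ge0.
- exact: (holo_measurable_powR q (sob_op_holo hu hf)).
- by apply: measurable_funeM; apply: emeasurable_sum => k; exact: mk.
move=> x _; rewrite sumEFin -EFinM lee_fin.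
apply: le_trans (powR_sum_le (a := fun k : 'I_n.+1 => cabs (u k (toC x) * cder k f (toC x))) q0
  _); last first.
  by move=> k; exact: cabs_ge0.
apply: ge0_ler_powR; rewrite ?nnegrE ?cabs_ge0 ?(ltW q0)//.
  by apply: sumr_ge0 => k _; exact: cabs_ge0.
exact: cabs_sum.
Qed.

End Measures.
End Sobolev.

(** * The coefficients u_k in terms of the test functions *)

Section TestEstimate.
Variable R : realType.
Implicit Types (f g : R[i] -> R[i]) (z w b : R[i]) (p q r d : R).

Lemma sob_op_tfun n u b d M z : 0 < d -> 1 + d <= cabs b -> discC z ->
  sob_op n u (tfun b d M) z = tfun b d M z *
    \sum_(j < n.+1) rising M%:R j * (u j z * (d^-1)%:C ^+ j * tfun b d j z).
Proof.
move=> d0 bd zD; rewrite /sob_op mulr_sumr; apply: eq_bigr => j _.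
by rewrite (cder_tfun d0 bd)// /tfun exprD; ring.
Qed.

Lemma tfun_coef_le (n N : nat) : exists2 C : R, 0 < C &
  forall u b d z k, 0 < d -> 1 + d <= cabs b -> discC z -> cabs (b - z) <= 4 * d ->
  (k <= n)%N ->
  cabs (u k z) <= C * d ^+ k * \sum_(m < n.+1) cabs (sob_op n u (tfun b d (N + m)) z).
Proof.
have [c cE] := rising_invertible R[i] N n.
pose S : R := \sum_(k < n.+1) \sum_(m < n.+1) cabs (c k m).
have S0 : 0 <= S by apply: sumr_ge0 => k _; apply: sumr_ge0 => m _; exact: cabs_ge0.
have cS k m : cabs (c k m) <= S.
  rewrite /S (bigD1 k)//= (bigD1 m)//= -addrA lerDl addr_ge0// ?sumr_ge0// => i _.
    exact: cabs_ge0.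
  by apply: sumr_ge0 => j _; exact: cabs_ge0.
(* [4^(N + n)] and [4^n] pay for the divisions by [T^(N + m)] and [T^k], where [|T| >= 1/4]; [S]
   bounds the entries of the inverse matrix. *)
exists (4 ^+ (N + n + n) * (S + 1)); first by rewrite mulr_gt0 ?exprn_gt0 ?ltr0n// ltr_wpDl.
move=> u b d z k d0 bd zD bz kn.
have far := tfun_far bd zD.
have bz0 : 0 < cabs (b - z) := lt_le_trans d0 far.
pose T := tfun b d 1 z.
have TM M : tfun b d M z = T ^+ M by rewrite /T /tfun expr1.
have T4 : 4^-1 <= cabs T.
  by rewrite /T cabs_tfun1// ler_pdivlMr// mulrC ler_pdivrMr ?ltr0n// mulrC.
have T0 : T != 0 by rewrite -cabs_gt0 (lt_le_trans _ T4)// invr_gt0 ltr0n.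
(* The [X j] are the unknowns: [LE] is the equation of index [m], and [XE] solves the system by
   means of [c]. *)
pose X j := u j z * (d^-1)%:C ^+ j * T ^+ j.
have LE (m : 'I_n.+1) : T ^- (N + m) * sob_op n u (tfun b d (N + m)) z =
    \sum_(j < n.+1) rising (N + m)%:R j * X j.
  rewrite sob_op_tfun// TM mulKf ?expf_neq0//.
have XE : X k = \sum_(m < n.+1) c (Ordinal (kn : (k < n.+1)%N)) m *
  (T ^- (N + m) * sob_op n u (tfun b d (N + m)) z).
  under eq_bigr => m _ do rewrite LE mulr_sumr.
  rewrite exchange_big /= (bigD1 (Ordinal (kn : (k < n.+1)%N)))//= [X in _ + X]big1 ?addr0.
    under eq_bigr => m _ do rewrite mulrA.
    have := cE (Ordinal (kn : (k < n.+1)%N)) (Ordinal (kn : (k < n.+1)%N)); rewrite eqxx /= => cE'.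
    by rewrite -mulr_suml cE' mul1r.
  move=> j jk; under eq_bigr => m _ do rewrite mulrA.
  by rewrite -mulr_suml cE eq_sym (negbTE jk) mul0r.
have dC : d%:C != 0 :> R[i] by rewrite eq_complex /= eqxx andbT gt_eqF.
have uE : u k z = d%:C ^+ k * (T ^- k * X k).
  rewrite /X fmorphV exprVn; field; by rewrite !expf_neq0.
have Tinv M : (M <= N + n + n)%N -> cabs (T ^- M) <= 4 ^+ M.
  move=> _; rewrite cabsV cabsX -exprVn lerXn2r// ?nnegrE ?invr_ge0 ?cabs_ge0 ?ler0n//.
  by rewrite invf_ple ?posrE ?ltr0n// (lt_le_trans _ T4)// invr_gt0 ltr0n.
rewrite uE cabsM cabsX cabsR (gtr0_norm d0) [_ * d ^+ k]mulrC -[leRHS]mulrA.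
apply: ler_wpM2l; first by rewrite exprn_ge0// ltW.
rewrite cabsM XE.
apply: (@le_trans _ _ (4 ^+ n * \sum_(m < n.+1)
  (S * (4 ^+ (N + n) * cabs (sob_op n u (tfun b d (N + m)) z))))).
  apply: ler_pM; rewrite ?cabs_ge0//.
    rewrite (le_trans (Tinv k _))//; first by rewrite (leq_trans kn)// leq_addl.
    by rewrite ler_eXn2l// ltr1n.
  apply: (le_trans (cabs_sum _ _ _)); apply: ler_sum => m _.
  rewrite !cabsM; apply: ler_pM; rewrite ?mulr_ge0 ?cabs_ge0 ?cS//.
  apply: ler_wpM2r; first exact: cabs_ge0.
  have mn : (m <= n)%N by rewrite -ltnS.
  rewrite (le_trans (Tinv _ _))//; first by rewrite -addnA leq_add2l (leq_trans mn)// leq_addr.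
  by rewrite ler_eXn2l ?ltr1n// leq_add2l.
rewrite -!mulr_sumr !mulrA.
apply: ler_wpM2r; first by apply: sumr_ge0 => m _; exact: cabs_ge0.
rewrite -mulrA [S * _]mulrC mulrA -exprD addnC.
by apply: ler_wpM2l; rewrite ?exprn_ge0 ?ler0n// lerDl.
Qed.

Section Measures.
Variables (n : nat) (q : R) (N : nat).
Hypothesis q0 : 0 < q.

(** Only the power [k q] of [d] appears here; the missing [2 q / p] comes from the norms of the test
    functions. *)
Lemma test_estimate : exists2 C : R, 0 < C &
  forall (u : nat -> R[i] -> R[i]) (mu : {measure set (plane R) -> \bar R})
    (nu : nat -> {measure set (plane R) -> \bar R}),
  (forall k, (k <= n)%N -> holo (u k)) ->
  (forall k (A : set (plane R)), (k <= n)%N -> measurable A ->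
     nu k A = (\int[mu]_(x in A) (powR (cabs (u k (toC x))) q)%:E)%E) ->
  forall b d k, 0 < d -> 1 + d <= cabs b -> (k <= n)%N ->
  (nu k (@disc R `&` pball b (4 * d)) <=
    (C * powR d (k%:R * q))%:E * \sum_(m < n.+1) sob_int mu n u q (tfun b d (N + m)))%E.
Proof.
have [C C0 HC] := tfun_coef_le n N.
exists (powR C q * powR n.+1%:R q); first by rewrite mulr_gt0// powR_gt0// ltr0n.
move=> u mu nu hu nuE b d k d0 bd kn.
have mA : measurable (@disc R `&` pball b (4 * d)).
  by apply: measurableI; [exact: measurable_disc|exact: measurable_pball].
have AD : @disc R `&` pball b (4 * d) `<=` @disc R by move=> x [].
rewrite nuE//.
have mL (m : 'I_n.+1) := holo_measurable_powR q (sob_op_holo hu (tfun_holo d0 bd (M := N + m))).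
set K := _ * powR d _.
have K0 : 0 <= K by rewrite !mulr_ge0// powR_ge0.
have msum : measurable_fun (@disc R) (fun x => \sum_(m < n.+1)
  (powR (cabs (sob_op n u (tfun b d (N + m)) (toC x))) q)%:E)%E.
  by apply: emeasurable_sum => m; exact: mL.
have s0 (x : plane R) : (0 <= \sum_(m < n.+1) (powR
  (cabs (sob_op n u (tfun b d (N + m)) (toC x))) q)%:E)%E.
  by apply: sume_ge0 => m _; rewrite lee_fin powR_ge0.
rewrite /sob_int -ge0_integral_sum//; first last.
- by move=> m x _; rewrite lee_fin powR_ge0.
- exact: measurable_disc.
rewrite -ge0_integralZl//; last exact: measurable_disc.
apply: (@le_trans _ _ (\int[mu]_(x in @disc R `&` pball b (4 * d))
  (K%:E * \sum_(m < n.+1) (powR (cabs (sob_op n u (tfun b d (N + m)) (toC x))) q)%:E)%E)%E); last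
    first.
  apply: ge0_subset_integral => //.
  - exact: measurable_disc.
  - exact: measurable_funeM.
  - by move=> x _; rewrite mule_ge0.
apply: ge0_le_integral => //.
- by move=> x _; rewrite lee_fin powR_ge0.
- exact: (measurable_funS (@measurable_disc R) AD (holo_measurable_powR q (hu _ kn))).
- apply: (measurable_funS (@measurable_disc R) AD); exact: measurable_funeM.
move=> x [xD xB]; rewrite sumEFin -EFinM lee_fin.
have bz : cabs (b - toC x) <= 4 * d by rewrite cabsBC; exact: ltW.
have H := HC u b d (toC x) k d0 bd xD bz kn.
have S0 : 0 <= \sum_(m < n.+1) cabs (sob_op n u (tfun b d (N + m)) (toC x)).
  by apply: sumr_ge0 => m _; exact: cabs_ge0.
apply: (@le_trans _ _ (powR (C * d ^+ k * \sum_(m < n.+1) cabs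
  (sob_op n u (tfun b d (N + m)) (toC x))) q)).
  by apply: ge0_ler_powR; rewrite ?nnegrE ?cabs_ge0 ?(ltW q0)// !mulr_ge0 ?exprn_ge0// ltW.
have dk0 : 0 <= d ^+ k by rewrite exprn_ge0// ltW.
have C0' := ltW C0.
rewrite powRM ?mulr_ge0// powRM//.
rewrite -(powR_mulrn k (ltW d0)) -powRrM.
have P := @powR_sum_le R n.+1 (fun m => cabs (sob_op n u (tfun b d (N + m)) (toC x))) q q0
  (fun m => cabs_ge0 _).
apply: (@le_trans _ _ (powR C q * powR d (k%:R * q) *
  (powR n.+1%:R q * \sum_(m < n.+1) powR (cabs (sob_op n u (tfun b d (N + m)) (toC x))) q))).
  by apply: ler_wpM2l; rewrite ?mulr_ge0 ?powR_ge0.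
by rewrite /K le_eqVlt; apply/orP; left; apply/eqP; ring.
Qed.

End Measures.
End TestEstimate.

Section Final.
Variable R : realType.
Implicit Types (f g : R[i] -> R[i]) (z w b : R[i]) (p q r d : R).

Lemma tfun_bergman b d M p : 0 < p -> 0 < d -> 1 + d <= cabs b -> 4 <= M%:R * p ->
  bergman p (tfun b d M) /\
  forall q, 0 <= q -> powR (bnorm p (tfun b d M)) q <= powR (4 * pi) (q / p) * powR d (2 / p * q).
Proof.
move=> p0 d0 bd Mp; have I := tfun_integral d0 bd Mp.
have B : bergman p (tfun b d M).
  split; first exact: tfun_holo.
  rewrite /bergman_int; apply: le_lt_trans (ltry (4 * (d * pi) ^+ 2 * pi^-1)).
  by rewrite [leRHS]EFinM; apply: lee_wpmul2r => //; rewrite lee_fin invr_ge0 pi_ge0.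
split => // q q_ge0; have [A A0 [AE ->]] := bergman_integral B.
rewrite AE lee_fin in I; have pi0 := pi_gt0 R.
have -> : powR d (2 / p * q) = powR (d ^+ 2) (q / p).
  by rewrite -(powR_mulrn 2 (ltW d0)) -powRrM mulrAC mulrA.
rewrite -powRM ?mulr_ge0 ?exprn_ge0 ?(ltW d0) ?(ltW pi0)//.
apply: ge0_ler_powR; rewrite ?nnegrE ?divr_ge0 ?mulr_ge0 ?exprn_ge0 ?(ltW d0) ?(ltW pi0)
  ?(ltW p0)//.
rewrite ler_pdivrMr// (le_trans I)// le_eqVlt; apply/orP; left; apply/eqP; ring.
Qed.

(** Take [b] on the ray through [z] with modulus [1 + ddist z], and [b = 2] if [z = 0]. Then
    [|b - z| = 2 ddist z], and [2 + 1/2 <= 4]. *)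
Lemma cover_ball z : discC z -> exists2 b : R[i], 1 + ddist z <= cabs b &
  pball z (ddist z / 2) `<=` pball b (4 * ddist z).
Proof.
move=> zD; have d0 : 0 < ddist z by rewrite subr_gt0.
have [b bz bE] : exists2 b : R[i], cabs (b - z) = 2 * ddist z & cabs b = 1 + ddist z.
  have [->|z0] := eqVneq z 0.
    exists (2%:C); rewrite ?subr0 ?cabsR ?ger0_norm /ddist ?cabs0 ?subr0 ?ler0n ?mulr1//.
  have cz : 0 < cabs z by rewrite cabs_gt0.
  exists (((1 + ddist z) / cabs z)%:C * z).
    have -> : ((1 + ddist z) / cabs z)%:C * z - z = ((1 + ddist z) / cabs z - 1)%:C * z.
      by rewrite rmorphB mulrBl mul1r.
    have -> : (1 + ddist z) / cabs z - 1 = 2 * ddist z / cabs z.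
      by rewrite /ddist; field; rewrite gt_eqF.
    have n0 : 0 <= 2 * ddist z / cabs z by rewrite divr_ge0 ?(ltW cz)// mulr_ge0 ?(ltW d0).
    by rewrite cabsM cabsR (ger0_norm n0) divfK ?gt_eqF.
  have n0 : 0 <= (1 + ddist z) / cabs z by rewrite divr_ge0 ?(ltW cz)// addr_ge0 ?(ltW d0).
  by rewrite cabsM cabsR (ger0_norm n0) divfK ?gt_eqF.
exists b; rewrite ?bE//.
by apply: pball_sub; rewrite cabsBC bz; clear - d0; lra.
Qed.

(** Suited to integrals that may be infinite for finitely many indices: the eventual bound gives
    finiteness as well. *)
Lemma cvge0_near (x : nat -> \bar R) : (forall j, 0 <= x j)%E ->
  (x j @[j --> \oo] --> 0%E <-> forall e : R, 0 < e -> \forall j \near \oo, (x j <= e%:E)%E).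
Proof.
move=> x0; split => [/fine_cvgP[xfin /cvgrPdist_le xc] e e0|h].
  have := xc e e0; apply: filterS2 xfin => j xj.
  rewrite sub0r normrN /= => H.
  by rewrite -(fineK xj) lee_fin (le_trans _ H)// ler_norm.
apply/fine_cvgP; split.
  by apply: filterS (h 1 ltr01) => j xj; rewrite ge0_fin_numE// (le_lt_trans xj)// ltry.
apply/cvgrPdist_le => e e0; apply: filterS (h e e0) => j xj.
have xf : x j \is a fin_num by rewrite ge0_fin_numE// (le_lt_trans xj)// ltry.
by rewrite sub0r normrN ger0_norm ?fine_ge0//= -lee_fin fineK.
Qed.

Lemma near_all_lt (P : nat -> nat -> Prop) m :
  (forall k, (k < m)%N -> \forall j \near \oo, P k j) ->
  \forall j \near \oo, forall k, (k < m)%N -> P k j.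
Proof.
elim: m => [_|m IH h]; first by near=> j.
have h1 := IH (fun k km => h k (leqW km)); have h2 := h m (ltnSn m).
apply: filterS2 h1 h2 => j H1 H2 k; rewrite ltnS leq_eqVlt => /predU1P[->//|]; exact: H1.
Unshelve. all: by end_near. Qed.

Lemma cderZ_disc k c f z : holo f -> discC z -> cder k (fun w => c * f w) z = c * cder k f z.
Proof.
move=> hf; move: z; apply: (@cder_has_disc R k _ (fun k z => c * cder k f z)) => // j w wD.
exact: has_cderZ (cderivable_has (holo_cder hf wD)).
Qed.

Lemma holoZ c f : holo f -> holo (fun w => c * f w).
Proof. by move=> hf z zD; exact: (has_cder_derive (has_cderZ c (cderivable_has (hf z zD)))).1. Qed.

Lemma sob_opZ n u c f z : holo f -> discC z ->
  sob_op n u (fun w => c * f w) z = c * sob_op n u f z.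
Proof.
by move=> hf zD; rewrite /sob_op mulr_sumr; apply: eq_bigr => k _; rewrite cderZ_disc// mulrCA.
Qed.

Lemma sob_intZ (mu : {measure set (plane R) -> \bar R}) n u q c f :
  (forall k, (k <= n)%N -> holo (u k)) -> holo f ->
  sob_int mu n u q (fun w => c * f w) = ((powR (cabs c) q)%:E * sob_int mu n u q f)%E.
Proof.
move=> hu hf; rewrite /sob_int -ge0_integralZl//; first last.
- by rewrite lee_fin powR_ge0.
- by move=> x _; rewrite lee_fin powR_ge0.
- exact: (holo_measurable_powR q (sob_op_holo hu hf)).
- exact: measurable_disc.
apply: eq_integral => x /set_mem xD.
by rewrite sob_opZ// cabsM powRM ?cabs_ge0// EFinM.
Qed.

Lemma bergmanZ p c f : 0 < p -> bergman p f ->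
  bergman p (fun w => c * f w) /\ bnorm p (fun w => c * f w) = cabs c * bnorm p f.
Proof.
move=> p0 [hf fin].
have E : bergman_int p (fun w => c * f w) = ((powR (cabs c) p)%:E * bergman_int p f)%E.
  rewrite /bergman_int muleA -ge0_integralZl//; first last.
  - by rewrite lee_fin powR_ge0.
  - by move=> x _; rewrite lee_fin powR_ge0.
  - exact: (holo_measurable_powR p hf).
  - exact: measurable_disc.
  congr (_ * _)%E; apply: eq_integral => x _.
  by rewrite cabsM powRM ?cabs_ge0// EFinM.
have b0 : (0 <= bergman_int p f)%E.
  apply: mule_ge0; last by rewrite lee_fin invr_ge0 pi_ge0.
  by apply: integral_ge0 => x _; rewrite lee_fin powR_ge0.
have bf : bergman_int p f \is a fin_num by rewrite ge0_fin_numE.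
split; first by split; [exact: holoZ|rewrite E -(fineK bf) -EFinM ltry].
rewrite /bnorm E fineM// powRM ?powR_ge0 ?fine_ge0//.
by rewrite -powRrM divff ?gt_eqF// powRr1 ?cabs_ge0.
Qed.

End Final.

(** * From small measures of balls to the vanishing condition *)

Section Vanishing.
Variable R : realType.
Implicit Types (f g : R[i] -> R[i]) (z w b : R[i]) (p q r d : R).

(** For [|z| < r], Cauchy's estimate uses the ball of radius [s - r] around [z], which lies in the
    compact disc of radius [s], where the convergence is uniform. *)
Lemma cder_unif_small k (r s e : R) (fs : nat -> R[i] -> R[i]) :
  r < s -> s < 1 -> 0 < e -> (forall j, holo (fs j)) -> ucc_to0 fs ->
  \forall j \near \oo, forall z, cabs z < r -> cabs (cder k (fs j) z) <= e.
Proof.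
move=> rs s1 e0 hfs uc; have [C C0 HC] := @cauchy_estimate R k.
have sr0 : 0 < s - r by rewrite subr_gt0.
set eta := e / (C / (s - r) ^+ k).
have c0 : 0 < C / (s - r) ^+ k by rewrite divr_gt0// exprn_gt0.
have eta0 : 0 < eta by rewrite divr_gt0.
have sK : [set w : R[i]^o | cabs (w - 0) <= s] `<=` @discC R.
  by move=> w /=; rewrite subr0 => /le_lt_trans; exact.
have := uc _ (@compact_cball R 0 s) sK eta eta0.
apply: filterS => j Hj z zr.
have -> : e = C * eta / (s - r) ^+ k by rewrite mulrAC mulrC divfK ?gt_eqF.
apply: HC => // w wz.
have ws : cabs w <= s by have := cabsD (w - z) z; rewrite subrK; clear - zr wz; lra.
by split; [exact: le_lt_trans ws s1|apply/ltW/Hj; rewrite /= subr0].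
Qed.

(** The finiteness of [nu] on the disc serves twice: for the embedding on the annulus, and to
    integrate a uniformly small function over the inner disc. *)
Lemma vcarleson_of_balls k p q (nu : {measure set (plane R) -> \bar R}) :
  0 < p -> p <= q -> (nu (@disc R) < +oo)%E ->
  (forall e : R, 0 < e -> exists2 d0 : R, 0 < d0 & forall y, @disc R y -> ddist (toC y) < d0 ->
     (nu (@disc R `&` pball (toC y) (ddist (toC y) / 2)) <=
       (e * powR (ddist (toC y)) ((k%:R + 2 / p) * q))%:E)%E) ->
  vcarleson k p q nu.
Proof.
move=> p0 pq nufin H fs [fsB [M fsM]] uc.
have q0 : 0 < q := lt_le_trans p0 pq.
have mdisc := @measurable_disc R.
apply/(cvge0_near (fun j => der_int_ge0 q nu k (fs j))) => e e0.
have [C C0 HC] := @carleson_embed R k p q p0 pq.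
have Mq0 : 0 < powR M q + 1 by rewrite ltr_wpDl// powR_ge0.
set e1 := e / 2 / (C * (powR M q + 1)).
have e10 : 0 < e1 by rewrite !divr_gt0// mulr_gt0.
have [d0 d00 Hd] := H e1 e10.
(* A ball [B(y, ddist y / 2)] with [ddist y >= d0] stays in [|x| < r] and misses [E], so the bound
   on balls is only needed near the circle; [s] leaves room for Cauchy's estimate. *)
set r := 1 - d0 / 2; set s := 1 - d0 / 4.
have rs : r < s by rewrite /r /s; clear - d00; lra.
have s1 : s < 1 by rewrite /s; clear - d00; lra.
set F := @pball R 0 r; set E := @disc R `\` F.
have FE x : F x = (cabs (toC x) < r) by rewrite /F /pball /mkset subr0.
have mF : measurable F by exact: measurable_pball.
have mE : measurable E by exact: measurableD.
have ED : E `<=` @disc R by move=> x [].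
have FD : F `<=` @disc R.
  by move=> x; rewrite FE => xr; exact: lt_trans xr (lt_trans rs s1).
have nuE : (nu E < +oo)%E by apply: le_lt_trans nufin; apply: le_measure; rewrite ?inE.
have nuF : (nu F < +oo)%E by apply: le_lt_trans nufin; apply: le_measure; rewrite ?inE.
set V := fine (nu F).
have V0 : 0 <= V by exact: fine_ge0.
have VE : nu F = V%:E by rewrite fineK// ge0_fin_numE.
have hfs j : holo (fs j) := (fsB j).1.
(* Chosen so that [eta^q (V + 1) = e / 2]. *)
set eta := powR (e / 2 / (V + 1)) q^-1.
have V1 : 0 < V + 1 by rewrite ltr_wpDl.
have eV0 : 0 < e / 2 / (V + 1) by rewrite !divr_gt0.
have eta0 : 0 < eta by rewrite powR_gt0.
have := @cder_unif_small k r s eta fs rs s1 eta0 hfs uc.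
apply: filterS => j Hj.
have mf : measurable_fun (@disc R) (fun x => (powR (cabs (cder k (fs j) (toC x))) q)%:E).
  exact: (holo_measurable_powR q (holo_cder (k := k) (hfs j))).
have DE : @disc R = E `|` F by rewrite setUC /E setDUK.
have f0 x : (0 <= (powR (cabs (cder k (fs j) (toC x))) q)%:E)%E by rewrite lee_fin powR_ge0.
rewrite /der_int {1}DE ge0_integral_setU//; last 2 first.
- by rewrite -DE.
- by rewrite disj_set2E /E setDKI.
have -> : e = e / 2 + e / 2 by rewrite -splitr.
rewrite EFinD; apply: leeD.
  have h1 : (forall y, @disc R y -> (nu (pball (toC y) (ddist (toC y) / 2) `&` E) <=
     (e1 * powR (ddist (toC y)) ((k%:R + 2 / p) * q))%:E)%E).
    move=> y yD; have [dy|dy] := ltP (ddist (toC y)) d0.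
      apply: le_trans (Hd y yD dy); apply: le_measure; rewrite ?inE.
      - by apply: measurableI => //; exact: measurable_pball.
      - by apply: measurableI => //; exact: measurable_pball.
      - by rewrite setIC; apply: setSI.
    suff -> : pball (toC y) (ddist (toC y) / 2) `&` E = set0.
      by rewrite measure0 lee_fin mulr_ge0 ?powR_ge0// ltW.
    rewrite -subset0 => x [xy [_ xF]]; apply: xF; rewrite FE /r.
    have T := cabsD (toC x - toC y) (toC y); rewrite subrK in T.
    rewrite /pball /mkset in xy.
    by rewrite /ddist in xy dy; clear - T xy dy; lra.
  apply: (le_trans (HC nu E e1 (fs j) mE ED nuE (ltW e10) h1 (fsB j))).
  rewrite lee_fin.
  have -> : e / 2 = C * e1 * (powR M q + 1).
    by rewrite /e1; field; rewrite ?gt_eqF// mulr_gt0.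
  apply: ler_wpM2l; first by rewrite mulr_ge0// ltW.
  apply: (@le_trans _ _ (powR M q)); last by rewrite lerDl.
  by apply: ge0_ler_powR; rewrite ?nnegrE ?(ltW q0)// ?(le_trans _ (fsM 0%N)) ?powR_ge0.
apply: (@le_trans _ _ (\int[nu]_(x in F) (cst (powR eta q)%:E x))%E).
  apply: ge0_le_integral => //.
  - exact: measurable_funS mf.
  - move=> x; rewrite FE lee_fin => xr.
    by apply: ge0_ler_powR; rewrite ?nnegrE ?(ltW q0) ?cabs_ge0 ?(ltW eta0)//; exact: Hj.
rewrite integral_cst// VE -EFinM lee_fin /eta -powRrM mulVf ?gt_eqF// powRr1 ?(ltW eV0)//.
rewrite mulrAC ler_pdivrMr//; apply: ler_wpM2l; first by rewrite divr_ge0// ltW.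
by rewrite lerDl.
Qed.

End Vanishing.

(** * The two equivalences *)

Section Main.
Variables (R : realType) (n : nat) (p q : R) (u : nat -> R[i] -> R[i]).
Variables (mu : {measure set (plane R) -> \bar R}) (nu : nat -> {measure set (plane R) -> \bar R}).
Hypotheses (p0 : 0 < p) (pq : p <= q).
Hypothesis hu : forall k, (k <= n)%N -> holo (u k).
Hypothesis nuE : forall k (A : set (plane R)), (k <= n)%N -> measurable A ->
  nu k A = (\int[mu]_(x in A) (powR (cabs (u k (toC x))) q)%:E)%E.

Let q0 : 0 < q. Proof. exact: lt_le_trans p0 pq. Qed.
Let N := Num.bound (4 / p).

Let expo_ge m : 4 <= (N + m)%:R * p.
Proof.
rewrite -ler_pdivrMr// (le_trans (ltW (archi_boundP _)))//; last by rewrite ler_nat leq_addr.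
by rewrite divr_ge0// ltW.
Qed.

(** Shared by both equivalences: [K] is a fixed constant in the bounded case and arbitrarily small
    in the vanishing case, which is why [C] is chosen before it. *)
Lemma nu_ball_le : exists2 C : R, 0 < C & forall k (y : plane R) (K : R),
  (k <= n)%N -> @disc R y -> 0 <= K ->
  (forall b m, 1 + ddist (toC y) <= cabs b -> (m <= n)%N ->
    (sob_int mu n u q (tfun b (ddist (toC y)) (N + m)) <=
      (K * powR (ddist (toC y)) (2 / p * q))%:E)%E) ->
  (nu k (@disc R `&` pball (toC y) (ddist (toC y) / 2)) <=
    (C * K * powR (ddist (toC y)) ((k%:R + 2 / p) * q))%:E)%E.
Proof.
have [C C0 HC] := test_estimate n N q0.
exists (C * n.+1%:R); first by rewrite mulr_gt0// ltr0n.
move=> k y K kn yD K0 H; set d := ddist (toC y) in H *.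
have d0 : 0 < d by rewrite subr_gt0.
have [b bd sub] := @cover_ball R (toC y) yD.
apply: (@le_trans _ _ (nu k (@disc R `&` pball b (4 * d)))).
  apply: le_measure; rewrite ?inE.
  - by apply: measurableI; [exact: measurable_disc|exact: measurable_pball].
  - by apply: measurableI; [exact: measurable_disc|exact: measurable_pball].
  - exact: setIS.
apply: (le_trans (HC u mu nu hu nuE b d k d0 bd kn)).
have c0 : 0 <= C * powR d (k%:R * q) by rewrite mulr_ge0 ?powR_ge0// ltW.
apply: (@le_trans _ _ ((C * powR d (k%:R * q))%:E *
    \sum_(m < n.+1) (K * powR d (2 / p * q))%:E)%E).
  by apply: lee_wpmul2l; [rewrite lee_fin|apply: lee_sum => m _; exact: H (ltn_ord m)].
rewrite sumEFin -EFinM lee_fin sumr_const card_ord -[_ *+ n.+1]mulr_natl [(_ + 2 / p) * q]mulrDl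
  powRD; last first.
  by rewrite (gt_eqF d0) implybT.
by rewrite le_eqVlt; apply/orP; left; apply/eqP; ring.
Qed.

(** For [b = 2] and [d = 1] the ball of radius [4 d] contains the disc, so [test_estimate] bounds
    the total mass. *)
Lemma nu_disc_fin k : (k <= n)%N ->
  (forall m, (m <= n)%N -> (sob_int mu n u q (tfun (2%:C) 1 (N + m)) < +oo)%E) ->
  (nu k (@disc R) < +oo)%E.
Proof.
move=> kn H; have [C C0 HC] := test_estimate n N q0.
have c2 : cabs (2%:C : R[i]) = 2 by rewrite cabsR ger0_norm.
have bd : 1 + 1 <= cabs (2%:C : R[i]) by rewrite c2.
have := HC u mu nu hu nuE (2%:C) 1 k ltr01 bd kn.
have -> : @disc R `&` pball (2%:C) (4 * 1) = @disc R.
  apply/setIidl => x xD; rewrite /pball /mkset mulr1.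
  have := cabsD (toC x) (- (2%:C)); rewrite cabsN c2.
  move=> /le_lt_trans; apply; have -> : 4 = 2 + 2 :> R by ring.
  by rewrite ltrD2r (lt_trans xD)// ltr1n.
move=> /le_lt_trans; apply; apply: lte_mul_pinfty => //.
  by rewrite lee_fin mulr_ge0 ?powR_ge0// ltW.
by apply: lte_sum_pinfty => m _; exact: H (ltn_ord m).
Qed.

Lemma carleson_of_sob_carleson : sob_carleson n u p q mu -> forall k, (k <= n)%N -> carleson k p
  q (nu k).
Proof.
move=> [C C0 HC] k kn.
have tfun_le b d m : 0 < d -> 1 + d <= cabs b ->
    (sob_int mu n u q (tfun b d (N + m)) <=
      (C * powR (4 * pi) (q / p) * powR d (2 / p * q))%:E)%E.
  move=> d0 bd; have [B Bq] := tfun_bergman p0 d0 bd (expo_ge m).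
  by rewrite (le_trans (HC _ B))// lee_fin -mulrA ler_wpM2l ?(ltW C0)// Bq// ltW.
have fin : (nu k (@disc R) < +oo)%E.
  apply: nu_disc_fin => // m _; apply: le_lt_trans (tfun_le _ _ _ ltr01 _) (ltry _).
  by rewrite cabsR ger0_norm.
have [C1 C10 H1] := nu_ball_le.
have [C2 C20 H2] := @carleson_embed R k p q p0 pq.
set K := C * powR (4 * pi) (q / p).
have K0 : 0 < K by rewrite mulr_gt0// powR_gt0// mulr_gt0// pi_gt0.
exists (C2 * (C1 * K)); first by rewrite mulr_gt0 ?(mulr_gt0 C10 K0).
move=> f fB; apply: H2 => //.
- exact: measurable_disc.
- by rewrite mulr_ge0// ltW.
- move=> y yD; rewrite setIC; apply: H1 => //; first exact: ltW.
  by move=> b m bd _; apply: tfun_le => //; rewrite subr_gt0.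
Qed.

Lemma sob_carleson_of_carleson : (forall k, (k <= n)%N -> carleson k p q (nu k)) -> sob_carleson
  n u p q mu.
Proof.
move=> H.
(* The constants are chosen for all [k] at once, with the default 0 for [k > n]. *)
have /choice[C HC] : forall k, exists C : R, (k <= n)%N -> 0 < C /\
    forall f, bergman p f -> (der_int (nu k) k q f <= (C * powR (bnorm p f) q)%:E)%E.
  by move=> k; have [/H[C C0 HC]|_] := leqP k n; [exists C|exists 0].
have s0 : 0 < \sum_(k < n.+1) C k.
  rewrite big_ord_recl ltr_pwDl//; first exact: (HC 0%N isT).1.
  by apply: sumr_ge0 => k _; apply/ltW/(HC _ _).1; exact: (ltn_ord (lift ord0 k)).
exists (powR n.+1%:R q * \sum_(k < n.+1) C k).
  by rewrite mulr_gt0// powR_gt0// ltr0n.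
move=> f fB; apply: (le_trans (sob_int_le_der q0 hu nuE fB.1)).
rewrite -mulrA [leRHS]EFinM; apply: lee_wpmul2l; first by rewrite lee_fin powR_ge0.
by rewrite mulr_suml -sumEFin; apply: lee_sum => k _; exact: (HC k (ltn_ord k)).2.
Qed.

Lemma sob_vcarleson_of_vcarleson : (forall k, (k <= n)%N -> vcarleson k p q (nu k)) ->
  sob_vcarleson n u p q mu.
Proof.
move=> H fs fsB uc; apply/(cvge0_near (fun j => sob_int_ge0 n q u mu (fs j))) => e e0.
set A := powR n.+1%:R q; have A0 : 0 < A by rewrite powR_gt0// ltr0n.
have B0 : 0 < n.+1%:R * A by rewrite mulr_gt0// ltr0n.
set e1 := e / (n.+1%:R * A).
have e10 : 0 < e1 by rewrite divr_gt0.
have h k : (k < n.+1)%N -> \forall j \near \oo, (der_int (nu k) k q (fs j) <= e1%:E)%E.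
  move=> kn; have := H k kn fs fsB uc.
  have [Hc _] := cvge0_near (fun j => der_int_ge0 q (nu k) k (fs j)).
  by move=> /Hc; exact.
have := near_all_lt h.
apply: filterS => j Hj; apply: (le_trans (sob_int_le_der q0 hu nuE (fsB.1 j).1)).
apply: (@le_trans _ _ (A%:E * \sum_(k < n.+1) e1%:E)%E).
  by apply: lee_wpmul2l; [rewrite lee_fin ltW|apply: lee_sum => k _; exact: Hj].
rewrite sumEFin -EFinM lee_fin sumr_const card_ord -[_ *+ n.+1]mulr_natl mulrA.
by rewrite [A * _]mulrC [_ * e1]mulrC divfK ?gt_eqF.
Qed.

Section VanishingTest.
Hypothesis H : sob_vcarleson n u p q mu.

(* The hypothesis is only about limits: it is applied to the sequence
   [tfun / (j + 1)]. *)
Lemma sob_int_tfun_fin b d m : 0 < d -> 1 + d <= cabs b ->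
  (sob_int mu n u q (tfun b d (N + m)) < +oo)%E.
Proof.
move=> d0 bd; have [B _] := tfun_bergman p0 d0 bd (expo_ge m).
set f := tfun b d (N + m) in B *.
pose c (j : nat) : R := j.+1%:R^-1.
have c0 j : 0 < c j by rewrite invr_gt0 ltr0n.
have cE j : cabs ((c j)%:C) = c j by rewrite cabsR gtr0_norm.
have f1 z : discC z -> cabs (f z) <= 1.
  move=> zD; rewrite cabs_tfun// exprn_ile1//; have far := tfun_far bd zD.
    by rewrite divr_ge0 ?cabs_ge0 ?ltW.
  by rewrite ler_pdivrMr ?mul1r// (lt_le_trans d0).
pose fs j w := (c j)%:C * f w.
have fsB : bounded_seq p fs.
  split; first by move=> j; exact: (bergmanZ _ p0 B).1.
  exists (bnorm p f) => j; rewrite (bergmanZ _ p0 B).2 cE ler_piMl ?powR_ge0//.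
  by rewrite invf_le1 ?ltr0n// ler1n.
have uc : ucc_to0 fs.
  move=> K _ KD e e0; have := near_infty_natSinv_lt (PosNum e0); apply: filterS => j /= je z Kz.
  rewrite /fs cabsM cE (le_lt_trans _ je)// -[leRHS]mulr1.
  by apply: ler_wpM2l; [exact: ltW|exact/f1/KD].
have [Hc _] := cvge0_near (fun j => sob_int_ge0 n q u mu (fs j)).
(* One index with a scaled integral at most 1 suffices: as [c j > 0], an infinite integral would
   stay infinite after scaling. *)
have /filter_ex[j] := Hc (H fsB uc) 1 ltr01.
rewrite sob_intZ//; last exact: B.1.
rewrite cE => Hj; rewrite ltey; apply/eqP => E; move: Hj.
by rewrite E gt0_muley// lte_fin powR_gt0.
Qed.

Lemma sob_int_tfun_small e : 0 < e -> exists2 d0 : R, 0 < d0 & forall b d m,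
  0 < d -> d < d0 -> 1 + d <= cabs b -> (m <= n)%N ->
  (sob_int mu n u q (tfun b d (N + m)) <= (e * powR d (2 / p * q))%:E)%E.
Proof.
move=> e0; apply: contrapT => no.
have /choice[t Ht] : forall j : nat, exists t : R[i] * R * nat,
    [/\ 0 < t.1.2, t.1.2 < j.+1%:R^-1, 1 + t.1.2 <= cabs t.1.1 &
     ~ (sob_int mu n u q (tfun t.1.1 t.1.2 (N + t.2)) <= (e * powR t.1.2 (2 / p * q))%:E)%E].
  move=> j; apply: contrapT => noj; apply: no.
  exists j.+1%:R^-1; first by rewrite invr_gt0 ltr0n.
  move=> b d m d0 dj bd mn; apply: contrapT => nb.
  by apply: noj; exists (b, d, m).
pose d j := (t j).1.2; pose b j := (t j).1.1; pose M j := (N + (t j).2)%N.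
have d0 j : 0 < d j by have [] := Ht j.
have dj j : d j < j.+1%:R^-1 by have [] := Ht j.
have bd j : 1 + d j <= cabs (b j) by have [] := Ht j.
pose c j := powR (d j) (- (2 / p)).
have c0 j : 0 < c j by rewrite powR_gt0.
have cE j : cabs ((c j)%:C) = c j by rewrite cabsR gtr0_norm.
pose f j := tfun (b j) (d j) (M j).
pose fs j w := (c j)%:C * f j w.
have B j := tfun_bergman p0 (d0 j) (bd j) (expo_ge (t j).2).
have cK j s : powR (c j) s * powR (d j) (2 / p * s) = 1.
  by rewrite -powRrM -powRD ?(gt_eqF (d0 j)) ?implybT// mulNr addNr powRr0.
have fsB : bounded_seq p fs.
  split; first by move=> j; exact: (bergmanZ _ p0 (B j).1).1.
  exists (powR (4 * pi) (1 / p)) => j; rewrite (bergmanZ _ p0 (B j).1).2 cE.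
  have := (B j).2 1 ler01; rewrite powRr1 ?powR_ge0// => Bj.
  apply: (le_trans (ler_wpM2l (ltW (c0 j)) Bj)).
  by rewrite mulrCA -{1}[c j]powRr1 ?(ltW (c0 j))// cK mulr1.
have uc : ucc_to0 fs.
  move=> K cpK KD e' e'0; have [r /andP[r0 r1] Kr] := compact_disc_lt1 cpK KD.
  have s0 : 0 < 1 - r by rewrite subr_gt0.
  have sN0 : 0 < (1 - r) ^+ N by exact: exprn_gt0.
  (* [x] solves [x^(2/p) = e' (1 - r)^N], the bound wanted for [d^(2/p)]. *)
  set x := powR (e' * (1 - r) ^+ N) (p / 2).
  have x0 : 0 < x by rewrite powR_gt0// mulr_gt0.
  have m0 : 0 < Num.min (1 - r) x by rewrite lt_min s0 x0.
  have := near_infty_natSinv_lt (PosNum m0); apply: filterS => j /= je z Kz.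
  have := lt_trans (dj j) je; rewrite lt_min => /andP[ds dx].
  have far : 1 - r <= cabs (b j - z).
    apply: le_trans (cabsB_ge _ _); apply: lerB (Kr z Kz).
    by rewrite (le_trans _ (bd j))// lerDl ltW.
  have far0 := lt_le_trans s0 far.
  rewrite /fs cabsM cE cabs_tfun//.
  have a0 : 0 <= d j / cabs (b j - z) by rewrite divr_ge0 ?ltW.
  (* The exponents [M j] vary with [j], but they are at least [N] and the base is at most 1 once
     [d j < 1 - r]. *)
  have h1 : (d j / cabs (b j - z)) ^+ M j <= (d j / (1 - r)) ^+ N.
    apply: (@le_trans _ _ ((d j / cabs (b j - z)) ^+ N)).
      apply: ler_wiXn2l; rewrite ?leq_addr// ler_pdivrMr// mul1r.
      exact: ltW (lt_le_trans ds far).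
    apply: lerXn2r; rewrite ?nnegrE// ?divr_ge0 ?(ltW (d0 j)) ?(ltW s0)//.
    by apply: ler_wpM2l; [exact: ltW|rewrite lef_pV2].
  apply: (le_lt_trans (ler_wpM2l (ltW (c0 j)) h1)).
  rewrite expr_div_n mulrA ltr_pdivrMr//.
  have d1 : d j <= 1.
    by rewrite (le_trans (ltW ds))// gerBl ltW.
  have -> : c j * d j ^+ N = powR (d j) (N%:R - 2 / p).
    by rewrite -(powR_mulrn _ (ltW (d0 j))) -powRD ?(gt_eqF (d0 j)) ?implybT// addrC.
  (* Here [N >= 4 / p] gives [N - 2 / p >= 2 / p]: a positive power of [d] is left after the
     normalization. *)
  apply: (@le_lt_trans _ _ (powR (d j) (2 / p))).
    apply: ger_powR; first by rewrite d0 d1.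
    have := expo_ge 0; rewrite addn0 -ler_pdivrMr// => N4.
    by rewrite lerBrDr -mulrDl (le_trans _ N4)// ler_pM2r ?invr_gt0// -natrD.
  have -> : e' * (1 - r) ^+ N = powR x (2 / p).
    by rewrite /x -powRrM mulrA divfK ?divff ?powRr1// ?gt_eqF// mulr_ge0 ?ltW.
  by rewrite gt0_ltr_powR ?nnegrE ?ltW// ?divr_gt0.
have [Hc _] := cvge0_near (fun j => sob_int_ge0 n q u mu (fs j)).
have /filter_ex[j] := Hc (H fsB uc) e e0.
rewrite sob_intZ//; last exact: (B j).1.1.
rewrite cE => Hj; have [_ _ _] := Ht j; apply.
have a0 : (0 <= (powR (d j) (2 / p * q))%:E)%E by rewrite lee_fin powR_ge0.
have := lee_wpmul2l a0 Hj; rewrite muleA -!EFinM [X in (X%:E * _)%E]mulrC cK mul1e.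
by rewrite mulrC.
Qed.

Lemma vcarleson_of_sob_vcarleson k : (k <= n)%N -> vcarleson k p q (nu k).
Proof.
move=> kn; apply: vcarleson_of_balls => //.
  by apply: nu_disc_fin => // m _; apply: sob_int_tfun_fin; rewrite ?ltr01// cabsR ger0_norm.
move=> e e0; have [C C0 HC] := nu_ball_le.
have eC0 : 0 < e / C by rewrite divr_gt0.
have [d0 d00 Hd] := sob_int_tfun_small eC0.
exists d0 => // y yD yd.
have -> : e = C * (e / C) by rewrite mulrC divfK ?gt_eqF.
apply: HC => //; first exact: ltW.
by move=> b m bd mn; apply: Hd => //; rewrite subr_gt0.
Qed.

End VanishingTest.
End Main.

Local Close Scope classical_set_scope.
Local Close Scope complex_scope.

Theorem theorem1p1 (R : realType) (n : nat) (p q : R)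
  (u : nat -> R[i] -> R[i]) (mu : {measure set (plane R) -> \bar R})
  (nu : nat -> {measure set (plane R) -> \bar R}) :
  (0 < n)%N -> 0 < p -> p <= q ->
  (forall k, (k <= n)%N -> holo (u k)) ->
  (* nu k is the measure |u_k|^q d(mu) *)
  (forall k (A : set (plane R)), (k <= n)%N -> measurable A ->
     nu k A = (\int[mu]_(x in A) (powR (cabs (u k (toC x))) q)%:E)%E) ->
  (sob_carleson n u p q mu <->
     (forall k, (k <= n)%N -> carleson k p q (nu k))) /\
  (sob_vcarleson n u p q mu <->
     (forall k, (k <= n)%N -> vcarleson k p q (nu k))).
Proof.
move=> _ p0 pq hu nuE; split; split.
- exact: (carleson_of_sob_carleson p0 pq hu nuE).
- exact: (sob_carleson_of_carleson p0 pq hu nuE).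
- by move=> H k kn; exact: (vcarleson_of_sob_vcarleson p0 pq hu nuE H kn).
- exact: (sob_vcarleson_of_vcarleson p0 pq hu nuE).
Qed.
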